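(* Let $\mathbf k$ be a field of characteristic $0$, let $n\ge0$, let $Q_n$ be the quiver with two vertices $e_1,e_2$ and $n$ arrows from $e_2$ to $e_1$, and let $A=\mathbf kQ_n$ be its path algebra. Let $\mathcal C$ be the bounded derived (dg-)category of right $A$-modules, with the monoidal structure given by the vertexwise tensor product of quiver representations. Then $$TH^\bullet(\mathcal C)=0.$$
   Context: **Monoidal structure.** A right $A$-module $M$ is a collection of vector spaces $M_v$ indexed by vertices $v$, with linear maps $f_x^M:M_v\to M_w$ for each arrow $x:w\to v$. The tensor product is $(M\otimes_{\mathcal C}N)_v=M_v\otimes_{\mathbf k}N_v$, $f_x^{M\otimes N}=f_x^M\otimes f_x^N$. It is extended to complexes, with the usual associators of vector spaces. $TH^\bullet(\mathcal C)$ is the cohomology of the $\otimes$-Hochschild complex $TC^\bullet(\mathcal C)$ defined as follows. **Conventions.** $R=\mathbf k$; the associators are $a_{X,Y,Z}:(X\otimes Y)\otimes Z\to X\otimes(Y\otimes Z)$. Unbracketed tensor products are bracketed from the left. Whenever a formula below produces a morphism between differently bracketed products, it is composed with canonical isomorphisms built from associators to become a morphism between left-bracketed products. The Koszul sign rule is used. **Cochains.** For $p,q\ge0$ let $$\widetilde C^{p,q}=\prod_{(X_{ij})_{0\le i\le p,\,0\le j\le q}}\mathrm{Hom}_R\Big(\bigotimes_{0\le i\le p,\ 0\le j<q}\mathrm{Hom}_{\mathcal C}(X_{ij},X_{i,j+1}),\ \mathrm{Hom}_{\mathcal C}\big(\bigotimes_i X_{i0},\bigotimes_i X_{iq}\big)\Big).$$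 The reduced cochains $C^{p,q}\subset\widetilde C^{p,q}$ are those vanishing on every $(f_{ij})$ having some $j$ with $f_{ij}=\mathrm{Id}$ for all $i$. Put $TC^m=\bigoplus_{p+q+r=m}(C^{p,q})^r$, where $r$ is the cohomological degree. **Aposets.** A path in a poset is a totally ordered subset $(p_0<\dots<p_m)$. An aposet is a poset with a collection $\mathcal A$ of admissible paths. $I_m$ is the chain $0<\dots<m$, its only admissible path being the whole of $I_m$. A path in a product $S\times T$ of aposets is admissible iff there are admissible $Q\subset S$, $U\subset T$ such that it runs from (first of $Q$, first of $U$) to (last of $Q$, last of $U$), each step moving between consecutive elements of $Q$ (horizontal) or of $U$ (vertical) with the other coordinate fixed. $A_m$ is the set of vertices of the $m$-dimensional associahedron (full bracketings of $m+2$ letters) ordered by $(UV)W\to U(VW)$, with terminal vertex the right-bracketed one; codimension 1 faces are of the form $A_k\times A_l$, $k+l=m-1$. Inductively, the point is admissible in $A_0$, and $(p_0<\dots<p_m)$ is admissible in $A_m$ ($m\ge1$) iff $p_m$ is terminal and $(p_0,\dots,p_{m-1})$ is admissible in a codimension 1 face. **Differential.** $d=\delta+\sum_{i\ge0}d_i$, with $\delta$ the internal differential and $d_i:C^{p,q}\to C^{p+i,q-i+1}$, with signs (overall signs of $\delta,d_0,d_1$ depending on $p,q,r$; signs $\pm$ in $d_i$, $i\ge2$) chosen so that $d^2=0$. For $\phi\in C^{p,q}$: $$(d_0\phi)(\{f_{ij}\})=\phi(\{f_{ij}\}_{j\ne0})\circ(\otimes_i f_{i0})+\sum_{j=0}^{q-1}(-1)^{j+1}\phi(\dots,f_{i,j+1}f_{ij},\dots)+(-1)^{q+1}(\otimes_i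 f_{iq})\circ\phi(\{f_{ij}\}_{j\neq q}).$$ For $\phi\in C^{p-1,q}$: $$(d_1\phi)(\{f_{ij}\})=(f_{0,q-1}\cdots f_{00})\otimes\phi(\{f_{ij}\}_{i\ne0})+\sum_{i=0}^{p-1}(-1)^{i+1}\phi(\dots,f_{ij}\otimes f_{i+1,j},\dots)+(-1)^{p+1}\phi(\{f_{ij}\}_{i\neq p})\otimes(f_{p,q-1}\cdots f_{p0}).$$ For $i\ge2$, $\phi\in C^{p-i,q+i-1}$: $(d_i\phi)(\{f_{kl}\})=\sum_{j=0}^{p-i}\sum_{P\in\mathcal A(A_{i-1}\times I_q)}\pm\phi(P(f))$, where $P(f)_{kl}$ ($0\le k\le p-i$, $0\le l<q+i-1$) is as follows. For a vertical step $((t,m),(t,m+1))$ of $P$ at place $l$: $f_{km}$ if $k<j$, $t(f_{jm},\dots,f_{j+i,m})$ if $k=j$, $f_{k+i,m}$ if $k>j$. For a horizontal step $((s,m),(t,m))$: $\mathrm{Id}_{X_{km}}$ if $k<j$, the canonical associator map $s(X_{jm},\dots,X_{j+i,m})\to t(X_{jm},\dots,X_{j+i,m})$ if $k=j$, $\mathrm{Id}_{X_{k+i,m}}$ if $k>j$. *)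

(* Defs.v *)
From HB Require Import structures.
From Stdlib Require Relation_Operators.
From mathcomp Require Import all_boot all_order all_algebra.
From mathcomp Require Import boolp classical_sets functions.

Set Implicit Arguments.
Unset Strict Implicit.
Unset Printing Implicit Defensive.

Import GRing.Theory.
Local Open Scope ring_scope.

Section Tensor.
Context {k : fieldType}.

Definition is_bilin (U V W : lmodType k) (b : U -> V -> W) : Prop :=
  (forall u, linear (b u)) /\ (forall v, linear (b^~ v)).

Section TensorProduct.
Variables U V : lmodType k.

Definition sum_of (W : lmodType k) (b : U -> V -> W) (s : seq (U * V)) : W :=
  \sum_(uv <- s) b uv.1 uv.2.

(* U ⊗ V is the quotient of the finite formal sums of pairs by the relation    *)
(* that no bilinear map separates them; [tlift_mk] and [tprod_ext] are its     *)
(* universal property.                                                         *)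
Definition tequiv (s t : seq (U * V)) : bool :=
  `[< forall (W : lmodType k) (b : U -> V -> W),
        is_bilin b -> sum_of b s = sum_of b t >].

Lemma tequiv_equiv : equiv_class_of tequiv.
Proof.
split=> [s|s t|t s u].
- by apply/asboolP.
- by apply/asboolP/asboolP => h W b bb; rewrite h.
- by move=> /asboolP h1 /asboolP h2; apply/asboolP => W b bb; rewrite h1 ?h2.
Qed.

Canonical tequiv_rel := EquivRelPack tequiv_equiv.

Definition tprod : Type := {eq_quot tequiv_rel}%qT.
HB.instance Definition _ := Choice.on tprod.

Definition tclass (s : seq (U * V)) : tprod := (\pi_({eq_quot tequiv_rel}) s)%qT.
Definition trepr (t : tprod) : seq (U * V) :=
  (@repr _ {eq_quot tequiv_rel}%qT t).

Definition tlift (W : lmodType k) (b : U -> V -> W) (t : tprod) : W :=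
  sum_of b (trepr t).

Lemma tlift_class (W : lmodType k) (b : U -> V -> W) s :
  is_bilin b -> tlift b (tclass s) = sum_of b s.
Proof.
move=> bb; rewrite /tlift.
have : trepr (tclass s) = s %[mod {eq_quot tequiv_rel}]%qT.
  by rewrite /trepr /tclass reprK.
by move/eqmodP/asboolP; apply.
Qed.

Lemma tprodP (x y : tprod) :
  (forall (W : lmodType k) (b : U -> V -> W), is_bilin b -> tlift b x = tlift b y)
  -> x = y.
Proof.
move=> h; rewrite -[x]reprK -[y]reprK.
by apply/eqmodP/asboolP => W b bb; apply: h.
Qed.

Definition tadd (x y : tprod) := tclass (trepr x ++ trepr y).
Definition tscale (a : k) (x : tprod) :=
  tclass [seq (a *: uv.1, uv.2) | uv <- trepr x].
Definition tzero : tprod := tclass [::].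
Definition topp (x : tprod) := tscale (-1) x.

Section Lifts.
Variables (W : lmodType k) (b : U -> V -> W).
Hypothesis bb : is_bilin b.

Lemma bilin_scalel a u v : b (a *: u) v = a *: b u v.
Proof.
have /(_ a u 0) := bb.2 v; rewrite addr0 => ->.
suff -> : b 0 v = 0 by rewrite addr0.
have /(_ (-1) 0 0) := bb.2 v.
by rewrite scaler0 addr0 scaleN1r addNr.
Qed.

Lemma tlift_add x y : tlift b (tadd x y) = tlift b x + tlift b y.
Proof. by rewrite tlift_class // /sum_of big_cat. Qed.
Lemma tlift_scale a x : tlift b (tscale a x) = a *: tlift b x.
Proof.
rewrite tlift_class // /sum_of big_map scaler_sumr.
by apply: eq_bigr => uv _; rewrite bilin_scalel.
Qed.
Lemma tlift_zero : tlift b tzero = 0.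
Proof. by rewrite tlift_class // /sum_of big_nil. Qed.
Lemma tlift_opp x : tlift b (topp x) = - tlift b x.
Proof. by rewrite tlift_scale scaleN1r. Qed.
End Lifts.

Fact taddA : associative tadd.
Proof. by move=> x y z; apply: tprodP => W b bb; rewrite !tlift_add // addrA. Qed.
Fact taddC : commutative tadd.
Proof. by move=> x y; apply: tprodP => W b bb; rewrite !tlift_add // addrC. Qed.
Fact tadd0 : left_id tzero tadd.
Proof.
by move=> x; apply: tprodP => W b bb; rewrite tlift_add // tlift_zero // add0r.
Qed.
Fact taddN : left_inverse tzero topp tadd.
Proof.
move=> x; apply: tprodP => W b bb.
by rewrite tlift_add // tlift_opp // tlift_zero // addNr.
Qed.

HB.instance Definition _ := GRing.isZmodule.Build tprod taddA taddC tadd0 taddN.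

Fact tscaleA a b (x : tprod) : tscale a (tscale b x) = tscale (a * b) x.
Proof.
by apply: tprodP => W c cb; rewrite !tlift_scale // scalerA.
Qed.
Fact tscale1 : left_id 1 tscale.
Proof. by move=> x; apply: tprodP => W c cb; rewrite tlift_scale // scale1r. Qed.
Fact tscaleDr : right_distributive tscale +%R.
Proof.
move=> a x y; apply: tprodP => W c cb.
by rewrite tlift_scale // !tlift_add // !tlift_scale // scalerDr.
Qed.
Fact tscaleDl (x : tprod) : {morph tscale^~ x : a b / a + b}.
Proof.
move=> a b; apply: tprodP => W c cb.
by rewrite tlift_scale // tlift_add // !tlift_scale // scalerDl.
Qed.

HB.instance Definition _ :=
  GRing.Zmodule_isLmodule.Build k tprod tscaleA tscale1 tscaleDr tscaleDl.

Definition tmk (u : U) (v : V) : tprod := tclass [:: (u, v)].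

Lemma tlift_linear (W : lmodType k) (b : U -> V -> W) :
  is_bilin b -> linear (tlift b : tprod -> W).
Proof. by move=> bb a x y; rewrite tlift_add // tlift_scale. Qed.

Lemma tlift_mk (W : lmodType k) (b : U -> V -> W) u v :
  is_bilin b -> tlift b (tmk u v) = b u v.
Proof. by move=> bb; rewrite tlift_class // /sum_of big_seq1. Qed.

Lemma tmk_bilin : is_bilin tmk.
Proof.
split=> w a x y; apply: tprodP => W b bb; rewrite tlift_linear // !tlift_mk //.
- exact: bb.1.
- exact: bb.2.
Qed.

Lemma tclassE s : tclass s = sum_of tmk s.
Proof.
apply: tprodP => W b bb; rewrite tlift_class //.
elim: s => [|[u v] s IH]; first by rewrite /sum_of !big_nil tlift_zero.
by rewrite /sum_of !big_cons tlift_add // tlift_mk // -/(sum_of _ _) IH.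
Qed.

Lemma tspan (x : tprod) : exists s, x = sum_of tmk s.
Proof. by exists (trepr x); rewrite -tclassE /tclass /trepr reprK. Qed.

Lemma tprod_ext (W : lmodType k) (f g : {linear tprod -> W}) :
  (forall u v, f (tmk u v) = g (tmk u v)) -> f =1 g.
Proof.
move=> fg x; have [s ->] := tspan x; rewrite /sum_of !linear_sum.
by apply: eq_bigr => uv _; apply: fg.
Qed.

End TensorProduct.

Lemma tmkDl (U V : lmodType k) (v : V) : linear ((@tmk U V)^~ v).
Proof. exact: (tmk_bilin U V).2. Qed.
Lemma tmkDr (U V : lmodType k) (u : U) : linear (@tmk U V u).
Proof. exact: (tmk_bilin U V).1. Qed.
HB.instance Definition _ (U V : lmodType k) (u : U) :=
  GRing.isLinear.Build k V (tprod U V) *:%R (@tmk U V u) (@tmkDr U V u).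

Lemma tmk0l (U V : lmodType k) (v : V) : tmk (0 : U) v = 0.
Proof.
have := @tmkDl U V v (-1) 0 0.
by rewrite scaler0 addr0 scaleN1r addNr.
Qed.
Lemma tmk0r (U V : lmodType k) (u : U) : tmk u (0 : V) = 0.
Proof. exact: linear0. Qed.
Lemma tmkZl (U V : lmodType k) a (u : U) (v : V) : tmk (a *: u) v = a *: tmk u v.
Proof. by have := @tmkDl U V v a u 0; rewrite tmk0l !addr0. Qed.
Lemma tmkD1 (U V : lmodType k) (u u' : U) (v : V) :
  tmk (u + u') v = tmk u v + tmk u' v.
Proof. by have := @tmkDl U V v 1 u u'; rewrite !scale1r. Qed.
Lemma tmk_suml (U V : lmodType k) I (r : seq I) (P : pred I) (F : I -> U) (v : V) :
  tmk (\sum_(i <- r | P i) F i) v = \sum_(i <- r | P i) tmk (F i) v.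
Proof.
by elim/big_rec2: _ => [|i x y _ <-]; rewrite ?tmk0l ?tmkD1.
Qed.

Section TensorMap.
Variables (U V U' V' : lmodType k).

Definition tmap (f : U -> U') (g : V -> V') : tprod U V -> tprod U' V' :=
  tlift (fun u v => tmk (f u) (g v)).

Lemma tmap_bilin (f : {linear U -> U'}) (g : {linear V -> V'}) :
  is_bilin (fun u v => tmk (f u) (g v)).
Proof.
split=> w a x y; rewrite linearP; first by rewrite linearP.
by rewrite tmkDl.
Qed.

HB.instance Definition _ (f : {linear U -> U'}) (g : {linear V -> V'}) :=
  GRing.isLinear.Build k (tprod U V) (tprod U' V') *:%R (tmap f g)
    (tlift_linear (tmap_bilin f g)).

Lemma tmapE (f : {linear U -> U'}) (g : {linear V -> V'}) u v :
  tmap f g (tmk u v) = tmk (f u) (g v).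
Proof. exact: tlift_mk (tmap_bilin f g). Qed.

End TensorMap.

Section Associator.
Variables U V W : lmodType k.

Definition tassoc : tprod (tprod U V) W -> tprod U (tprod V W) :=
  tlift (fun t w => tlift (fun u v => tmk u (tmk v w)) t).
Definition tassoc_inv : tprod U (tprod V W) -> tprod (tprod U V) W :=
  tlift (fun u t => tlift (fun v w => tmk (tmk u v) w) t).

Lemma tassoc_bilin1 (w : W) : is_bilin (fun (u : U) (v : V) => tmk u (tmk v w)).
Proof. by split=> z a x y; rewrite !tmkDl // linearP. Qed.
Lemma tassoc_inv_bilin1 (u : U) : is_bilin (fun (v : V) (w : W) => tmk (tmk u v) w).
Proof. by split=> z a x y; rewrite linearP // tmkDl. Qed.

Lemma tassoc_bilin :
  is_bilin (fun (t : tprod U V) (w : W) => tlift (fun (u : U) (v : V) => tmk u (tmk v w)) t).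
Proof.
split=> [t a x y|w]; last exact: tlift_linear (tassoc_bilin1 w).
have [s ->] := tspan t.
rewrite -!tclassE !tlift_class; do ?exact: tassoc_bilin1.
rewrite /sum_of scaler_sumr -big_split; apply: eq_bigr => uv _ /=.
by rewrite !linearP.
Qed.
Lemma tassoc_inv_bilin :
  is_bilin (fun (u : U) (t : tprod V W) => tlift (fun (v : V) (w : W) => tmk (tmk u v) w) t).
Proof.
split=> [u|t a x y]; first exact: tlift_linear (tassoc_inv_bilin1 u).
have [s ->] := tspan t.
rewrite -!tclassE !tlift_class; do ?exact: tassoc_inv_bilin1.
rewrite /sum_of scaler_sumr -big_split; apply: eq_bigr => uv _ /=.
by rewrite !tmkDl.
Qed.

Lemma tassoc_linear : linear tassoc.
Proof. exact: tlift_linear tassoc_bilin. Qed.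
Lemma tassoc_inv_linear : linear tassoc_inv.
Proof. exact: tlift_linear tassoc_inv_bilin. Qed.
HB.instance Definition _ :=
  GRing.isLinear.Build k (tprod (tprod U V) W) (tprod U (tprod V W)) *:%R
    tassoc tassoc_linear.
HB.instance Definition _ :=
  GRing.isLinear.Build k (tprod U (tprod V W)) (tprod (tprod U V) W) *:%R
    tassoc_inv tassoc_inv_linear.

Lemma tassocE u v w : tassoc (tmk (tmk u v) w) = tmk u (tmk v w).
Proof.
rewrite /tassoc tlift_mk; last exact: tassoc_bilin.
by rewrite tlift_mk //; exact: tassoc_bilin1.
Qed.
Lemma tassoc_invE u v w : tassoc_inv (tmk u (tmk v w)) = tmk (tmk u v) w.
Proof.
rewrite /tassoc_inv tlift_mk; last exact: tassoc_inv_bilin.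
by rewrite tlift_mk //; exact: tassoc_inv_bilin1.
Qed.

End Associator.

Lemma tprod_ext3l (U V W Z : lmodType k)
    (f g : {linear tprod (tprod U V) W -> Z}) :
  (forall u v w, f (tmk (tmk u v) w) = g (tmk (tmk u v) w)) -> f =1 g.
Proof.
move=> fg; apply: tprod_ext => t w; have [s ->] := tspan t.
rewrite /sum_of tmk_suml !linear_sum; by apply: eq_bigr => uv _; apply: fg.
Qed.
Lemma tprod_ext3r (U V W Z : lmodType k)
    (f g : {linear tprod U (tprod V W) -> Z}) :
  (forall u v w, f (tmk u (tmk v w)) = g (tmk u (tmk v w))) -> f =1 g.
Proof.
move=> fg; apply: tprod_ext => u t; have [s ->] := tspan t.
rewrite /sum_of !linear_sum; by apply: eq_bigr => uv _; apply: fg.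
Qed.

Definition findim (V : lmodType k) : Prop :=
  exists s : seq V, forall x, exists c : nat -> k,
    x = \sum_(i < size s) c i *: s`_i.

Lemma linear_lift (V B C : lmodType k) (g : {linear B -> C}) (h : {linear V -> C}) :
  (forall c, exists b, g b = c) ->
  exists l : {linear V -> B}, forall v, g (l v) = h v.
Proof.
move=> gs.
pose P (G : set (V * B)) :=
  [/\ forall a p q, G p -> G q -> G (a *: p + q),
      forall p, G p -> g p.2 = h p.1 & forall b, G (0, b) -> b = 0].
have [|G [[Glin Ggh G0] Gmax]] := @Zorn_bigcup _ P.
  move=> F FP Ftot; split.
  - move=> a p q [X FX Xp] [Y FY Yq].
    have [XY|YX] := Ftot _ _ FX FY.
      by exists Y => //; have [H _ _] := FP _ FY; apply: H => //; exact: XY.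
    by exists X => //; have [H _ _] := FP _ FX; apply: H => //; exact: YX.
  - by move=> p [X FX Xp]; have [_ H _] := FP _ FX; exact: H.
  - by move=> b [X FX Xb]; have [_ _ H] := FP _ FX; exact: H.
have G00 : G (0, 0).
  apply: contrapT => nG00; apply: (Gmax (G `|` [set (0, 0)])%classic).
    split; first by left.
    by move=> /(_ (0, 0) (or_intror (erefl _))).
  have nG p : ~ G p.
    by move=> Gp; apply: nG00; have := Glin (-1) _ _ Gp Gp; rewrite scaleN1r addNr.
  split.
  - by move=> a p q [/nG//|->] [/nG//|->]; right; rewrite scaler0 addr0.
  - by move=> p [/nG//|->]; rewrite !linear0.
  - by move=> b [/nG//|[->]].
have Gtot v : exists b, G (v, b).
  apply: contrapT => nv.
  have [b0 b0E] := gs (h v).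
  pose G' : set (V * B) := 
    fun p => exists a q, G q /\ p = a *: (v, b0) + q.
  apply: (Gmax G').
    split; first by move=> q Gq; exists 0, q; rewrite scale0r add0r.
    move=> /(_ (v, b0)) H; apply: nv; exists b0; apply: H.
    by exists 1, (0, 0); rewrite scale1r addr0.
  split.
  - move=> a _ _ [a1 [q1 [G1 ->]]] [a2 [q2 [G2 ->]]].
    exists (a * a1 + a2), (a *: q1 + q2); split; first exact: Glin.
    by rewrite scalerDr scalerDl scalerA addrACA.
  - by move=> _ [a [q [Gq ->]]] /=; rewrite !linearP Ggh // b0E.
  - move=> b [a [[q1 q2] [Gq [e1 ->]]]].
    have [a0|a0] := eqVneq a 0.
      move: e1; rewrite a0 !scale0r !add0r => e1; rewrite -e1 in Gq.
      exact: G0.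
    case: nv; exists (- a^-1 *: q2).
    have -> : v = - a^-1 *: q1.
      have -> : q1 = - (a *: v) by apply/eqP; rewrite -addr_eq0 addrC -e1.
      by rewrite scalerN scaleNr opprK scalerA mulVf // scale1r.
    by have := Glin (- a^-1) _ _ Gq G00; rewrite addr0.
have /choice [l lG] := Gtot.
have lu v b : G (v, b) -> b = l v.
  move=> Gb; apply/eqP; rewrite -subr_eq0; apply/eqP/G0.
  have := Glin (-1) _ _ (lG v) Gb.
  by rewrite scaleN1r addrC (_ : _ - _ = (v - v, b - l v)) // subrr.
have ll : linear l.
  by move=> a x y; apply/esym/lu; exact: (Glin a _ _ (lG x) (lG y)).
pose l' : {linear V -> B} := HB.pack l (GRing.isLinear.Build k V B *:%R l ll).
by exists l' => v; exact: Ggh (lG v).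
Qed.

Lemma findim_tprod (U V : lmodType k) :
  findim U -> findim V -> findim (tprod U V).
Proof.
move=> [s sP] [t tP].
exists [seq tmk u v | u <- s, v <- t] => x.
have [r ->] := tspan x; rewrite /sum_of.
set l := [seq _ | _ <- _, _ <- _].
pose S (y : tprod U V) := exists c : nat -> k, y = \sum_(i < size l) c i *: l`_i.
rewrite -/(S _).
have S0 : S 0 by exists (fun=> 0); rewrite big1 // => i _; rewrite scale0r.
have SD y z : S y -> S z -> S (y + z).
  move=> [c ->] [d ->]; exists (fun i => c i + d i); rewrite -big_split.
  by apply: eq_bigr => i _; rewrite scalerDl.
have SZ a y : S y -> S (a *: y).
  move=> [c ->]; exists (fun i => a * c i); rewrite scaler_sumr.
  by apply: eq_bigr => i _; rewrite scalerA.
have Sl y : y \in l -> S y.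
  move=> yl; exists (fun i => (i == index y l)%:R).
  have lt : (index y l < size l)%N by rewrite index_mem.
  rewrite (bigD1 (Ordinal lt)) //= eqxx scale1r nth_index // big1 ?addr0 //.
  by move=> i /negPf; rewrite -val_eqE /= => ->; rewrite scale0r.
apply: (big_ind S) => // -[u v] _ /=.
have [c ->] := sP u; have [d ->] := tP v.
rewrite tmk_suml; apply: (big_ind S) => // i _.
rewrite linear_sum; apply: (big_ind S) => // j _.
rewrite linearZ /= tmkZl; apply/SZ/SZ/Sl.
by apply/allpairsP; exists (s`_i, t`_j); rewrite !mem_nth.
Qed.

End Tensor.

Section Complexes.
Context {k : fieldType}.

(* A bounded complex is given by its total space, the projections [pr i] onto  *)
(* its terms, and the differential, of degree +1.                              *)
Record cplx := Cplx {
  total :> lmodType k;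
  pr : int -> {linear total -> total};
  df : {linear total -> total};
  pr_pr : forall i j x, pr i (pr j x) = if i == j then pr j x else 0;
  pr_sum : exists2 s : seq int, uniq s & forall x, \sum_(i <- s) pr i x = x;
  df_pr : forall i x, df (pr i x) = pr (i + 1) (df x);
  df_df : forall x, df (df x) = 0
}.

Definition degs (X : cplx) : seq int := s2val (cid2 (pr_sum X)).

Lemma degs_uniq X : uniq (degs X).
Proof. by rewrite /degs; case: cid2. Qed.
Lemma pr_degs (X : cplx) (x : X) : \sum_(i <- degs X) pr X i x = x.
Proof. by rewrite /degs; case: cid2. Qed.

Lemma cplx_ext (X : cplx) (V : lmodType k) (f g : {linear X -> V}) :
  (forall i x, f (pr X i x) = g (pr X i x)) -> f =1 g.
Proof.
move=> fg x; rewrite -[x]pr_degs !linear_sum.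
by apply: eq_bigr => i _; apply: fg.
Qed.

Lemma pr_out (X : cplx) i (x : X) : i \notin degs X -> pr X i x = 0.
Proof.
move=> iX; rewrite -[x]pr_degs linear_sum big_seq big1 // => j jX.
by rewrite pr_pr; case: eqP iX => // ->; rewrite jX.
Qed.

Lemma pr_sub (X : cplx) (s : seq int) (x : X) :
  uniq s -> {subset degs X <= s} -> \sum_(i <- s) pr X i x = x.
Proof.
move=> us sub; rewrite -[RHS]pr_degs.
rewrite (bigID (mem (degs X))) /= [X in _ + X]big1 ?addr0; last first.
  by move=> i; apply: pr_out.
rewrite -big_filter; apply: perm_big; apply: uniq_perm.
- exact: filter_uniq.
- exact: degs_uniq.
- by move=> i; rewrite mem_filter andb_idr //; apply: sub.
Qed.

Definition kpar (X : cplx) (s : int) (x : X) : X :=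
  \sum_(i <- degs X) (-1) ^ (s * i) *: pr X i x.

Fact kpar_linear (X : cplx) s : linear (@kpar X s).
Proof.
move=> a x y; rewrite /kpar scaler_sumr -big_split; apply: eq_bigr => i _ /=.
by rewrite linearP scalerDr !scalerA mulrC.
Qed.
HB.instance Definition _ (X : cplx) s :=
  GRing.isLinear.Build k X X *:%R (@kpar X s) (@kpar_linear X s).

Lemma kpar_pr (X : cplx) s i (x : X) :
  kpar s (pr X i x) = (-1) ^ (s * i) *: pr X i x.
Proof.
rewrite /kpar; have [iX|iX] := boolP (i \in degs X); last first.
  rewrite (pr_out _ iX) scaler0 big1 // => j _.
  by rewrite linear0 scaler0.
rewrite (bigD1_seq i) ?degs_uniq //= pr_pr eqxx big1 ?addr0 //.
by move=> j /negPf ji; rewrite pr_pr ji scaler0.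
Qed.

Lemma pr_kpar (X : cplx) s i (x : X) :
  pr X i (kpar s x) = (-1) ^ (s * i) *: pr X i x.
Proof.
rewrite /kpar linear_sum /=; under eq_bigr do rewrite linearZ /= pr_pr.
have [iX|iX] := boolP (i \in degs X); last first.
  rewrite (pr_out _ iX) scaler0 big_seq big1 // => j jX.
  by case: eqP iX => [->|_ _]; rewrite ?jX ?scaler0.
rewrite (bigD1_seq i) ?degs_uniq //= eqxx big1 ?addr0 //.
by move=> j /negPf ji; rewrite eq_sym ji scaler0.
Qed.

Lemma expN1D (i j : int) : (-1) ^ (i + j) = (-1) ^ i * (-1) ^ j :> k.
Proof. by rewrite expfzDr // oppr_eq0 oner_eq0. Qed.
Lemma expN1K (i : int) : (-1) ^ i * (-1) ^ i = 1 :> k.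
Proof. by rewrite -exprzMl ?unitrN1 // mulrNN mulr1 exp1rz. Qed.

Lemma df_kpar (X : cplx) s (x : X) :
  df X (kpar s x) = (-1) ^ s *: kpar s (df X x).
Proof.
apply: (@cplx_ext X X (df X \o @kpar X s) ((-1) ^ s \*: (@kpar X s \o df X))).
move=> i {}x /=; rewrite kpar_pr df_pr kpar_pr linearZ /= df_pr scalerA.
by rewrite mulrDr mulr1 expN1D mulrCA expN1K mulr1.
Qed.

Section TensorComplex.
Variables X Y : cplx.

Definition tpr (m : int) (t : tprod X Y) : tprod X Y :=
  \sum_(i <- degs X) tmap (pr X i) (pr Y (m - i)) t.

Fact tpr_linear m : linear (tpr m).
Proof.
move=> a x y; rewrite /tpr scaler_sumr -big_split; apply: eq_bigr => i _ /=.
by rewrite linearP.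
Qed.
HB.instance Definition _ m :=
  GRing.isLinear.Build k (tprod X Y) (tprod X Y) *:%R (tpr m) (tpr_linear m).

(** d(x ⊗ y) = dx ⊗ y + (-1)^|x| x ⊗ dy *)
Definition tdf (t : tprod X Y) : tprod X Y :=
  tmap (df X) idfun t + tmap (@kpar X 1) (df Y) t.

Fact tdf_linear : linear tdf.
Proof.
by move=> a x y; rewrite /tdf !linearP scalerDr addrACA.
Qed.
HB.instance Definition _ :=
  GRing.isLinear.Build k (tprod X Y) (tprod X Y) *:%R tdf tdf_linear.

Lemma tprE m x y :
  tpr m (tmk x y) = \sum_(i <- degs X) tmk (pr X i x) (pr Y (m - i) y).
Proof. by apply: eq_bigr => i _; rewrite tmapE. Qed.

Lemma tprE_pr m i x y :
  tpr m (tmk (pr X i x) y) = tmk (pr X i x) (pr Y (m - i) y).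
Proof.
rewrite tprE; have [iX|iX] := boolP (i \in degs X); last first.
  by rewrite (pr_out _ iX) tmk0l big1 // => j _; rewrite linear0 tmk0l.
rewrite (bigD1_seq i) ?degs_uniq //= pr_pr eqxx big1 ?addr0 //.
by move=> j /negPf ji; rewrite pr_pr ji tmk0l.
Qed.

Lemma tdfE x y : tdf (tmk x y) = tmk (df X x) y + tmk (kpar 1 x) (df Y y).
Proof. by rewrite /tdf !tmapE. Qed.

Fact tpr_tpr i j t : tpr i (tpr j t) = if i == j then tpr j t else 0.
Proof.
pose f := (tpr i \o tpr j : {linear tprod X Y -> tprod X Y}).
have [->|ij] := eqVneq i j.
  apply: (@tprod_ext _ _ _ _ (tpr j \o tpr j) (tpr j)) => x y /=.
  rewrite tprE linear_sum; apply: eq_bigr => l _ /=.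
  by rewrite tprE_pr pr_pr eqxx.
apply: (@tprod_ext _ _ _ _ (tpr i \o tpr j) \0) => x y /=.
rewrite tprE linear_sum big1 // => l _ /=.
by rewrite tprE_pr pr_pr (inj_eq (addIr _)) (negPf ij) linear0.
Qed.

Fact tpr_sum :
  exists2 s : seq int, uniq s & forall t, \sum_(m <- s) tpr m t = t.
Proof.
pose s := undup [seq i + j | i <- degs X, j <- degs Y].
exists s; first exact: undup_uniq.
have S t : (fun t => \sum_(m <- s) tpr m t) t = \sum_(m <- s) tpr m t by [].
have lS : linear (fun t => \sum_(m <- s) tpr m t).
  move=> a x y; rewrite scaler_sumr -big_split; apply: eq_bigr => i _ /=.
  by rewrite linearP.
pose f : {linear tprod X Y -> tprod X Y} := HB.pack (fun t => \sum_(m <- s) tpr m t)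
  (GRing.isLinear.Build k _ _ *:%R _ lS).
apply: (@tprod_ext _ _ _ _ f idfun) => x y /=.
under eq_bigr do rewrite tprE.
rewrite exchange_big /= -[in RHS](pr_degs x) tmk_suml big_seq [RHS]big_seq.
apply: eq_bigr => i iX; rewrite -linear_sum; congr (tmk _ _).
rewrite -(big_map (fun m => m - i) xpredT (fun j => pr Y j y)) pr_sub //.
  by rewrite map_inj_uniq ?undup_uniq //; exact: addIr.
move=> j jY; apply/mapP; exists (i + j); last by rewrite addrC addKr.
by rewrite mem_undup; apply/allpairsP; exists (i, j).
Qed.

Fact tdf_tpr m t : tdf (tpr m t) = tpr (m + 1) (tdf t).
Proof.
apply: (@tprod_ext _ _ _ _ (tdf \o tpr m) (tpr (m + 1) \o tdf)) => x y /=.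
rewrite -[x]pr_degs tmk_suml [LHS](linear_sum (tdf \o tpr m)) [RHS](linear_sum (tpr (m + 1) \o tdf)) /=.
apply: eq_bigr => i _.
rewrite tprE_pr !tdfE linearD /= df_pr kpar_pr !tmkZl !linearZ /= !tprE_pr df_pr.
by rewrite addrAC opprD addrACA subrr addr0.
Qed.

Fact tdf_tdf t : tdf (tdf t) = 0.
Proof.
apply: (@tprod_ext _ _ _ _ (tdf \o tdf) \0) => x y /=.
rewrite tdfE linearD /= !tdfE !df_df df_kpar linear0 tmk0l add0r addr0.
by rewrite expr1z tmkZl scaleN1r addrN.
Qed.

Definition ctens : cplx := Cplx tpr_tpr tpr_sum tdf_tpr tdf_tdf.

End TensorComplex.

Definition cassoc (X Y Z : cplx) :
  {linear ctens (ctens X Y) Z -> ctens X (ctens Y Z)} := @tassoc k X Y Z.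
Definition cassoc_inv (X Y Z : cplx) :
  {linear ctens X (ctens Y Z) -> ctens (ctens X Y) Z} := @tassoc_inv k X Y Z.

Lemma cassocE (X Y Z : cplx) (x : X) (y : Y) (z : Z) :
  cassoc X Y Z (tmk (tmk x y : ctens X Y) z) = tmk x (tmk y z : ctens Y Z).
Proof. exact: tassocE. Qed.
Lemma cassoc_invE (X Y Z : cplx) (x : X) (y : Y) (z : Z) :
  cassoc_inv X Y Z (tmk x (tmk y z : ctens Y Z)) = tmk (tmk x y : ctens X Y) z.
Proof. exact: tassoc_invE. Qed.

Lemma tpr_tmk (X Y : cplx) i j (x : X) (y : Y) :
  tmk (pr X i x) (pr Y j y) = tpr (i + j) (tmk (pr X i x) (pr Y j y)).
Proof. by rewrite tprE_pr addrC addKr pr_pr eqxx. Qed.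

Lemma tpr3l (X Y Z : cplx) m i j (x : X) (y : Y) (z : Z) :
  pr (ctens (ctens X Y) Z) m (tmk (tmk (pr X i x) (pr Y j y) : ctens X Y) z) =
  tmk (tmk (pr X i x) (pr Y j y) : ctens X Y) (pr Z (m - i - j) z).
Proof. by rewrite tpr_tmk /= (@tprE_pr (ctens X Y) Z) opprD addrA. Qed.

Lemma tpr3r (X Y Z : cplx) m i j (x : X) (y : Y) (z : Z) :
  pr (ctens X (ctens Y Z)) m (tmk (pr X i x) (tmk (pr Y j y) z : ctens Y Z)) =
  tmk (pr X i x) (tmk (pr Y j y) (pr Z (m - i - j) z) : ctens Y Z).
Proof. by rewrite /= (@tprE_pr X (ctens Y Z)) /= tprE_pr. Qed.

Lemma cassoc_pr (X Y Z : cplx) m t :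
  cassoc X Y Z (pr (ctens (ctens X Y) Z) m t) =
  pr (ctens X (ctens Y Z)) m (cassoc X Y Z t).
Proof.
apply: (@tprod_ext3l k X Y Z (ctens X (ctens Y Z))
  (cassoc X Y Z \o pr (ctens (ctens X Y) Z) m)
  (pr (ctens X (ctens Y Z)) m \o cassoc X Y Z)) => x y z.
rewrite -[x]pr_degs !tmk_suml !linear_sum; apply: eq_bigr => i _.
rewrite -[y]pr_degs linear_sum !tmk_suml !linear_sum; apply: eq_bigr => j _.
change (cassoc X Y Z (pr (ctens (ctens X Y) Z) m
          (tmk (tmk (pr X i x) (pr Y j y) : ctens X Y) z)) =
        pr (ctens X (ctens Y Z)) m (cassoc X Y Z
          (tmk (tmk (pr X i x) (pr Y j y) : ctens X Y) z))).
by rewrite tpr3l !cassocE tpr3r.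
Qed.

Lemma cassoc_inv_pr (X Y Z : cplx) m t :
  cassoc_inv X Y Z (pr (ctens X (ctens Y Z)) m t) =
  pr (ctens (ctens X Y) Z) m (cassoc_inv X Y Z t).
Proof.
apply: (@tprod_ext3r k X Y Z (ctens (ctens X Y) Z)
  (cassoc_inv X Y Z \o pr (ctens X (ctens Y Z)) m)
  (pr (ctens (ctens X Y) Z) m \o cassoc_inv X Y Z)) => x y z.
rewrite -[x]pr_degs !tmk_suml !linear_sum; apply: eq_bigr => i _.
rewrite -[y]pr_degs !tmk_suml !linear_sum; apply: eq_bigr => j _.
change (cassoc_inv X Y Z (pr (ctens X (ctens Y Z)) m
          (tmk (pr X i x) (tmk (pr Y j y) z : ctens Y Z))) =
        pr (ctens (ctens X Y) Z) m (cassoc_inv X Y Z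
          (tmk (pr X i x) (tmk (pr Y j y) z : ctens Y Z)))).
by rewrite tpr3r !cassoc_invE tpr3l.
Qed.

End Complexes.
Arguments cplx k : clear implicits.

Inductive vertex := e1 | e2.

Section Modules.
Context {k : fieldType} {n : nat}.

(* The n arrows go from e2 to e1, so they act on a right module by maps        *)
(* M_{e1} -> M_{e2}.                                                           *)
Record qmod := QMod {
  qsp : vertex -> lmodType k;
  qact : 'I_n -> {linear qsp e1 -> qsp e2}
}.

Record qhom (M N : qmod) := QHom {
  qmap : forall v, {linear qsp M v -> qsp N v};
  qmapP : forall a x, qmap e2 (qact M a x) = qact N a (qmap e1 x)
}.

Definition projective (M : qmod) : Prop :=
  forall (B C : qmod) (g : qhom B C) (h : qhom M C),
    (forall v c, exists b, qmap g v b = c) ->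
    exists l : qhom M B, forall v x, qmap g v (qmap l v x) = qmap h v x.

Lemma projective_retract (M : qmod) : projective M ->
  exists r : 'I_n -> {linear qsp M e2 -> qsp M e1},
    forall a b x, r b (qact M a x) = if a == b then x else 0.
Proof.
move=> pM.
pose B2 : lmodType k := ({ffun 'I_n -> qsp M e1} * qsp M e2)%type.
pose Bs v : lmodType k := match v with e1 => qsp M e1 | e2 => B2 end.
pose ba a (x : Bs e1) : Bs e2 := ([ffun b => if a == b then x else 0], 0).
have lba a : linear (ba a).
  move=> c x y; congr (_, _); last by rewrite /= scaler0 addr0.
  apply/ffunP => b; rewrite !ffunE; case: ifP => //.
  by rewrite scaler0 addr0.
pose Ba a : {linear Bs e1 -> Bs e2} :=
  HB.pack (ba a) (GRing.isLinear.Build k (Bs e1) (Bs e2) *:%R (ba a) (lba a)).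
pose B := @QMod Bs Ba.
pose gf (p : B2) : qsp M e2 := \sum_a qact M a (p.1 a) + p.2.
have lgf : linear gf.
  move=> c x y; rewrite /gf /= scalerDr addrACA; congr (_ + _).
  rewrite scaler_sumr -big_split; apply: eq_bigr => a _ /=.
  by rewrite !ffunE linearP.
pose Gf : {linear B2 -> qsp M e2} :=
  HB.pack gf (GRing.isLinear.Build k B2 (qsp M e2) *:%R gf lgf).
pose gm v : {linear qsp B v -> qsp M v} :=
  match v return {linear qsp B v -> qsp M v} with e1 => idfun | e2 => Gf end.
have gP a x : gm e2 (qact B a x) = qact M a (gm e1 x).
  rewrite /= /gf /= addr0 (bigD1 a) //= ffunE eqxx big1 ?addr0 // => b.
  by rewrite ffunE eq_sym => /negPf ->; rewrite linear0.
pose im v : {linear qsp M v -> qsp M v} := idfun.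
have iP a x : im e2 (qact M a x) = qact M a (im e1 x) by [].
have [|l lP] := pM B M (@QHom B M gm gP) (@QHom M M im iP).
  case=> c; first by exists c.
  by exists (0, c); rewrite /= /gf /= big1 ?add0r // => a _; rewrite ffunE linear0.
pose rf b (y : qsp M e2) : qsp M e1 := (qmap l e2 y : B2).1 b.
have lrf b : linear (rf b) by move=> c x y; rewrite /rf linearP /= !ffunE.
pose R b : {linear qsp M e2 -> qsp M e1} :=
  HB.pack (rf b) (GRing.isLinear.Build k (qsp M e2) (qsp M e1) *:%R (rf b) (lrf b)).
exists R => a b x; rewrite /= /rf qmapP /= ffunE.
by case: eqP => // _; exact: (lP e1 x).
Qed.

Lemma retract_projective (M : qmod) (r : 'I_n -> {linear qsp M e2 -> qsp M e1}) :
  (forall a b x, r b (qact M a x) = if a == b then x else 0) -> projective M.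
Proof.
move=> rP B C g h gs.
have [l1 l1P] := linear_lift (qmap h e1) (gs e1).
have [l2 l2P] := linear_lift (qmap h e2) (gs e2).
pose pf y := y - \sum_a qact M a (r a y).
have lpf : linear pf.
  move=> c x y; rewrite /pf scalerBr addrACA -opprD; congr (_ - _).
  rewrite scaler_sumr -big_split; apply: eq_bigr => a _ /=.
  by rewrite !linearP.
pose lf y := \sum_a qact B a (l1 (r a y)) + l2 (pf y).
have llf : linear lf.
  move=> c x y; rewrite /lf lpf linearP scalerDr addrACA; congr (_ + _).
  rewrite scaler_sumr -big_split; apply: eq_bigr => a _ /=.
  by rewrite !linearP.
pose L2 : {linear qsp M e2 -> qsp B e2} :=
  HB.pack lf (GRing.isLinear.Build k (qsp M e2) (qsp B e2) *:%R lf llf).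
pose lm v : {linear qsp M v -> qsp B v} :=
  match v return {linear qsp M v -> qsp B v} with e1 => l1 | e2 => L2 end.
have sumE (V : lmodType k) (F : 'I_n -> {linear qsp M e1 -> V}) a x :
    \sum_b F b (r b (qact M a x)) = F a x.
  rewrite (bigD1 a) //= rP eqxx big1 ?addr0 // => b.
  by rewrite rP eq_sym => /negPf ->; rewrite linear0.
have lmP a x : lm e2 (qact M a x) = qact B a (lm e1 x).
  rewrite /= /lf /pf (sumE _ (fun b => qact B b \o l1)) /=.
  by rewrite (sumE _ (qact M)) subrr linear0 addr0.
exists (QHom lmP) => -[x|y] /=; first exact: l1P.
rewrite /lf linearD l2P linear_sum /pf linearB linear_sum /= addrC.
rewrite (_ : \sum_i qmap g e2 _ = \sum_i qmap h e2 (qact M i (r i y))) ?subrK //.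
by apply: eq_bigr => a _; rewrite !qmapP l1P.
Qed.

End Modules.
Arguments qmod k n : clear implicits.

Section DerivedCategory.
Context {k : fieldType} {n : nat} {fg : bool}.

(* The bounded derived dg-category of right modules: the path algebra is       *)
(* hereditary, so it is the dg-category of bounded complexes of projective     *)
(* modules, and projective modules are stable under the vertexwise tensor      *)
(* product ([ot_proj]).  A complex of modules is given by its complexes of     *)
(* vector spaces at e1, e2 and the action of the arrows; [ob_proj] is about    *)
(* the sum of its terms, which is projective iff each term is.  With           *)
(* [fg = true], only finitely generated modules are considered.                *)
Record ob := Ob {
  ov : vertex -> cplx k;
  oact : 'I_n -> {linear ov e1 -> ov e2};
  oact_pr : forall a i x, oact a (pr (ov e1) i x) = pr (ov e2) i (oact a x);
  oact_df : forall a x, oact a (df (ov e1) x) = df (ov e2) (oact a x);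
  ob_proj : projective (@QMod k n (fun v => ov v : lmodType k) oact);
  ob_fg : fg -> forall v, findim (ov v)
}.

Lemma oact_kpar (X : ob) a s x : oact X a (kpar s x) = kpar s (oact X a x).
Proof.
apply: (@cplx_ext _ _ _ (oact X a \o @kpar _ (ov X e1) s)
                        (@kpar _ (ov X e2) s \o oact X a)) => i {}x /=.
by rewrite kpar_pr oact_pr kpar_pr linearZ /= oact_pr.
Qed.

Section TensorOb.
Variables X Y : ob.

Definition otv (v : vertex) : cplx k := ctens (ov X v) (ov Y v).
Definition otact (a : 'I_n) : {linear otv e1 -> otv e2} :=
  tmap (oact X a) (oact Y a).

Fact otact_pr a i t : otact a (pr (otv e1) i t) = pr (otv e2) i (otact a t).
Proof.
apply: (@tprod_ext _ _ _ _ (otact a \o pr (otv e1) i) (pr (otv e2) i \o otact a)).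
move=> x y; rewrite -[x]pr_degs tmk_suml !linear_sum; apply: eq_bigr => j _ /=.
by rewrite tprE_pr !tmapE !oact_pr tprE_pr.
Qed.

Fact otact_df a t : otact a (df (otv e1) t) = df (otv e2) (otact a t).
Proof.
apply: (@tprod_ext _ _ _ _ (otact a \o df (otv e1)) (df (otv e2) \o otact a)).
by move=> x y /=; rewrite tmapE !tdfE linearD /= !tmapE !oact_df oact_kpar.
Qed.

Fact ot_proj : projective (@QMod k n (fun v => otv v : lmodType k) otact).
Proof.
have [r rP] := projective_retract (@ob_proj X).
have [s sP] := projective_retract (@ob_proj Y).
apply: (@retract_projective k n (@QMod k n (fun v => otv v : lmodType k) otact)
  (fun a => tmap (r a) (s a))) => a b t /=.
have [->|ab] := eqVneq a b.
  apply: (@tprod_ext _ _ _ _ (tmap (r b) (s b) \o otact b) idfun) => x y /=.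
  by rewrite !tmapE (rP b b) (sP b b) eqxx.
apply: (@tprod_ext _ _ _ _ (tmap (r b) (s b) \o otact a) \0) => x y /=.
by rewrite !tmapE (rP a b) (negPf ab) tmk0l.
Qed.

Fact ot_fg : fg -> forall v, findim (otv v).
Proof. by move=> f v; apply: findim_tprod; apply: ob_fg. Qed.

Definition otens : ob := Ob otact_pr otact_df ot_proj ot_fg.

End TensorOb.

#[local] Obligation Tactic := idtac.

(* [hom X Y] is the sum of all the Hom^r(X, Y): as X and Y are bounded, this   *)
(* is the space of all module maps between the total spaces.                   *)
Record hom (X Y : ob) := Hom {
  hv :> forall v, ov X v -> ov Y v;
  hv_linear : forall v, linear (@hv v);
  hv_act : forall a x, @hv e2 (oact X a x) = oact Y a (@hv e1 x)
}.
Arguments hv {X Y} h v x.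
Arguments hv_linear {X Y} h v.

HB.instance Definition _ (X Y : ob) (f : hom X Y) v :=
  GRing.isLinear.Build k (ov X v) (ov Y v) *:%R (hv f v) (hv_linear f v).

Lemma homP X Y (f g : hom X Y) : (forall v, f v =1 g v) -> f = g.
Proof.
case: f g => [f lf cf] [g lg cg] /= fg0.
have E : f = g by apply: functional_extensionality_dep => v; apply/funext/fg0.
subst g; congr Hom; exact: Prop_irrelevance.
Qed.

HB.instance Definition _ X Y := gen_eqMixin (hom X Y).
HB.instance Definition _ X Y := gen_choiceMixin (hom X Y).

Section HomSpace.
Variables X Y : ob.

Program Definition hadd (f g : hom X Y) : hom X Y :=
  @Hom X Y (fun v x => f v x + g v x) _ _.
Next Obligation.
by move=> f g v a x y /=; rewrite !linearP scalerDr addrACA.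
Qed.
Next Obligation. by move=> f g a x /=; rewrite linearD !hv_act. Qed.

Program Definition hzero : hom X Y := @Hom X Y (fun v x => 0) _ _.
Next Obligation. by move=> v a x y; rewrite scaler0 addr0. Qed.
Next Obligation. by move=> a x; rewrite linear0. Qed.

Program Definition hscale (a : k) (f : hom X Y) : hom X Y :=
  @Hom X Y (fun v x => a *: f v x) _ _.
Next Obligation.
by move=> a f v b x y /=; rewrite linearP scalerDr !scalerA mulrC.
Qed.
Next Obligation. by move=> a f b x /=; rewrite hv_act linearZ. Qed.

Definition hopp (f : hom X Y) : hom X Y := hscale (-1) f.

Fact haddA : associative hadd.
Proof. by move=> f g h; apply: homP => v x /=; rewrite addrA. Qed.
Fact haddC : commutative hadd.
Proof. by move=> f g; apply: homP => v x /=; rewrite addrC. Qed.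
Fact hadd0 : left_id hzero hadd.
Proof. by move=> f; apply: homP => v x /=; rewrite add0r. Qed.
Fact haddN : left_inverse hzero hopp hadd.
Proof. by move=> f; apply: homP => v x /=; rewrite scaleN1r addNr. Qed.
HB.instance Definition _ :=
  GRing.isZmodule.Build (hom X Y) haddA haddC hadd0 haddN.

Fact hscaleA a b f : hscale a (hscale b f) = hscale (a * b) f.
Proof. by apply: homP => v x /=; rewrite scalerA. Qed.
Fact hscale1 : left_id 1 hscale.
Proof. by move=> f; apply: homP => v x /=; rewrite scale1r. Qed.
Fact hscaleDr : right_distributive hscale +%R.
Proof. by move=> a f g; apply: homP => v x /=; rewrite scalerDr. Qed.
Fact hscaleDl f : {morph hscale^~ f : a b / a + b}.
Proof. by move=> a b; apply: homP => v x /=; rewrite scalerDl. Qed.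
HB.instance Definition _ := GRing.Zmodule_isLmodule.Build k (hom X Y)
  hscaleA hscale1 hscaleDr hscaleDl.

Lemma hom0E v x : (0 : hom X Y) v x = 0.
Proof. by []. Qed.
Lemma homDE (f g : hom X Y) v x : (f + g) v x = f v x + g v x.
Proof. by []. Qed.
Lemma homZE a (f : hom X Y) v x : (a *: f) v x = a *: f v x.
Proof. by []. Qed.
Lemma homNE (f : hom X Y) v x : (- f) v x = - f v x.
Proof. by rewrite -[LHS]/(-1 *: f v x) scaleN1r. Qed.

Definition homog (r : int) (f : hom X Y) : Prop :=
  forall v i x, f v (pr (ov X v) i x) = pr (ov Y v) (i + r) (f v x).

End HomSpace.

Program Definition hid X : hom X X := @Hom X X (fun v x => x) _ _.
Next Obligation. by []. Qed.
Next Obligation. by []. Qed.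

Program Definition hcomp X Y Z (g : hom Y Z) (f : hom X Y) : hom X Z :=
  @Hom X Z (fun v x => g v (f v x)) _ _.
Next Obligation. by move=> X Y Z g f v a x y /=; rewrite !linearP. Qed.
Next Obligation. by move=> X Y Z g f a x /=; rewrite !hv_act. Qed.

Program Definition hd X : hom X X := @Hom X X (fun v x => df (ov X v) x) _ _.
Next Obligation. by move=> X v a x y /=; rewrite linearP. Qed.
Next Obligation. by move=> X a x /=; rewrite oact_df. Qed.

Definition hdiff X Y (r : int) (f : hom X Y) : hom X Y :=
  hcomp (hd Y) f - (-1) ^ r *: hcomp f (hd X).

(** (f ⊗ g)(x ⊗ y) = (-1)^(s|x|) f(x) ⊗ g(y), for g of degree s *)
Program Definition htens X Y X' Y' (s : int) (f : hom X Y) (g : hom X' Y') :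
    hom (otens X X') (otens Y Y') :=
  @Hom (otens X X') (otens Y Y')
    (fun v => tmap (fun x => f v (kpar s x)) (g v)) _ _.
Next Obligation.
move=> X Y X' Y' s f g v; pose h : {linear ov X v -> ov Y v} := f v \o @kpar _ (ov X v) s.
exact: (tlift_linear (tmap_bilin h (g v))).
Qed.
Next Obligation.
move=> X Y X' Y' s f g a t.
pose h v : {linear ov X v -> ov Y v} := f v \o @kpar _ (ov X v) s.
pose T v : {linear otv X X' v -> otv Y Y' v} := tmap (h v) (g v).
apply: (@tprod_ext _ _ _ _ (T e2 \o otact X X' a) (otact Y Y' a \o T e1)) => x y /=.
by rewrite !tmapE /h /= -oact_kpar !hv_act.
Qed.

Program Definition hassoc X Y Z : hom (otens (otens X Y) Z) (otens X (otens Y Z)) :=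
  @Hom (otens (otens X Y) Z) (otens X (otens Y Z))
    (fun v => @tassoc k (ov X v) (ov Y v) (ov Z v)) _ _.
Next Obligation. by move=> X Y Z v; exact: tassoc_linear. Qed.
Next Obligation.
move=> X Y Z a t.
apply: (@tprod_ext3l _ _ _ _ _
  (@tassoc k (ov X e2) (ov Y e2) (ov Z e2) \o otact (otens X Y) Z a)
  (otact X (otens Y Z) a \o @tassoc k (ov X e1) (ov Y e1) (ov Z e1))) => x y z /=.
by rewrite tassocE !tmapE /= !tmapE tassocE.
Qed.

Program Definition hassoc_inv X Y Z :
    hom (otens X (otens Y Z)) (otens (otens X Y) Z) :=
  @Hom (otens X (otens Y Z)) (otens (otens X Y) Z)
    (fun v => @tassoc_inv k (ov X v) (ov Y v) (ov Z v)) _ _.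
Next Obligation. by move=> X Y Z v; exact: tassoc_inv_linear. Qed.
Next Obligation.
move=> X Y Z a t.
apply: (@tprod_ext3r _ _ _ _ _
  (@tassoc_inv k (ov X e2) (ov Y e2) (ov Z e2) \o otact X (otens Y Z) a)
  (otact (otens X Y) Z a \o @tassoc_inv k (ov X e1) (ov Y e1) (ov Z e1))) => x y z /=.
by rewrite tassoc_invE !tmapE /= !tmapE tassoc_invE.
Qed.

Lemma homog_id X : homog 0 (hid X).
Proof. by move=> v i x; rewrite addr0. Qed.

Lemma homog_comp X Y Z r s (g : hom Y Z) (f : hom X Y) :
  homog s g -> homog r f -> homog (s + r) (hcomp g f).
Proof. by move=> hg hf v i x /=; rewrite hf hg -addrA (addrC r). Qed.

Lemma homog_diff X Y r (f : hom X Y) : homog r f -> homog (r + 1) (hdiff r f).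
Proof.
move=> hf v i x; rewrite !(homDE, homNE, homZE) /= hf !df_pr hf.
rewrite (addrAC i 1 r) -(addrA i r 1).
by rewrite [RHS]linearB; congr (_ - _); rewrite linearZ.
Qed.

Lemma homog_tens X Y X' Y' r s (f : hom X Y) (g : hom X' Y') :
  homog r f -> homog s g -> homog (r + s) (htens s f g).
Proof.
move=> hf hg v m t.
pose h v : {linear ov X v -> ov Y v} := f v \o @kpar _ (ov X v) s.
pose T : {linear otv X X' v -> otv Y Y' v} := tmap (h v) (g v).
apply: (@tprod_ext _ _ _ _ (T \o tpr m) (@tpr _ (ov Y v) (ov Y' v) (m + (r + s)) \o T)).
move=> x y /=; rewrite tmapE tprE linear_sum /=.
under eq_bigr do rewrite tmapE /h /= kpar_pr linearZ /= hf hg tmkZl.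
have E : h v x = \sum_(i <- degs (ov X v)) h v (pr (ov X v) i x).
  by rewrite -linear_sum pr_degs.
rewrite -[f v (kpar s x)]/(h v x) E tmk_suml linear_sum /=.
apply: eq_bigr => i _; rewrite kpar_pr linearZ /= hf tmkZl linearZ /= tprE_pr; congr (_ *: tmk _ _).
by congr (pr _ _ _); rewrite opprD addrACA (addrC r s) addrK.
Qed.

Lemma homog0 X Y r : homog r (0 : hom X Y).
Proof. by move=> v i x; rewrite !hom0E linear0. Qed.

Lemma homog_assoc X Y Z : homog 0 (hassoc X Y Z).
Proof. by move=> v m t; rewrite addr0; exact: cassoc_pr. Qed.

Lemma homog_assoc_inv X Y Z : homog 0 (hassoc_inv X Y Z).
Proof. by move=> v m t; rewrite addr0; exact: cassoc_inv_pr. Qed.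

End DerivedCategory.
Arguments ob k n fg : clear implicits.

Inductive tree (T : Type) := Lf of T | Nd of tree T & tree T.
HB.instance Definition _ (T : Type) := gen_eqMixin (tree T).

Fixpoint tbind (S T : Type) (t : tree S) (f : S -> tree T) : tree T :=
  match t with Lf x => f x | Nd l r => Nd (tbind l f) (tbind r f) end.
Definition trelabel (S T : Type) (f : S -> T) (t : tree S) : tree T :=
  tbind t (fun x => Lf (f x)).

Fixpoint lcomb (m : nat) : tree nat :=
  if m is m'.+1 then Nd (lcomb m') (Lf m) else Lf 0%N.
Fixpoint rcomb (a m : nat) : tree nat :=
  if m is m'.+1 then Nd (Lf a) (rcomb a.+1 m') else Lf a.

Inductive rotation (T : Type) : tree T -> tree T -> Prop :=
| rot_root U V W : rotation (Nd (Nd U V) W) (Nd U (Nd V W))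
| rot_left U U' V : rotation U U' -> rotation (Nd U V) (Nd U' V)
| rot_right U V V' : rotation V V' -> rotation (Nd U V) (Nd U V').

Definition tree_lt (s t : tree nat) : bool :=
  `[< Relation_Operators.clos_trans _ (@rotation nat) s t >].

(* A vertex of A_m is a bracketing of the letters 0, ..., m + 1.  The face     *)
(* A_k x A_l at the letter [a] of A_{k+l+1} consists of the bracketings        *)
(* [graft a l (s, u)], with the bracketing [u] of l + 2 letters put in place   *)
(* of the letter [a] of [s].                                                   *)
Definition graft (a l : nat) (su : tree nat * tree nat) : tree nat :=
  tbind su.1 (fun b =>
    if (b < a)%N then Lf b
    else if b == a then trelabel (addn a) su.2
    else Lf (b + l.+1)%N).

Section Staircases.
Variables S T : Type.

(** paths from (q, u) to the ends of q :: Q and u :: U, by unit steps *)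
Fixpoint stairs (q : S) (Q : seq S) {struct Q} : T -> seq T -> seq (seq (S * T)) :=
  fix stairs_q (u : T) (U : seq T) {struct U} : seq (seq (S * T)) :=
    map (cons (q, u))
      match Q, U with
      | [::], [::] => [:: [::]]
      | q' :: Q', [::] => stairs q' Q' u [::]
      | [::], u' :: U' => stairs_q u' U'
      | q' :: Q', u' :: U' => stairs q' Q' u U ++ stairs_q u' U'
      end.

End Staircases.

(* An aposet is represented by the duplicate-free list of its admissible       *)
(* paths; [adm_prod] is the product.                                           *)
Definition adm_prod (S T : eqType) (PS : seq (seq S)) (PT : seq (seq T)) :
    seq (seq (S * T)) :=
  undup (flatten [seq match Q, U with
                      | q :: Q', u :: U' => stairs q Q' u U'
                      | _, _ => [::]
                      end | Q <- PS, U <- PT]).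

Definition adm_I (q : nat) : seq (seq nat) := [:: iota 0 q.+1].

Section Associahedra.
Variables (adm : nat -> seq (seq (tree nat))) (m : nat).

Definition adm_faces : seq (seq (tree nat)) :=
  flatten [seq [seq map (graft a (m - k)) P | P <- adm_prod (adm k) (adm (m - k))%N]
          | k <- iota 0 m.+1, a <- iota 0 k.+2].

Definition adm_succ : seq (seq (tree nat)) :=
  [seq P <- undup [seq rcons P (rcomb 0 m.+2) | P <- adm_faces]
  | sorted tree_lt P].
End Associahedra.

Fixpoint adm_upto (m : nat) : nat -> seq (seq (tree nat)) :=
  if m is m'.+1 then
    fun i => if (i <= m')%N then adm_upto m' i else adm_succ (adm_upto m') m'
  else fun=> [:: [:: rcomb 0 1]].
Definition adm_A (m : nat) : seq (seq (tree nat)) := adm_upto m m.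

(** successive steps of a path in A_m x I_q starting at (_, m): [Some t] is a
    horizontal step to [t], [None] a vertical step *)
Fixpoint steps (m : nat) (P : seq (tree nat * nat)) : seq (option (tree nat)) :=
  if P is (t, m') :: P' then
    (if m' == m then Some t else None) :: steps m' P'
  else [::].

Fixpoint last_tree (s : tree nat) (st : seq (option (tree nat))) : tree nat :=
  match st with
  | [::] => s
  | Some t :: st' => last_tree t st'
  | None :: st' => last_tree s st'
  end.

Section TensorHochschild.
Context {k : fieldType} {n : nat} {fg : bool}.
Local Notation ob := (ob k n fg).

Record gmor (X Y : ob) := GMor {
  deg : int;
  gval :> hom X Y;
  gvalP : homog deg gval
}.

Definition gid (X : ob) : gmor X X := GMor (@homog_id k n fg X).
Definition gcomp (X Y Z : ob) (g : gmor Y Z) (f : gmor X Y) : gmor X Z :=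
  GMor (homog_comp (gvalP g) (gvalP f)).
Definition gtens (X Y X' Y' : ob) (f : gmor X Y) (g : gmor X' Y') :
    gmor (otens X X') (otens Y Y') :=
  GMor (homog_tens (gvalP f) (gvalP g)).
Definition gdiff (X Y : ob) (f : gmor X Y) : gmor X Y :=
  GMor (homog_diff (gvalP f)).
Definition gassoc (X Y Z : ob) : gmor (otens (otens X Y) Z) (otens X (otens Y Z)) :=
  GMor (@homog_assoc k n fg X Y Z).
Definition gassoc_inv (X Y Z : ob) :
    gmor (otens X (otens Y Z)) (otens (otens X Y) Z) :=
  GMor (@homog_assoc_inv k n fg X Y Z).

(* Used only between objects which are provably, but not definitionally,      *)
(* equal (see [tev_tbind]); the second branch never matters.                   *)
Definition gcast (X Y : ob) : gmor X Y :=
  match pselect (X = Y) with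
  | left e => ecast Z (gmor X Z) e (gid X)
  | right _ => GMor (@homog0 k n fg X Y 0)
  end.

Section Evaluation.
Variable J : Type.

Definition fam (X Y : J -> ob) : Type := forall j, gmor (X j) (Y j).

Fixpoint tev (t : tree J) (X : J -> ob) : ob :=
  match t with Lf j => X j | Nd l r => otens (tev l X) (tev r X) end.

Fixpoint tevm (t : tree J) (X Y : J -> ob) (F : fam X Y) : gmor (tev t X) (tev t Y) :=
  match t with Lf j => F j | Nd l r => gtens (tevm l F) (tevm r F) end.

Variable X : J -> ob.

(** A ⊗ x_1 ⊗ ... ⊗ x_m bracketed from the left, x_i being the leaves of t *)
Fixpoint lpush (A : ob) (t : tree J) : ob :=
  match t with Lf j => otens A (X j) | Nd l r => lpush (lpush A l) r end.

Fixpoint push (A : ob) (t : tree J) : gmor (otens A (tev t X)) (lpush A t) :=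
  match t return gmor (otens A (tev t X)) (lpush A t) with
  | Lf j => gid _
  | Nd l r => gcomp (push (lpush A l) r)
      (gcomp (gtens (push A l) (gid (tev r X))) (gassoc_inv A (tev l X) (tev r X)))
  end.

Fixpoint pull (A : ob) (t : tree J) : gmor (lpush A t) (otens A (tev t X)) :=
  match t return gmor (lpush A t) (otens A (tev t X)) with
  | Lf j => gid _
  | Nd l r => gcomp (gassoc A (tev l X) (tev r X))
      (gcomp (gtens (pull A l) (gid (tev r X))) (pull (lpush A l) r))
  end.

Fixpoint lnorm (t : tree J) : ob :=
  match t with Lf j => X j | Nd l r => lpush (lnorm l) r end.

Fixpoint to_lnorm (t : tree J) : gmor (tev t X) (lnorm t) :=
  match t return gmor (tev t X) (lnorm t) with
  | Lf j => gid _
  | Nd l r => gcomp (push (lnorm l) r) (gtens (to_lnorm l) (gid (tev r X)))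
  end.

Fixpoint of_lnorm (t : tree J) : gmor (lnorm t) (tev t X) :=
  match t return gmor (lnorm t) (tev t X) with
  | Lf j => gid _
  | Nd l r => gcomp (gtens (of_lnorm l) (gid (tev r X))) (pull (lnorm l) r)
  end.

(* The canonical isomorphism between two bracketings of the same word; it is   *)
(* the identity when s and t are equal leaves.                                 *)
Definition can (s t : tree J) : gmor (tev s X) (tev t X) :=
  gcomp (of_lnorm t) (gcomp (gcast (lnorm s) (lnorm t)) (to_lnorm s)).

End Evaluation.

Definition tevs (J J' : Type) (T : J' -> tree J) (X : J -> ob) : J' -> ob :=
  fun j => tev (T j) X.
Definition tevsm (J J' : Type) (T : J' -> tree J) (X Y : J -> ob) (F : fam X Y) :
  fam (tevs T X) (tevs T Y) := fun j => tevm (T j) F.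

Lemma tev_tbind (J J' : Type) (t : tree J') (T : J' -> tree J) (X : J -> ob) :
  tev (tbind t T) X = tev t (tevs T X).
Proof. by elim: t => //= l -> r ->. Qed.

Definition ltree (p : nat) : tree 'I_p.+1 := trelabel inord (lcomb p).
Definition lprod (p : nat) (X : 'I_p.+1 -> ob) : ob := tev (ltree p) X.
Definition lprodm (p : nat) (X Y : 'I_p.+1 -> ob) (F : fam X Y) :
  gmor (lprod X) (lprod Y) := tevm (ltree p) F.

(* For A = tev s X and B = tev t Y, a morphism A -> B composed with canonical  *)
(* isomorphisms into one between left-bracketed products.                      *)
Definition rebracket (p : nat) (X Y : 'I_p.+1 -> ob) (s t : tree 'I_p.+1)
    (A B : ob) (f : hom A B) : hom (lprod X) (lprod Y) :=
  hcomp (can Y t (ltree p))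
    (hcomp (gcast B (tev t Y))
      (hcomp f (hcomp (gcast (tev s X) A) (can X (ltree p) s)))).
Arguments rebracket {p X Y} s t {A B} f.

Section Chains.
Variable p : nat.
Local Notation J := 'I_p.+1.
Local Notation fam := (@fam J).

(* An array (f_ij), 0 <= i <= p, 0 <= j < q, is the chain of its columns       *)
(* f_{.0}, ..., f_{.q-1}.                                                      *)
Inductive chain : (J -> ob) -> (J -> ob) -> Type :=
| cnil X : chain X X
| ccons X Z Y (F : fam X Z) (c : chain Z Y) : chain X Y.

Fixpoint csize X Y (c : chain X Y) : nat :=
  if c is ccons _ _ _ _ c' then (csize c').+1 else 0.

Fixpoint ccat X Z Y (c : chain X Z) : chain Z Y -> chain X Y :=
  match c in chain X Z return chain Z Y -> chain X Y with
  | cnil _ => fun d => d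
  | ccons _ _ _ F c' => fun d => ccons F (ccat c' d)
  end.

Definition fdeg X Y (F : fam X Y) : int := \sum_j deg (F j).

Fixpoint cdeg X Y (c : chain X Y) : int :=
  if c is ccons _ _ _ F c' then cdeg c' + fdeg F else 0.

Definition fid X : fam X X := fun j => gid (X j).
Definition fcomp X Y Z (G : fam Y Z) (F : fam X Y) : fam X Z :=
  fun j => gcomp (G j) (F j).

Fixpoint crow (i : J) X Y (c : chain X Y) : gmor (X i) (Y i) :=
  match c in chain X Y return gmor (X i) (Y i) with
  | cnil X => gid (X i)
  | ccons _ _ _ F c' => gcomp (crow i c') (F i)
  end.

Fixpoint clast X Z Y (F : fam X Z) (c : chain Z Y) {struct c} :
    {W : J -> ob & (chain X W * fam W Y)%type} :=
  match c in chain Z Y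
  return fam X Z -> {W : J -> ob & (chain X W * fam W Y)%type} with
  | cnil _ => fun F => existT _ X (cnil X, F)
  | ccons _ _ _ G c' => fun F =>
      let: existT W (d, H) := clast G c' in existT _ W (ccons F d, H)
  end F.

(* Koszul signs.  The arguments of a cochain are ordered as                    *)
(*   F_{q-1}, ..., F_0   with   F_j = (f_{0j}, ..., f_{pj}),                   *)
(* so that the word of [phi (f_ij)] is  phi F_{q-1} ... F_0.  The lists below  *)
(* carry the exponents of the signs.                                           *)

(** (⊗ g_i)(⊗ f_i) = ± ⊗ (g_i f_i) *)
Definition kcomp X Y Z (G : fam Y Z) (F : fam X Y) : int :=
  \sum_(i : J) \sum_(i' : J | (i < i')%N) deg (F i) * deg (G i').

(** moves row i to the left of the other rows *)
Fixpoint kleft (i : J) X Y (c : chain X Y) : int :=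
  if c is ccons _ _ _ F c' then
    deg (F i) * (cdeg c' - deg (crow i c')) + kleft i c'
  else 0.
(** moves row i to the right of the other rows *)
Fixpoint kright (i : J) X Y (c : chain X Y) : int :=
  if c is ccons _ _ _ F c' then
    (fdeg F - deg (F i)) * deg (crow i c') + kright i c'
  else 0.

Fixpoint cdiffs X Y (c : chain X Y) : seq (int * chain X Y) :=
  match c in chain X Y return seq (int * chain X Y) with
  | cnil _ => [::]
  | ccons _ _ _ F c' =>
      [seq (cdeg c' + \sum_(i : J | (i < j)%N) deg (F i),
            ccons (dfwith F (gdiff (F j))) c') | j : J <- enum J]
      ++ [seq (x.1, ccons F x.2) | x <- cdiffs c']
  end.

(** compositions of two consecutive columns j, j+1, with the sign (-1)^(j+1) *)
Definition cmerge1 X Z Y (F : fam X Z) (c : chain Z Y) : seq (int * chain X Y) :=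
  match c in chain Z Y return fam X Z -> seq (int * chain X Y) with
  | cnil _ => fun F => [::]
  | ccons _ _ _ G c' => fun F => [:: (1 + kcomp G F, ccons (fcomp G F) c')]
  end F.
Fixpoint cmerges X Y (c : chain X Y) : seq (int * chain X Y) :=
  match c in chain X Y return seq (int * chain X Y) with
  | cnil _ => [::]
  | ccons _ _ _ F c' =>
      cmerge1 F c' ++ [seq (1 + x.1, ccons F x.2) | x <- cmerges c']
  end.

End Chains.

Fixpoint cmap (p p' : nat) (T : 'I_p'.+1 -> tree 'I_p.+1) X Y (c : @chain p X Y) :
    @chain p' (tevs T X) (tevs T Y) :=
  match c in chain X Y return chain (tevs T X) (tevs T Y) with
  | cnil _ => cnil _
  | ccons _ _ _ F c' => ccons (tevsm T F) (cmap T c')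
  end.

(* The bracketing s of the letters j, ..., j + i among 0, ..., p.              *)
Definition block (p p' i j : nat) (s : tree nat) : 'I_p'.+1 -> tree 'I_p.+1 :=
  fun l => if (l < j)%N then Lf (inord l)
           else if l == j :> nat then trelabel (fun a => inord (j + a)) s
           else Lf (inord (l + i)).
Arguments block {p p'} i j s l.

(* The chain P(f): [s] is the current bracketing and [c] the columns not yet   *)
(* used.                                                                       *)
Fixpoint cpath (p p' i j : nat) (s : tree nat) (st : seq (option (tree nat)))
    X Y (c : @chain p X Y) {struct st} :
    @chain p' (tevs (@block p p' i j s) X)
              (tevs (@block p p' i j (last_tree s st)) Y) :=
  match st return chain (tevs (block i j s) X)
                        (tevs (block i j (last_tree s st)) Y) with
  | [::] => cmap (block i j s) c
  | Some t :: st' =>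
      ccons (fun l => can X (block i j s l) (block i j t l)) (cpath p' i j t st' c)
  | None :: st' =>
      match c in chain X Y
      return chain (tevs (block i j s) X)
                   (tevs (block i j (last_tree s st')) Y) with
      | cnil X => cpath p' i j s st' (cnil X)
      | ccons _ _ _ F c' =>
          ccons (tevsm (block i j s) F) (cpath p' i j s st' c')
      end
  end.

(* An element of prod_q C~^{p,q}: its component in C~^{p,q} is its restriction *)
(* to the chains of size q.                                                    *)
Definition cochain (p : nat) : Type :=
  forall X Y : 'I_p.+1 -> ob, chain X Y -> hom (lprod X) (lprod Y).

Definition multilinear (p : nat) (phi : cochain p) : Prop :=
  forall X Z Z' Y (c : chain X Z) (F : fam Z Z') (c' : chain Z' Y) (j : 'I_p.+1)
    (a : k) (r : int) (f g : hom (Z j) (Z' j))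
    (hf : homog r f) (hg : homog r g) (hfg : homog r (a *: f + g)),
  let ins h := ccat c (ccons (dfwith F h) c') in
  phi X Y (ins (GMor hfg)) = a *: phi X Y (ins (GMor hf)) + phi X Y (ins (GMor hg)).

Definition reduced (p : nat) (phi : cochain p) : Prop :=
  forall X Z Y (c : chain X Z) (c' : chain Z Y),
  phi X Y (ccat c (ccons (fid Z) c')) = 0.

Section Differentials.
Variable r : int.

Definition diff_int (p : nat) (phi : cochain p) : cochain p := fun X Y c =>
  hdiff (r + cdeg c) (phi X Y c)
  - (-1) ^ r *: \sum_(x <- cdiffs c) (-1) ^ x.1 *: phi X Y x.2.

Definition diff0 (p : nat) (phi : cochain p) : cochain p := fun X Y c =>
  match c in chain X Y return hom (lprod X) (lprod Y) with
  | cnil _ => 0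
  | ccons X _ Y F c' =>
      let: existT W (d, G) := clast F c' in
      hcomp (phi _ _ c') (lprodm F)
      + \sum_(x <- cmerges (ccons F c')) (-1) ^ x.1 *: phi X Y x.2
      + ((-1) ^+ (csize c').+1 * (-1) ^ (r * fdeg G)) *:
          hcomp (lprodm G) (phi X W d)
  end.

Definition diff1 (p : nat) (phi : cochain p) : cochain p.+1 := fun X Y c =>
  let tl := fun l : 'I_p.+1 => Lf (lift ord0 l) in
  let ini := fun l : 'I_p.+1 => Lf (lift ord_max l) in
  let ttl := Nd (Lf ord0) (tbind (ltree p) tl) in
  let thd := Nd (tbind (ltree p) ini) (Lf ord_max) in
  let f0 := crow ord0 c in
  let fp := crow ord_max c in
  (-1) ^ (r * deg f0 + kleft ord0 c) *:
    rebracket ttl ttl (htens (r + cdeg (cmap tl c)) f0 (phi _ _ (cmap tl c)))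
  + \sum_(i < p.+1) (-1) ^+ i.+1 *:
      (let T := @block p.+1 p 1 i (rcomb 0 1) in
       rebracket (tbind (ltree p) T) (tbind (ltree p) T) (phi _ _ (cmap T c)))
  + ((-1) ^+ p * (-1) ^ (kright ord_max c)) *:
    rebracket thd thd (htens (deg fp) (phi _ _ (cmap ini c)) fp).

Definition diff_path (p i : nat) (phi : cochain (p - i)) (j : nat)
    (P : seq (tree nat * nat)) : cochain p := fun X Y c =>
  if P is (s, _) :: P' then
    let st := steps 0 P' in
    let T := fun t => @block p (p - i) i j t in
    rebracket (tbind (ltree (p - i)) (T s))
              (tbind (ltree (p - i)) (T (last_tree s st)))
              (phi _ _ (cpath (p - i) i j s st c))
  else 0.

End Differentials.

(* Signs of delta, d_0, d_1 on C^{p,q} in degree r, and of the summands of     *)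
(* d_i, i >= 2: [sgn_path p q r i j P] is for phi in C^{p,q} of degree r.      *)
Record signs := Signs {
  sgn_int : nat -> nat -> int -> bool;
  sgn0 : nat -> nat -> int -> bool;
  sgn1 : nat -> nat -> int -> bool;
  sgn_path : nat -> nat -> int -> nat -> nat -> seq (tree nat * nat) -> bool
}.

Definition tcochain : Type := forall p, cochain p.

Record is_TC (m : int) (z : tcochain) : Prop := IsTC {
  TC_multilinear : forall p, multilinear (z p);
  TC_reduced : forall p, reduced (z p);
  TC_degree : forall p (X Y : 'I_p.+1 -> ob) (c : chain X Y),
    homog (m - p%:Z - (csize c)%:Z + cdeg c) (z p X Y c);
  TC_finite : exists N : nat, forall p (X Y : 'I_p.+1 -> ob) (c : chain X Y),
    (N < p + csize c)%N -> z p X Y c = 0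
}.

(** the component in C^{p,q}, q = csize c, of d z, for z in TC^m *)
Definition tdiff (sg : signs) (m : int) (z : tcochain) : tcochain := fun p X Y c =>
  let q := csize c in
  let r := m + 1 - p%:Z - q%:Z in
  (-1) ^+ sgn_int sg p q (r - 1) *: diff_int (r - 1) (z p) c
  + (-1) ^+ sgn0 sg p q.-1 r *: diff0 r (z p) c
  + match p return forall X Y : 'I_p.+1 -> ob, chain X Y -> hom (lprod X) (lprod Y) with
    | 0 => fun X Y c => 0
    | p'.+1 => fun X Y c => (-1) ^+ sgn1 sg p' q r *: diff1 r (z p') c
    end X Y c
  + \sum_(2 <= i < p.+1) \sum_(0 <= j < (p - i).+1%N)
      \sum_(P <- adm_prod (adm_A i.-1) (adm_I q))
        (-1) ^+ sgn_path sg (p - i)%N (q + i.-1)%N r i j P *: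
          @diff_path p i (z (p - i)%N) j P X Y c.

(* TH^m = 0: every cocycle of degree m is a coboundary.                        *)
Definition TH_zero (sg : signs) (m : int) : Prop :=
  forall z : tcochain, is_TC m z ->
    (forall p (X Y : 'I_p.+1 -> ob) (c : chain X Y), tdiff sg m z c = 0) ->
  exists2 w : tcochain, is_TC (m - 1) w &
    forall p (X Y : 'I_p.+1 -> ob) (c : chain X Y), z p X Y c = tdiff sg (m - 1) w c.

Definition tdiff_sq0 (sg : signs) : Prop :=
  forall (m : int) (z : tcochain), is_TC m z ->
  forall p (X Y : 'I_p.+1 -> ob) (c : chain X Y),
    tdiff sg (m + 1) (tdiff sg m z) c = 0.

End TensorHochschild.

(* Main.v *)
(* Filter TC by total arity p + q and then by p. The leading component x in C^{p,q} of a
   cocycle satisfies d_0 x = 0 and d_1 x = d_0 y for some y, and it suffices to write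
   x = d_0 u + d_1 v with d_0 v = 0, since d(u + v) then changes only x and later
   components. The fibre functors X |-> X(v) are representable, so reduced cochains are
   d_0-exact at each vertex; as A is hereditary with only the arrows from one vertex to
   the other, the primitives at the two vertices can be corrected to commute with the
   arrows, except for q <= 1 and internal degree 0.
   For q = 1 the obstruction is a tuple mu_a in (k^n)^{⊗ p+1}, and the condition on d_1 x
   says that mu_a is, up to a scalar multiple of e_a^{⊗ p+1} independent of a, a cocycle of
   the cobar complex of the coalgebra k^n of grouplike elements e_1, ..., e_n with
   coefficients in k e_a. Contracting the first factor with e_a shows that mu_a is the
   coboundary of some N_a, and N is realized by a cocycle v in C^{p-1,1}. For q = 0 the class is a
   scalar at each vertex, on which d_1 acts by an alternating sum of ones. *)

From HB Require Import structures.
From mathcomp Require Import all_boot all_order all_algebra.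
From mathcomp Require Import ring.
From mathcomp Require Import boolp.
Require Import Defs.
Set Implicit Arguments.
Unset Strict Implicit.
Unset Printing Implicit Defensive.
Import GRing.Theory.
Local Open Scope ring_scope.
(** * Tensors of homogeneous elements *)

Section HomogeneousElements.
Context {k : fieldType}.

(** The contractions at the two vertices are chosen independently, whereas a cochain must commute
    with the arrows. The defect is again a cocycle, of arity one less; retractions of the arrows,
    which exist because the objects are projective, turn a primitive of the defect into a correction
    at e2 alone. At q = 1 the defect has arity 0 and need not have a primitive: it is a natural
    transformation, determined up to sign by the value mu_a of the cocycle on the map [eps a] from
    P_2 to P_1. The relations between d_0 and d_1 are not computed from Koszul signs: d^2 = 0 is
    applied to cochains concentrated in a single bidegree, and the relevant component is read off.
    The internal differential preserves p + q, and the d_i with i >= 2 raise p by at least 2, so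
    neither reaches the two components of dz that decide about a leading term; of the admissible
    paths, only the number of horizontal steps and the words of the bracketings matter. *)

Definition ishom (X : cplx k) (d : int) (x : X) : Prop := pr X d x = x.

Lemma tmkZr (U V : lmodType k) a (u : U) (v : V) : tmk u (a *: v) = a *: tmk u v.
Proof. exact: linearZ. Qed.
Lemma tmkDr2 (U V : lmodType k) (u : U) (v v' : V) :
  tmk u (v + v') = tmk u v + tmk u v'.
Proof. exact: linearD. Qed.
Lemma tmk_sumr (U V : lmodType k) I (r : seq I) (F : I -> V) (u : U) :
  tmk u (\sum_(i <- r) F i) = \sum_(i <- r) tmk u (F i).
Proof. exact: linear_sum. Qed.

Lemma ishomE (X : cplx k) d (x : X) i :
  ishom d x -> pr X i x = if i == d then x else 0.
Proof. by move=> hx; rewrite -hx pr_pr; case: eqP => // _; rewrite hx. Qed.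

Lemma ishom_degs (X : cplx k) d (x : X) : ishom d x -> d \notin degs X -> x = 0.
Proof. by move=> <- hd; rewrite pr_out. Qed.

Lemma kpar_hom (X : cplx k) s d (x : X) :
  ishom d x -> kpar s x = (-1) ^ (s * d) *: x.
Proof. by move=> <-; rewrite kpar_pr. Qed.

Lemma kpar0 (X : cplx k) (x : X) : kpar 0 x = x.
Proof.
rewrite /kpar -[RHS]pr_degs; apply: eq_bigr => i _.
by rewrite mul0r expr0z scale1r.
Qed.

Lemma ishom_tens (X Y : cplx k) d e (x : X) (y : Y) :
  ishom d x -> ishom e y -> @ishom (ctens X Y) (d + e) (tmk x y).
Proof. by move=> <- <-; rewrite /ishom tpr_tmk /= tpr_tpr eqxx. Qed.

End HomogeneousElements.

(** * The word underlying a bracketing *)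

Fixpoint leaves (T : Type) (t : tree T) : seq T :=
  match t with Lf x => [:: x] | Nd l r => leaves l ++ leaves r end.

Lemma leaves_tbind (S T : Type) (t : tree S) (f : S -> tree T) :
  leaves (tbind t f) = flatten [seq leaves (f x) | x <- leaves t].
Proof.
by elim: t => [x|l hl r hr] /=; rewrite ?cats0 // hl hr map_cat flatten_cat.
Qed.

Lemma leaves_trelabel (S T : Type) (f : S -> T) (t : tree S) :
  leaves (trelabel f t) = map f (leaves t).
Proof. by rewrite leaves_tbind; elim: (leaves t) => //= x s ->. Qed.

Lemma leaves_lcomb m : leaves (lcomb m) = iota 0 m.+1.
Proof. by elim: m => // m ih; rewrite [LHS]/= ih -[m.+2]addn1 iotaD. Qed.

Lemma leaves_rcomb a m : leaves (rcomb a m) = iota a m.+1.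
Proof. by elim: m a => // m ih a; rewrite [LHS]/= ih. Qed.

Lemma map_inord_iota m : [seq inord i : 'I_m.+1 | i <- iota 0 m.+1] = enum 'I_m.+1.
Proof.
rewrite -val_enum_ord -map_comp -[RHS]map_id; apply: eq_map => i.
by rewrite /= inord_val.
Qed.

Lemma leaves_ltree p : leaves (ltree p) = enum 'I_p.+1.
Proof. by rewrite leaves_trelabel leaves_lcomb map_inord_iota. Qed.

(** * Pure tensors over a bracketing *)

Section PureTensors.
Context {k : fieldType} {n : nat} {fg : bool}.
Local Notation ob := (ob k n fg).

Lemma hvZ (X Y : ob) (f : hom X Y) v a x : f v (a *: x) = a *: f v x.
Proof. exact: linearZ. Qed.
Lemma hvD (X Y : ob) (f : hom X Y) v x y : f v (x + y) = f v x + f v y.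
Proof. exact: linearD. Qed.
Lemma hv0 (X Y : ob) (f : hom X Y) v : f v 0 = 0.
Proof. exact: linear0. Qed.
Lemma hv_sum (X Y : ob) (f : hom X Y) v I (r : seq I) (F : I -> ov X v) :
  f v (\sum_(i <- r) F i) = \sum_(i <- r) f v (F i).
Proof. exact: linear_sum. Qed.

Lemma gmor_ext (X Y : ob) (f g : gmor X Y) :
  deg f = deg g -> (forall v, f v =1 g v) -> f = g.
Proof.
case: f g => [d f hf] [e g hg] /= ed /homP efg; subst e g.
by congr GMor; exact: Prop_irrelevance.
Qed.

Section Tree.
Variables (J : Type) (X : J -> ob) (v : vertex).

Fixpoint pt (t : tree J) (xi : forall j, ov (X j) v) : ov (tev t X) v :=
  match t return ov (tev t X) v with
  | Lf j => xi j
  | Nd l r => (tmk (pt l xi) (pt r xi) : ov (otens (tev l X) (tev r X)) v)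
  end.

Lemma eq_pt (t : tree J) xi eta : xi = eta -> pt t xi = pt t eta.
Proof. by move=> ->. Qed.

Lemma ishom_pt (t : tree J) (D : J -> int) xi :
  (forall j, ishom (D j) (xi j)) ->
  ishom (\sum_(j <- leaves t) D j) (pt t xi).
Proof.
move=> h; elim: t => [j|l hl r hr] /=; first by rewrite big_seq1.
by rewrite big_cat; apply: ishom_tens.
Qed.

Lemma ishom0_pt (t : tree J) xi :
  (forall j, ishom 0 (xi j)) -> ishom 0 (pt t xi).
Proof. by move=> h; have := ishom_pt t h; rewrite big1. Qed.

End Tree.

Lemma htensE (X Y X' Y' : ob) s (f : hom X Y) (g : hom X' Y') v x y :
  htens s f g v (tmk x y) = tmk (f v (kpar s x)) (g v y).
Proof.
pose h : {linear ov X v -> ov Y v} := f v \o @kpar _ (ov X v) s.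
exact: (tmapE h (g v)).
Qed.

Lemma tevm_NdE (J : Type) (l r : tree J) (X Y : J -> ob) (G : fam X Y) v x y :
  tevm (Nd l r) G v (tmk x y : ov (tev (Nd l r) X) v) =
  tmk (tevm l G v (kpar (deg (tevm r G)) x)) (tevm r G v y).
Proof. exact: htensE. Qed.

Lemma deg_tevm (J : Type) (t : tree J) (X Y : J -> ob) (G : fam X Y) :
  deg (tevm t G) = \sum_(j <- leaves t) deg (G j).
Proof. by elim: t => [j|l hl r hr] /=; rewrite ?big_seq1 // big_cat hl hr. Qed.

(* Exponent of the Koszul sign in (⊗ g_j)(⊗ x_j) = ± ⊗ (g_j x_j), |x_j| = D j *)
Fixpoint ksign (J : Type) (t : tree J) (D E : J -> int) : int :=
  match t with
  | Lf _ => 0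
  | Nd l r => (\sum_(j <- leaves r) E j) * (\sum_(j <- leaves l) D j)
      + ksign l D E + ksign r D E
  end.

Lemma tevm_pt (J : Type) (t : tree J) (X Y : J -> ob) (G : fam X Y) v
    (D : J -> int) (xi : forall j, ov (X j) v) :
  (forall j, ishom (D j) (xi j)) ->
  tevm t G v (pt t xi) =
  (-1) ^ ksign t D (fun j => deg (G j)) *: pt t (fun j => G j v (xi j)).
Proof.
move=> h; elim: t => [j|l hl r hr]; first by rewrite /= expr0z scale1r.
rewrite [pt _ _]/= tevm_NdE (kpar_hom _ (ishom_pt l h)) hvZ hl hr !tmkZl !tmkZr !scalerA.
by rewrite !expN1D deg_tevm.
Qed.

(** Every summand of the Koszul exponent contains the degree of some [xi j]. The representing
    objects live in degree 0, so applying a family to their generators produces no sign. *)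
Lemma tevm_pt0 (J : Type) (t : tree J) (X Y : J -> ob) (G : fam X Y) v
    (xi : forall j, ov (X j) v) :
  (forall j, ishom 0 (xi j)) ->
  tevm t G v (pt t xi) = pt t (fun j => G j v (xi j)).
Proof.
move=> h; rewrite (tevm_pt t G h) (_ : ksign _ _ _ = 0) ?expr0z ?scale1r //.
by elim: t => //= l -> r ->; rewrite [X in _ * X]big1 // mulr0 !addr0.
Qed.

Lemma oact_pt (J : Type) (t : tree J) (X : J -> ob) a (xi : forall j, ov (X j) e1) :
  oact (tev t X) a (pt t xi) = pt t (fun j => oact (X j) a (xi j)).
Proof. by elim: t => //= l <- r <-; rewrite /otact tmapE. Qed.

(** A tensor product of lines is a line, so values on generators are recorded by scalars; with all
    [xi j] zero it shows that a tensor product of zero spaces is zero. *)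
Lemma pt_span (J : Type) (t : tree J) (X : J -> ob) v (xi : forall j, ov (X j) v) :
  (forall j x, exists c, x = c *: xi j) -> forall x, exists c, x = c *: pt t xi.
Proof.
move=> h; elim: t => [j|l hl r hr] x; first exact: h.
have [s ->] := tspan x; rewrite /sum_of.
elim: s => [|[y z] s [c ih]]; first by exists 0; rewrite big_nil scale0r.
have [d ->] := hl y; have [e ->] := hr z.
exists (d * e + c); rewrite big_cons ih scalerDl /=; congr (_ + _).
by rewrite tmkZl linearZ /= scalerA.
Qed.

(** The product of the forms dual to the factors detects the pure tensor, so that scalars in front
    of it can be compared. *)
Lemma pt_form (J : Type) (t : tree J) (X : J -> ob) v (xi : forall j, ov (X j) v)
    (kap : forall j, {linear ov (X j) v -> k^o}) :
  (forall j, kap j (xi j) = 1) ->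
  exists f : {linear ov (tev t X) v -> k^o}, f (pt t xi) = 1.
Proof.
move=> h; elim: t => [j|l [f hf] r [g hg]]; first by exists (kap j); exact: h.
have bb : is_bilin (fun x y => (f x * g y : k^o)).
  split=> z a x y; rewrite linearP.
    by rewrite mulrDr -!scalerAr.
  by rewrite mulrDl -scalerAl.
pose F : {linear ov (tev (Nd l r) X) v -> k^o} :=
  HB.pack (tlift (fun x y => (f x * g y : k^o)) : ov (tev (Nd l r) X) v -> k^o)
   (GRing.isLinear.Build k (ov (tev (Nd l r) X) v) k^o *:%R _ (tlift_linear bb)).
by exists F; rewrite /F /= tlift_mk // hf hg mulr1.
Qed.

End PureTensors.

(** * The objects representing the fibres at the vertices *)

Section RepresentingObjects.
Context {k : fieldType} {n : nat} {fg : bool}.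
Local Notation ob := (ob k n fg).

Definition conc_pr (V : lmodType k) (i : int) : {linear V -> V} :=
  if i == 0 then (idfun : {linear V -> V}) else (\0 : {linear V -> V}).

Fact conc_pr_pr (V : lmodType k) i j x :
  @conc_pr V i (@conc_pr V j x) = if i == j then @conc_pr V j x else 0.
Proof.
rewrite /conc_pr; case: (i =P 0) => [->|/eqP i0]; case: (j =P 0) => [->|/eqP j0] //=.
- by rewrite eq_sym (negPf j0).
- by rewrite (negPf i0).
- by case: ifP.
Qed.

Fact conc_pr_sum (V : lmodType k) :
  exists2 s : seq int, uniq s & forall x, \sum_(i <- s) @conc_pr V i x = x.
Proof. by exists [:: 0] => // x; rewrite big_seq1. Qed.

Fact conc_df_pr (V : lmodType k) i (x : V) :
  (\0 : {linear V -> V}) (conc_pr V i x) = conc_pr V (i + 1) (0 : V).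
Proof. by rewrite linear0. Qed.

Definition conc (V : lmodType k) : cplx k :=
  @Cplx k V (@conc_pr V) \0 (@conc_pr_pr V) (@conc_pr_sum V) (@conc_df_pr V)
    (fun=> erefl).

Lemma findim_ffun d : findim ({ffun 'I_d -> k^o} : lmodType k).
Proof.
exists [seq [ffun j => (i == j)%:R] | i <- enum 'I_d] => x.
exists (fun i => if insub i is Some j then x j else 0).
pose F i := (if insub i is Some j then x j else 0 : k) *:
  [seq ([ffun j => (i == j)%:R] : {ffun 'I_d -> k^o}) | i <- enum 'I_d]`_i.
rewrite -(big_mkord xpredT F) size_map size_enum_ord big_mkord /F.
apply/ffunP => j; rewrite sum_ffunE (bigD1 j) //= big1 ?addr0 => [|i ij].
  rewrite (nth_map j) ?size_enum_ord // nth_ord_enum valK.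
  by rewrite !ffunE eqxx; exact/esym/mulr1.
rewrite (nth_map j) ?size_enum_ord // nth_ord_enum valK.
by rewrite !ffunE (negPf ij); exact: mulr0.
Qed.

(** The number of paths between the two vertices. As the arrows act from the fibre at e1 to the
    fibre at e2, P_1 is (k, k^n) and P_2 is (0, k). *)
Definition pdim (v w : vertex) : nat :=
  match v, w with e1, e1 => 1 | e1, e2 => n | e2, e1 => 0 | e2, e2 => 1 end.
Definition psp v w : lmodType k := {ffun 'I_(pdim v w) -> k^o}.

Definition pact_fun v (a : 'I_n) : psp v e1 -> psp v e2 :=
  match v return psp v e1 -> psp v e2 with
  | e1 => fun x => [ffun i => if i == a then x ord0 else 0]
  | e2 => fun=> 0
  end.
Fact pact_linear v a : linear (@pact_fun v a).
Proof.
case: v => c x y /=; last by rewrite scaler0 addr0.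
apply/ffunP => i; rewrite !ffunE; case: ifP => // _.
by rewrite scaler0 addr0.
Qed.
Definition pact v a : {linear conc (psp v e1) -> conc (psp v e2)} :=
  HB.pack (@pact_fun v a : psp v e1 -> psp v e2)
    (GRing.isLinear.Build k (psp v e1) (psp v e2) *:%R (@pact_fun v a) (@pact_linear v a)).

(** The coordinates on k^n split the arrows jointly; by [retract_projective] this is
    projectivity. *)
Definition pret_fun v (a : 'I_n) : psp v e2 -> psp v e1 :=
  match v return psp v e2 -> psp v e1 with
  | e1 => fun y => [ffun i => y a]
  | e2 => fun=> 0
  end.
Fact pret_linear v a : linear (@pret_fun v a).
Proof.
case: v => c x y /=; last by rewrite scaler0 addr0.
by apply/ffunP => i; rewrite !ffunE.
Qed.
Definition pret v a : {linear psp v e2 -> psp v e1} :=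
  HB.pack (@pret_fun v a)
    (GRing.isLinear.Build k (psp v e2) (psp v e1) *:%R (@pret_fun v a) (@pret_linear v a)).

Fact pact_pr v a i x :
  pact v a (pr (conc (psp v e1)) i x) = pr (conc (psp v e2)) i (pact v a x).
Proof. by rewrite /= /conc_pr; case: eqP => //= _; exact: linear0 (pact v a). Qed.
Fact pact_df v a x :
  pact v a (df (conc (psp v e1)) x) = df (conc (psp v e2)) (pact v a x).
Proof. exact: linear0 (pact v a). Qed.
Fact pact_proj v :
  projective (@QMod k n (fun w => conc (psp v w) : lmodType k) (pact v)).
Proof.
apply: (@retract_projective k n
  (@QMod k n (fun w => conc (psp v w) : lmodType k) (pact v)) (pret v)) => a b /=.
case: v => /= x; last first.
  by apply/ffunP => -[].
apply/ffunP => i; rewrite !ffunE eq_sym; case: eqP => // _.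
  by rewrite (ord1 i).
by rewrite ffunE.
Qed.

(* The object representing M |-> M(v), with the universal element [pgen v]. *)
Definition pob (v : vertex) : ob :=
  @Ob k n fg (fun w => conc (psp v w)) (pact v) (@pact_pr v) (@pact_df v)
    (@pact_proj v) (fun _ w => findim_ffun (pdim v w)).

Definition pgen v : ov (pob v) v :=
  match v return psp v v with e1 => [ffun=> 1] | e2 => [ffun=> 1] end.

Lemma ishom_pob v w (x : ov (pob v) w) : ishom 0 x.
Proof. by []. Qed.

Lemma pgen_span v (x : ov (pob v) v) : exists c, x = c *: pgen v.
Proof.
case: v x => x; exists (x ord0); apply/ffunP => i; rewrite !ffunE (ord1 i);
  exact/esym/mulr1.
Qed.

Lemma pob21_0 (x : ov (pob e2) e1) : x = 0.
Proof. by apply/ffunP => -[]. Qed.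

Definition pbas (a : 'I_n) : ov (pob e1) e2 := oact (pob e1) a (pgen e1).

Lemma pbas_span (x : ov (pob e1) e2) : exists c : 'I_n -> k, x = \sum_a c a *: pbas a.
Proof.
exists x; apply/ffunP => i; rewrite sum_ffunE (bigD1 i) //= big1 ?addr0.
  by rewrite /pbas /= !ffunE eqxx; exact/esym/mulr1.
by move=> j /negPf ji; rewrite /pbas /= !ffunE eq_sym ji; exact: mulr0.
Qed.

Definition pcoord_fun (a : 'I_n) (x : ov (pob e1) e2) : k^o := (x : psp e1 e2) a.
Fact pcoord_linear a : linear (pcoord_fun a).
Proof. by move=> c x y; rewrite /pcoord_fun !ffunE. Qed.
Definition pcoord a : {linear ov (pob e1) e2 -> k^o} :=
  HB.pack (pcoord_fun a)
    (GRing.isLinear.Build k (ov (pob e1) e2) k^o *:%R (pcoord_fun a) (pcoord_linear a)).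

Lemma pcoordE a b : pcoord a (pbas b) = (a == b)%:R.
Proof. by rewrite /= /pcoord_fun /pbas /= !ffunE; case: eqP. Qed.

(** P_1(e2) is spanned by the images of the generator under the arrows, and P_2(e1) is zero. *)
Lemma hom_pob_ext v (X : ob) (f g : hom (pob v) X) :
  f v (pgen v) = g v (pgen v) -> f = g.
Proof.
move=> e; apply: homP => w x.
have ev (y : ov (pob v) v) : f v y = g v y.
  by have [c ->] := pgen_span y; rewrite !hvZ e.
case: v f g e x ev => f g e; case: w => x ev; try exact: ev.
- have [c ->] := pbas_span x; rewrite !hv_sum; apply: eq_bigr => a _.
  by rewrite !hvZ /pbas !hv_act ev.
- by rewrite (pob21_0 x) !hv0.
Qed.

Definition prep_fun v (X : ob) (xi : ov X v) : forall w, ov (pob v) w -> ov X w :=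
  match v return ov X v -> forall w, ov (pob v) w -> ov X w with
  | e1 => fun xi w =>
      match w return ov (pob e1) w -> ov X w with
      | e1 => fun x => (x : psp e1 e1) ord0 *: xi
      | e2 => fun x => \sum_(a < n) (x : psp e1 e2) a *: oact X a xi
      end
  | e2 => fun xi w =>
      match w return ov (pob e2) w -> ov X w with
      | e1 => fun=> 0
      | e2 => fun x => (x : psp e2 e2) ord0 *: xi
      end
  end xi.

Fact prep_linear v (X : ob) (xi : ov X v) w : linear (@prep_fun v X xi w).
Proof.
case: v xi => xi; case: w => c x y /=.
- by rewrite !ffunE scalerDl scalerA.
- rewrite scaler_sumr -big_split; apply: eq_bigr => a _ /=.
  by rewrite !ffunE scalerDl scalerA.
- by rewrite scaler0 addr0.
- by rewrite !ffunE scalerDl scalerA.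
Qed.

Fact prep_act v (X : ob) (xi : ov X v) a x :
  @prep_fun v X xi e2 (oact (pob v) a x) = oact X a (@prep_fun v X xi e1 x).
Proof.
case: v xi x => xi x /=; last first.
  by rewrite linear0 (_ : (0 : psp e2 e2) ord0 = 0) ?scale0r // ffunE.
rewrite (bigD1 a) //= ffunE eqxx linearZ /= big1 ?addr0 // => b /negPf ba.
by rewrite ffunE ba scale0r.
Qed.

Definition prep_hom v (X : ob) (xi : ov X v) : hom (pob v) X :=
  Hom (prep_linear xi) (prep_act xi).

Lemma prep_homE v (X : ob) (xi : ov X v) : prep_hom xi v (pgen v) = xi.
Proof. by case: v xi => xi /=; rewrite ffunE scale1r. Qed.

Fact prep_homog v (X : ob) d (xi : ov X v) : homog d (prep_hom (pr _ d xi)).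
Proof.
move=> w i x; rewrite [pr _ i x]/= /conc_pr; have [->|i0] := eqVneq i 0.
  rewrite add0r /=; case: v xi x => xi x; case: w x => x /=.
  - by rewrite linearZ /= pr_pr eqxx.
  - rewrite linear_sum; apply: eq_bigr => a _ /=.
    by rewrite linearZ /= !oact_pr pr_pr eqxx.
  - by rewrite linear0.
  - by rewrite linearZ /= pr_pr eqxx.
have id : (i + d == d) = false by rewrite -[eqbRHS]add0r (inj_eq (addIr d)) (negPf i0).
rewrite hv0; apply/esym; case: v xi x => xi x; case: w x => x /=.
- by rewrite linearZ /= pr_pr id scaler0.
- rewrite linear_sum big1 // => a _ /=.
  by rewrite linearZ /= !oact_pr pr_pr id scaler0.
- by rewrite linear0.
- by rewrite linearZ /= pr_pr id scaler0.
Qed.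

(** Projecting [xi] to degree [d] first makes this a graded morphism for every [xi], depending
    linearly on [xi] for fixed [d]. *)
Definition prep v (X : ob) (d : int) (xi : ov X v) : gmor (pob v) X :=
  GMor (prep_homog d xi).

Lemma prepE v (X : ob) d (xi : ov X v) : prep d xi v (pgen v) = pr _ d xi.
Proof. exact: prep_homE. Qed.

Lemma gmor_pob_ext v (X : ob) (f g : gmor (pob v) X) :
  deg f = deg g -> f v (pgen v) = g v (pgen v) -> f = g.
Proof. by move=> ed e; apply: gmor_ext ed _ => w x; rewrite (hom_pob_ext e). Qed.

Lemma ishom_gmor v (X Y : ob) (f : gmor X Y) d (x : ov X v) :
  ishom d x -> ishom (d + deg f) (f v x).
Proof. by move=> hx; rewrite /ishom -gvalP hx. Qed.

Lemma prep_gmor v (X : ob) (f : gmor (pob v) X) : prep (deg f) (f v (pgen v)) = f.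
Proof.
apply: gmor_pob_ext => //; rewrite prepE.
by rewrite -[X in pr _ X]add0r; apply: (ishom_gmor f).
Qed.

End RepresentingObjects.
Arguments pgen {k n fg} v.
Arguments pob {k n fg} v.

(** * Multilinearity in the columns of a chain *)

Section ListRelations.
Variables (T : Type).
Implicit Types l : seq (int * T).

Fixpoint lall (P : T -> Prop) l : Prop :=
  if l is x :: l' then P x.2 /\ lall P l' else True.

Lemma lall_cat P l l' : lall P l -> lall P l' -> lall P (l ++ l').
Proof. by elim: l => //= x l ih [Px Pl] Pl'; split=> //; apply: ih. Qed.

Lemma lall_impl (P Q : T -> Prop) l : (forall x, P x -> Q x) -> lall P l -> lall Q l.
Proof. by move=> PQ; elim: l => //= x l ih [/PQ Px Pl]; split=> //; apply: ih. Qed.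

Lemma lall_sum (V : nmodType) P l (F G : int * T -> V) :
  lall P l -> (forall s x, P x -> F (s, x) = G (s, x)) ->
  \sum_(x <- l) F x = \sum_(x <- l) G x.
Proof.
move=> h FG; elim: l h => [|[s x] l ih] /=; first by rewrite !big_nil.
by move=> [Px Pl]; rewrite !big_cons ih // FG.
Qed.

Lemma lall_sum0 (V : nmodType) P l (F : int * T -> V) :
  lall P l -> (forall s x, P x -> F (s, x) = 0) -> \sum_(x <- l) F x = 0.
Proof. by move=> h F0; rewrite (lall_sum (G := fun=> 0) h) // big1. Qed.

(** [R x x1 x2] stands for a relation x = a x1 + x2 in one slot. The three lists carry the same
    signs entry by entry, which is what makes the signed sums over [cmerges] and [cdiffs] linear in
    each slot. *)
Inductive lrel (R : T -> T -> T -> Prop) :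
    seq (int * T) -> seq (int * T) -> seq (int * T) -> Prop :=
| lrel_nil : lrel R [::] [::] [::]
| lrel_cons s x x1 x2 l l1 l2 :
    R x x1 x2 -> lrel R l l1 l2 -> lrel R ((s, x) :: l) ((s, x1) :: l1) ((s, x2) :: l2).

Lemma lrel_cat R l l1 l2 m m1 m2 :
  lrel R l l1 l2 -> lrel R m m1 m2 -> lrel R (l ++ m) (l1 ++ m1) (l2 ++ m2).
Proof. by elim=> //= *; constructor; auto. Qed.

Lemma lrel_sum (K : pzRingType) (V : lmodType K) R l l1 l2 (F : int * T -> V) a :
  lrel R l l1 l2 ->
  (forall s x x1 x2, R x x1 x2 -> F (s, x) = a *: F (s, x1) + F (s, x2)) ->
  \sum_(x <- l) F x = a *: (\sum_(x <- l1) F x) + \sum_(x <- l2) F x.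
Proof.
move=> h HF; elim: h => [|s x x1 x2 {}l {}l1 {}l2 Rx _ ih].
  by rewrite !big_nil scaler0 addr0.
by rewrite !big_cons ih (HF _ _ _ _ Rx) scalerDr addrACA.
Qed.
End ListRelations.

Lemma lall_map (S T : Type) (f : int * S -> int * T) (P : T -> Prop) l :
  lall (fun x => forall s, P (f (s, x)).2) l -> lall P (map f l).
Proof. by elim: l => //= -[s x] l ih [Px Pl]; split=> //; apply: ih. Qed.

Lemma lrel_map (S T : Type) (R : S -> S -> S -> Prop) (R' : T -> T -> T -> Prop)
    (u : int -> int) (f f1 f2 : S -> T) l l1 l2 :
  (forall x x1 x2, R x x1 x2 -> R' (f x) (f1 x1) (f2 x2)) ->
  lrel R l l1 l2 ->
  lrel R' [seq (u x.1, f x.2) | x <- l] [seq (u x.1, f1 x.2) | x <- l1]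
    [seq (u x.1, f2 x.2) | x <- l2].
Proof. by move=> h; elim=> /= *; constructor; auto. Qed.

Lemma lrel_diag (T : Type) (l : seq (int * T)) : lrel (fun x y z => x = y /\ x = z) l l l.
Proof. by elim: l => [|[s x] l ih]; constructor. Qed.

Section LinearSlots.
Context {k : fieldType} {n : nat} {fg : bool}.
Local Notation ob := (ob k n fg).

Definition glin (a : k) (X Y : ob) (f f1 f2 : gmor X Y) : Prop :=
  [/\ deg f1 = deg f, deg f2 = deg f & (f : hom X Y) = a *: (f1 : hom X Y) + f2].

Lemma glinE a (X Y : ob) (f f1 f2 : gmor X Y) v x :
  glin a f f1 f2 -> f v x = a *: f1 v x + f2 v x.
Proof. by case=> _ _ ->. Qed.

Lemma glin_intro a (X Y : ob) (f f1 f2 : gmor X Y) :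
  deg f1 = deg f -> deg f2 = deg f ->
  (forall v x, f v x = a *: f1 v x + f2 v x) -> glin a f f1 f2.
Proof. by move=> e1 e2 e; split=> //; apply: homP. Qed.

Section Slots.
Variable J : eqType.

(** Linearity in one row is phrased as a relation because graded morphisms carry their degree and
    cannot be added freely. *)
Definition slin (j : J) a (X Y : J -> ob) (F F1 F2 : fam X Y) : Prop :=
  (forall i, i != j -> F1 i = F i /\ F2 i = F i) /\ glin a (F j) (F1 j) (F2 j).

Lemma slin_deg j a (X Y : J -> ob) (F F1 F2 : fam X Y) : slin j a F F1 F2 ->
  (fun i => deg (F1 i)) = (fun i => deg (F i)) /\
  (fun i => deg (F2 i)) = (fun i => deg (F i)).
Proof.
case=> h [e1 e2 _]; split; apply/funext => i.
  by have [->//|/h [->]] := eqVneq i j.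
by have [->//|/h [_ ->]] := eqVneq i j.
Qed.

Lemma slin_dfwith j a (X Y : J -> ob) (F : fam X Y) f f1 f2 :
  glin a f f1 f2 -> slin j a (dfwith (i := j) F f) (dfwith (i := j) F f1) (dfwith (i := j) F f2).
Proof.
move=> h; split=> [i ij|]; last by rewrite !dfwith_in.
by rewrite !dfwith_out // eq_sym.
Qed.

Lemma slinP j a (X Y : J -> ob) (F F1 F2 : fam X Y) : slin j a F F1 F2 ->
  exists (G : fam X Y) f f1 f2, [/\ glin a f f1 f2, F = dfwith (i := j) G f,
    F1 = dfwith (i := j) G f1 & F2 = dfwith (i := j) G f2].
Proof.
case=> h hj; exists F, (F j), (F1 j), (F2 j); split=> //;
  apply: functional_extensionality_dep => i; case: dfwithP => // i' ji; by
  rewrite eq_sym in ji; have [e1 e2] := h _ ji.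
Qed.

Lemma eq_tevm (t : tree J) (X Y : J -> ob) (F G : fam X Y) :
  {in leaves t, forall j, F j = G j} -> tevm t F = tevm t G.
Proof.
elim: t => [j|l hl r hr] h /=; first by apply: h; rewrite inE.
by rewrite hl ?hr // => j jt; apply: h; rewrite /= mem_cat jt ?orbT.
Qed.

Lemma glin_tens1 a (X Y X' Y' : ob) (f f1 f2 : gmor X Y) (g : gmor X' Y') :
  glin a f f1 f2 -> glin a (gtens f g) (gtens f1 g) (gtens f2 g).
Proof.
move=> h; have [e1 e2 _] := h; apply: glin_intro; rewrite /= ?e1 ?e2 //.
move=> v.
pose L : {linear ov (otens X X') v -> ov (otens Y Y') v} := htens (deg g) f g v.
pose M : {linear ov (otens X X') v -> ov (otens Y Y') v} :=
  a \*: htens (deg g) f1 g v \+ htens (deg g) f2 g v.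
apply: (@tprod_ext _ _ _ _ L M) => x y.
change (htens (deg g) f g v (tmk x y) =
  a *: htens (deg g) f1 g v (tmk x y) + htens (deg g) f2 g v (tmk x y)).
by rewrite !htensE (glinE _ h) tmkD1 tmkZl.
Qed.

Lemma glin_tens2 a (X Y X' Y' : ob) (f : gmor X Y) (g g1 g2 : gmor X' Y') :
  glin a g g1 g2 -> glin a (gtens f g) (gtens f g1) (gtens f g2).
Proof.
move=> h; have [e1 e2 _] := h; apply: glin_intro; rewrite /= ?e1 ?e2 //.
move=> v.
pose L : {linear ov (otens X X') v -> ov (otens Y Y') v} := htens (deg g) f g v.
pose M : {linear ov (otens X X') v -> ov (otens Y Y') v} :=
  a \*: htens (deg g) f g1 v \+ htens (deg g) f g2 v.
apply: (@tprod_ext _ _ _ _ L M) => x y.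
change (htens (deg g) f g v (tmk x y) =
  a *: htens (deg g) f g1 v (tmk x y) + htens (deg g) f g2 v (tmk x y)).
by rewrite !htensE (glinE _ h) tmkDr2 tmkZr.
Qed.

Lemma glin_comp1 a (X Y Z : ob) (f : gmor X Y) (g g1 g2 : gmor Y Z) :
  glin a g g1 g2 -> glin a (gcomp g f) (gcomp g1 f) (gcomp g2 f).
Proof.
move=> h; have [e1 e2 _] := h; apply: glin_intro; rewrite /= ?e1 ?e2 // => v x.
exact: (glinE _ h).
Qed.

Lemma glin_comp2 a (X Y Z : ob) (f f1 f2 : gmor X Y) (g : gmor Y Z) :
  glin a f f1 f2 -> glin a (gcomp g f) (gcomp g f1) (gcomp g f2).
Proof.
move=> h; have [e1 e2 _] := h; apply: glin_intro; rewrite /= ?e1 ?e2 // => v x.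
by rewrite (glinE _ h) hvD hvZ.
Qed.

Lemma tevm_slin j a (X Y : J -> ob) (F F1 F2 : fam X Y) (t : tree J) :
  slin j a F F1 F2 -> uniq (leaves t) -> j \in leaves t ->
  glin a (tevm t F) (tevm t F1) (tevm t F2).
Proof.
move=> h; have [h0 hj] := h; elim: t => [i|l hl r hr] /=.
  by move=> _; rewrite inE => /eqP <-.
have out s : j \notin leaves s -> tevm s F1 = tevm s F /\ tevm s F2 = tevm s F.
  move=> js; split; apply: eq_tevm => i it;
    (have [|e1 e2] := h0 i; [by apply: contraNneq js => <-|by rewrite ?e1 ?e2]).
rewrite cat_uniq => /and3P [ul /hasPn ulr ur]; rewrite mem_cat => /orP[jl|jr].
  have [|-> ->] := out r; first by apply: contraL jl; exact: ulr.
  exact/glin_tens1/hl.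
have [|-> ->] := out l; first exact: ulr.
exact/glin_tens2/hr.
Qed.

Lemma tevm_slin_out j a (X Y : J -> ob) (F F1 F2 : fam X Y) (t : tree J) :
  slin j a F F1 F2 -> j \notin leaves t ->
  tevm t F1 = tevm t F /\ tevm t F2 = tevm t F.
Proof.
move=> [h0 _] js; split; apply: eq_tevm => i it;
  (have [|e1 e2] := h0 i; [by apply: contraNneq js => <-|by rewrite ?e1 ?e2]).
Qed.

End Slots.

Section Chains.
Variable p : nat.
Local Notation J := 'I_p.+1.

(** Unlike [multilinear], which cuts a chain by [ccat], this relation follows the recursive
    structure of chains, so it passes through operations on chains by induction; [mlinearP]
    translates between the two. *)
Fixpoint lin3 (j : J) a X Y (c : @chain k n fg p X Y) : chain X Y -> chain X Y -> Prop :=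
  match c in chain X Y return chain X Y -> chain X Y -> Prop with
  | cnil _ => fun _ _ => False
  | ccons X Z Y F c' => fun c1 c2 =>
      (exists F1 F2, [/\ slin j a F F1 F2, c1 = ccons F1 c' & c2 = ccons F2 c']) \/
      (exists c1' c2', [/\ lin3 j a c' c1' c2', c1 = ccons F c1' & c2 = ccons F c2'])
  end.

Definition mlinear (phi : cochain p) : Prop := forall j a X Y (c c1 c2 : chain X Y),
  lin3 j a c c1 c2 -> phi X Y c = a *: phi X Y c1 + phi X Y c2.

Lemma lin3_ccat j a X Z Y (c0 : @chain k n fg p X Z) (c c1 c2 : chain Z Y) :
  lin3 j a c c1 c2 -> lin3 j a (ccat c0 c) (ccat c0 c1) (ccat c0 c2).
Proof.
elim: c0 c c1 c2 => //= X' Z' Y' F c0 ih c c1 c2 /ih h.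
by right; exists (ccat c0 c1), (ccat c0 c2).
Qed.

Lemma lin3P j a X Y (c c1 c2 : @chain k n fg p X Y) : lin3 j a c c1 c2 ->
  exists Z Z' (d : chain X Z) (F F1 F2 : fam Z Z') (d' : chain Z' Y),
  [/\ slin j a F F1 F2, c = ccat d (ccons F d'), c1 = ccat d (ccons F1 d')
    & c2 = ccat d (ccons F2 d')].
Proof.
elim: c c1 c2 => //= {}X Z {}Y F c ih c1 c2 [[F1 [F2 [h -> ->]]]|].
  by exists X, Z, (cnil X), F, F1, F2, c.
move=> [c1' [c2' [/ih [Z1 [Z1' [d [G [G1 [G2 [d' [h -> -> ->]]]]]]]] -> ->]]].
by exists Z1, Z1', (ccons F d), G, G1, G2, d'.
Qed.

Lemma mlinearP (phi : cochain p) : mlinear phi <-> multilinear phi.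
Proof.
split=> h.
  move=> X Z Z' Y c F c' j a r f g hf hg hfg /=; apply: (h j).
  by apply: lin3_ccat; left; do 2 eexists; split=> //; exact: slin_dfwith.
move=> j a X Y c c1 c2 /lin3P [Z [Z' [d [F [F1 [F2 [d' [hF -> -> ->]]]]]]]].
have [G [[r f hf] [[r1 f1 hf1] [[r2 f2 hf2] [[/= e1 e2 e] -> -> ->]]]]] := slinP hF.
subst r1 r2 f; exact: (h _ _ _ _ d G d' j a r f1 f2 hf1 hf2 hf).
Qed.

(** Whole chains are equated, since the column F : X -> Z can be compared with [fid X] only once Z
    is identified with X. *)
Fixpoint idc X Y (c : @chain k n fg p X Y) : Prop :=
  match c with
  | cnil _ => False
  | ccons X Z Y F c' => (exists c'', ccons F c' = ccons (fid X) c'') \/ idc c'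
  end.

Definition idreduced (phi : cochain p) : Prop :=
  forall X Y (c : @chain k n fg p X Y), idc c -> phi X Y c = 0.

Lemma idcP X Y (c : @chain k n fg p X Y) : idc c ->
  exists Z (d : chain X Z) d', c = ccat d (ccons (fid Z) d').
Proof.
elim: c => //= {}X Z {}Y F c ih [[c'' ->]|/ih [Z' [d [d' ->]]]].
  by exists X, (cnil X), c''.
by exists Z', (ccons F d), d'.
Qed.

Lemma idc_ccat X Z Y (c0 : @chain k n fg p X Z) (c : chain Z Y) :
  idc c -> idc (ccat c0 c).
Proof. by elim: c0 c => //= X' Z' Y' F c0 ih c /ih; right. Qed.

Lemma idreducedP (phi : cochain p) : idreduced phi <-> reduced phi.
Proof.
split=> h; first by move=> X Z Y c c'; apply: h; apply: idc_ccat; left; exists c'.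
by move=> X Y c /idcP [Z [d [d' ->]]]; apply: h.
Qed.

(* Multilinear reduced cochains vanish on such chains. *)
Definition dead X Y (c : @chain k n fg p X Y) : Prop :=
  idc c \/ exists j, lin3 j (-1) c c c.

(** A zero entry satisfies f = -f + f, so the chain is related to itself, and every multilinear
    value y on it satisfies y = -y + y. *)
Lemma lin3_zero (j : J) X Z Y (F : @fam k n fg J X Z) (c : chain Z Y) :
  (F j : hom _ _) = 0 -> lin3 j (-1) (ccons F c) (ccons F c) (ccons F c).
Proof.
move=> F0; left; exists F, F; split=> //; split=> //.
by split=> //; rewrite F0 scaler0 addr0.
Qed.

Lemma dead_ccons X Z Y (F : @fam k n fg J X Z) (c : chain Z Y) :
  dead c -> dead (ccons F c).
Proof. by case=> [h|[j h]]; [left; right|right; exists j; right; exists c, c]. Qed.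

Lemma lin3_csize j a X Y (c c1 c2 : @chain k n fg p X Y) :
  lin3 j a c c1 c2 -> csize c1 = csize c /\ csize c2 = csize c.
Proof.
elim: c c1 c2 => //= {}X Z {}Y F c ih c1 c2 [[F1 [F2 [h -> ->]]]|] //=.
by move=> [c1' [c2' [/ih [h1 h2] -> ->]]] /=; rewrite h1 h2.
Qed.

Lemma slin_fdeg j a X Y (F F1 F2 : @fam k n fg J X Y) :
  slin j a F F1 F2 -> fdeg F1 = fdeg F /\ fdeg F2 = fdeg F.
Proof.
move=> /slin_deg [h1 h2]; split; apply: eq_bigr => i _.
  by rewrite -[LHS]/((fun i => deg (F1 i)) i) h1.
by rewrite -[LHS]/((fun i => deg (F2 i)) i) h2.
Qed.

Lemma lin3_cdeg j a X Y (c c1 c2 : @chain k n fg p X Y) :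
  lin3 j a c c1 c2 -> cdeg c1 = cdeg c /\ cdeg c2 = cdeg c.
Proof.
elim: c c1 c2 => //= {}X Z {}Y F c ih c1 c2 [[F1 [F2 [h -> ->]]]|] /=.
  by have [-> ->] := slin_fdeg h.
by move=> [c1' [c2' [/ih [h1 h2] -> ->]]] /=; rewrite h1 h2.
Qed.

(** The sign of composing two columns is the sign of a left-bracketed tensor product of maps applied
    to a pure tensor; in particular it depends on the degrees only. *)
Lemma kcompE X Y Z (G : @fam k n fg J Y Z) (F : fam X Y) :
  kcomp G F = ksign (ltree p) (fun i => deg (F i)) (fun i => deg (G i)).
Proof.
pose D i := deg (F (inord i)); pose E i := deg (G (inord i)).
have K m : (m <= p)%N ->
    ksign (trelabel inord (lcomb m)) (fun i => deg (F i)) (fun i => deg (G i)) =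
    \sum_(0 <= i' < m.+1) \sum_(0 <= i < i') D i * E i'.
  elim: m => [|m ih] mp; first by rewrite big_nat1 big_geq.
  rewrite big_nat_recr //= ih ?(ltnW mp) // big_seq1 leaves_trelabel leaves_lcomb.
  rewrite big_map addr0 addrC mulr_sumr; congr (_ + _).
  by apply: eq_bigr => i _; rewrite mulrC.
rewrite /ltree K // big_mkord /kcomp (exchange_big_dep xpredT) //=.
apply: eq_bigr => i' _.
rewrite big_mkord (big_ord_widen _ (fun i => D i * E i') (ltnW (ltn_ord i'))).
by apply: eq_bigr => i _; rewrite /D /E !inord_val.
Qed.

End Chains.
End LinearSlots.

(** * Composing columns and splitting off the last one *)

Section ColumnOperations.
Context {k : fieldType} {n : nat} {fg : bool} {p : nat}.
Local Notation ob := (ob k n fg).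
Local Notation J := 'I_p.+1.
Local Notation chain := (@chain k n fg p).
Local Notation fam := (@fam k n fg J).

Lemma slin_comp1 j a (X Y Z : J -> ob) (F : fam X Y) (G G1 G2 : fam Y Z) :
  slin j a G G1 G2 -> slin j a (fcomp G F) (fcomp G1 F) (fcomp G2 F).
Proof.
case=> h hj; split; last exact: glin_comp1.
by move=> i /h [e1 e2]; rewrite /fcomp e1 e2.
Qed.

Lemma slin_comp2 j a (X Y Z : J -> ob) (F F1 F2 : fam X Y) (G : fam Y Z) :
  slin j a F F1 F2 -> slin j a (fcomp G F) (fcomp G F1) (fcomp G F2).
Proof.
case=> h hj; split; last exact: glin_comp2.
by move=> i /h [e1 e2]; rewrite /fcomp e1 e2.
Qed.

Lemma fcomp_idr (X Y : J -> ob) (F : fam X Y) : fcomp F (fid X) = F.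
Proof.
apply: functional_extensionality_dep => j; apply: gmor_ext => //=.
by rewrite addr0.
Qed.

Lemma fcomp_idl (X Y : J -> ob) (F : fam X Y) : fcomp (fid Y) F = F.
Proof.
apply: functional_extensionality_dep => j; apply: gmor_ext => //=.
by rewrite add0r.
Qed.

Lemma slin_kcomp1 j a (X Y Z : J -> ob) (F : fam X Y) (G G1 G2 : fam Y Z) :
  slin j a G G1 G2 -> kcomp G1 F = kcomp G F /\ kcomp G2 F = kcomp G F.
Proof. by move=> /slin_deg [h1 h2]; rewrite !kcompE h1 h2. Qed.

Lemma slin_kcomp2 j a (X Y Z : J -> ob) (F F1 F2 : fam X Y) (G : fam Y Z) :
  slin j a F F1 F2 -> kcomp G F1 = kcomp G F /\ kcomp G F2 = kcomp G F.
Proof. by move=> /slin_deg [h1 h2]; rewrite !kcompE h1 h2. Qed.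

Lemma kcomp_idr (X Y : J -> ob) (F : fam X Y) : kcomp F (fid X) = 0.
Proof. by rewrite /kcomp big1 // => i _; rewrite big1 // => i' _; rewrite mul0r. Qed.

Lemma kcomp_idl (X Y : J -> ob) (F : fam X Y) : kcomp (fid Y) F = 0.
Proof. by rewrite /kcomp big1 // => i _; rewrite big1 // => i' _; rewrite mulr0. Qed.

Lemma fdeg_id (X : J -> ob) : fdeg (fid X) = 0 :> int.
Proof. by rewrite /fdeg big1. Qed.

Lemma fdeg_comp (X Y Z : J -> ob) (F : fam X Y) (G : fam Y Z) :
  fdeg (fcomp G F) = fdeg G + fdeg F.
Proof. by rewrite /fdeg -big_split. Qed.

Lemma cmerges_ccons (X Z Y : J -> ob) (F : fam X Z) (c : chain Z Y) :
  cmerges (ccons F c) =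
  cmerge1 F c ++ [seq (1 + x.1, ccons F x.2) | x <- cmerges c].
Proof. by []. Qed.

Lemma lrel_cmerges j a X Y (c c1 c2 : chain X Y) :
  lin3 j a c c1 c2 -> lrel (@lin3 _ _ _ _ j a X Y) (cmerges c) (cmerges c1) (cmerges c2).
Proof.
elim: c c1 c2 => //= {}X Z {}Y F c ih c1 c2 [[F1 [F2 [h -> ->]]]|].
  apply: lrel_cat; last first.
    apply: (@lrel_map _ _ _ _ (fun s => 1 + s)); last exact: lrel_diag.
    by move=> x _ _ [<- <-]; left; exists F1, F2.
  case: c {ih} F F1 F2 h => [Y'|Z' Z'' Y' G c] F F1 F2 h /=; first by constructor.
  have [-> ->] := slin_kcomp2 G h; constructor; last by constructor.
  by left; do 2 eexists; split; first exact: slin_comp2 h.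
move=> [c1' [c2' [h -> ->]]]; apply: lrel_cat; last first.
  apply: (@lrel_map _ _ _ _ (fun s => 1 + s)); last exact: ih.
  by move=> x x1 x2 hx; right; exists x1, x2.
case: c {ih} F c1' c2' h => [Y'|Z' Z'' Y' G c] F c1' c2' //=.
case=> [[G1 [G2 [h -> ->]]]|[c1'' [c2'' [h -> ->]]]] /=.
  have [-> ->] := slin_kcomp1 F h; constructor; last by constructor.
  by left; do 2 eexists; split; first exact: slin_comp1 h.
constructor; last by constructor.
by right; exists c1'', c2''.
Qed.

Lemma cmerges_size X Y (c : chain X Y) :
  lall (fun x => (csize x).+1 = csize c /\ cdeg x = cdeg c) (cmerges c).
Proof.
elim: c => //= {}X Z {}Y F c ih; apply: lall_cat; last first.
  by apply: lall_map; apply: lall_impl ih => x [h1 h2] s /=; rewrite h1 h2.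
case: c F {ih} => //= Z' Z'' Y' G c F; split=> //; split=> //.
by rewrite fdeg_comp addrA.
Qed.

(** Splitting off the last column hides the intermediate object in a sigma type; a common witness W
    keeps the three results comparable. *)
Definition lrel_last j a X Y
    (s s1 s2 : {W : J -> ob & (chain X W * fam W Y)%type}) : Prop :=
  exists W d d1 d2 G G1 G2, [/\ s = existT _ W (d, G), s1 = existT _ W (d1, G1),
    s2 = existT _ W (d2, G2) &
    (slin j a G G1 G2 /\ d1 = d /\ d2 = d) \/
    (lin3 j a d d1 d2 /\ G1 = G /\ G2 = G)].

Lemma lrel_last_ccons j a X Z Y (F : fam X Z) s s1 s2 :
  @lrel_last j a Z Y s s1 s2 ->
  @lrel_last j a X Y (let: existT W (d, H) := s in existT _ W (ccons F d, H))
    (let: existT W (d, H) := s1 in existT _ W (ccons F d, H))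
    (let: existT W (d, H) := s2 in existT _ W (ccons F d, H)).
Proof.
move=> [W [d [d1 [d2 [G [G1 [G2 [-> -> -> h]]]]]]]].
exists W, (ccons F d), (ccons F d1), (ccons F d2), G, G1, G2; split=> //.
case: h => [[h [-> ->]]|[h [-> ->]]]; [by left|right; split=> //].
by right; exists d1, d2.
Qed.

Lemma lrel_clast j a X Z Y (F : fam X Z) (c c1 c2 : chain Z Y) :
  lin3 j a c c1 c2 -> lrel_last j a (clast F c) (clast F c1) (clast F c2).
Proof.
elim: c X F c1 c2 => //= Z1 Z' Y' G c ih X F c1 c2.
case=> [[G1 [G2 [h -> ->]]]|[c1' [c2' [h -> ->]]]] /=; last first.
  exact/lrel_last_ccons/ih.
apply: lrel_last_ccons.
case: c G G1 G2 h {F ih} => [Y1|Z2 Z3 Y1 K c] G G1 G2 h /=.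
  by exists Z1, (cnil _), (cnil _), (cnil _), G, G1, G2; split=> //; left.
case E : (clast K c) => [W [d H]].
exists W, (ccons G d), (ccons G1 d), (ccons G2 d), H, H, H; split=> //.
by right; split=> //; left; exists G1, G2.
Qed.

Lemma lrel_clast1 j a X Z Y (F F1 F2 : fam X Z) (c : chain Z Y) :
  slin j a F F1 F2 -> lrel_last j a (clast F c) (clast F1 c) (clast F2 c).
Proof.
case: c F F1 F2 => [Y1|Z2 Z3 Y1 K c] F F1 F2 h /=.
  by exists X, (cnil _), (cnil _), (cnil _), F, F1, F2; split=> //; left.
case E : (clast K c) => [W [d H]].
exists W, (ccons F d), (ccons F1 d), (ccons F2 d), H, H, H; split=> //.
by right; split=> //; left; exists F1, F2.
Qed.

Lemma clast_size X Z Y (F : fam X Z) (c : chain Z Y) :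
  let s := projT2 (clast F c) in
  csize s.1 = csize c /\ cdeg s.1 + fdeg s.2 = cdeg c + fdeg F.
Proof.
elim: c X F => //= Z1 Z' Y' K c ih X F.
have := ih _ K; case: (clast K c) => [W [d H]] /= [-> e]; split=> //.
by rewrite addrAC e.
Qed.

End ColumnOperations.

Lemma addr3ACA (V : nmodType) (a a' b b' c c' : V) :
  a + a' + (b + b') + (c + c') = (a + b + c) + (a' + b' + c').
Proof. by rewrite (addrACA a) addrACA. Qed.

(** * The differential [d_0] at a vertex *)

Section MergeSums.
Context {k : fieldType} {n : nat} {fg : bool} {p : nat}.
Local Notation ob := (ob k n fg).
Local Notation J := 'I_p.+1.
Local Notation chain := (@chain k n fg p).
Local Notation fam := (@fam k n fg J).
Variable V : lmodType k.

Definition msum X Y (psi : chain X Y -> V) (c : chain X Y) : V :=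
  \sum_(x <- cmerges c) (-1) ^ x.1 *: psi x.2.

Lemma scale_expN1S s (x : V) : (-1 : k) ^ (1 + s) *: x = - ((-1) ^ s *: x).
Proof. by rewrite expN1D expr1z mulN1r scaleNr. Qed.

Lemma msum_cons X Z Z' Y (F : fam X Z) (G : fam Z Z') (c : chain Z' Y)
    (psi : chain X Y -> V) :
  msum psi (ccons F (ccons G c)) =
  - ((-1) ^ kcomp G F *: psi (ccons (fcomp G F) c)
     + msum (fun d => psi (ccons F d)) (ccons G c)).
Proof.
rewrite /msum [cmerges (ccons F _)]cmerges_ccons big_cat big_seq1 big_map.
rewrite opprD /= scale_expN1S; congr (_ + _).
by rewrite -sumrN; apply: eq_bigr => x _; rewrite scale_expN1S.
Qed.

Lemma msum1 X Z (F : fam X Z) (psi : chain X Z -> V) :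
  msum psi (ccons F (cnil Z)) = 0.
Proof. by rewrite /msum /= big_nil. Qed.

Lemma msum_dead X Y (psi : chain X Y -> V) (c : chain X Y) P :
  lall P (cmerges c) -> (forall d, P d -> psi d = 0) -> msum psi c = 0.
Proof. by move=> h e; apply: lall_sum0 h _ => s x /e /= ->; rewrite scaler0. Qed.

(** All merges but the first keep the identity column in front and are killed; the first one gives
    back [c] with sign -1. A single column has nothing to merge with. *)
Lemma msum_idhead X Y (c : chain X Y) (psi : chain X Y -> V) :
  (forall d, dead d -> psi d = 0) ->
  msum psi (ccons (fid X) c) = if csize c is _.+1 then - psi c else 0.
Proof.
case: c psi => [Y1|X1 Z Y1 H c] psi hpsi; first exact: msum1.
rewrite msum_cons kcomp_idr expr0z scale1r fcomp_idr (@msum_dead _ _ _ _ (fun=> True)).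
- by rewrite addr0.
- by elim: (cmerges _).
by move=> d _; apply: hpsi; left; left; exists d.
Qed.

Lemma clast_ccons X Z Z' Y (F : fam X Z) (G : fam Z Z') (c : chain Z' Y) :
  clast F (ccons G c) =
  let: existT W (d, H) := clast G c in existT _ W (ccons F d, H).
Proof. by []. Qed.

(** Merging an identity column with its left or its right neighbour gives the same chain with
    opposite signs; for the last column, the last term of d_0 replaces the second merge. [om]
    abstracts this last term, so that the induction can absorb the first column into both [psi] and
    [om]. *)
Lemma msum_id X Z Y (F : fam X Z) (c : chain Z Y) (psi : chain X Y -> V)
    (om : {W : J -> ob & (chain X W * fam W Y)%type} -> V) :
  idc c ->
  (forall d, dead d -> psi d = 0) ->
  (forall W (d : chain X W) G, dead d -> om (existT _ W (d, G)) = 0) ->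
  (forall d, om (existT _ Y (d, fid Y)) = psi d) ->
  msum psi (ccons F c) + (-1) ^+ (csize c).+1 *: om (clast F c) = 0.
Proof.
elim: c X F psi om => // {}Z Z' {}Y K c ih X F psi om hid hpsi hom hom1.
case: hid => [[c'' e]|hid].
  have -> : csize (ccons K c) = (csize c'').+1.
    by rewrite (congr1 (@csize _ _ _ _ _ _) e).
  rewrite e msum_cons kcomp_idl expr0z scale1r fcomp_idl msum_idhead; last first.
    by move=> d hd; apply: hpsi; exact: dead_ccons.
  case: c'' {K c ih e} F psi om hpsi hom hom1 => [Y1|Z1 Z2 Y1 H c''] F psi om hpsi hom hom1.
    by rewrite /= hom1 addr0 sqrrN expr1n scale1r addNr.
  rewrite subrr oppr0 add0r !clast_ccons; case: (clast H c'') => W [d G].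
  by rewrite hom ?scaler0 //; apply: dead_ccons; left; left; exists d.
rewrite msum_cons hpsi; last by left; right.
rewrite scaler0 add0r exprS mulN1r scaleNr -opprD; apply/eqP; rewrite oppr_eq0.
pose om' (s : {W : J -> ob & (chain Z W * fam W Y)%type}) :=
  om (let: existT W (d, H) := s in existT _ W (ccons F d, H)).
apply/eqP; apply: (ih _ K _ om') => //.
- by move=> d hd; apply: hpsi; exact: dead_ccons.
- by move=> W d G hd; apply: hom; exact: dead_ccons.
- by move=> d; exact: hom1.
Qed.

End MergeSums.

Section VertexCochains.
Context {k : fieldType} {n : nat} {fg : bool} {p : nat}.
Local Notation ob := (ob k n fg).
Local Notation J := 'I_p.+1.
Local Notation chain := (@chain k n fg p).
Local Notation fam := (@fam k n fg J).

Lemma deg_lprodm (X Y : J -> ob) (F : fam X Y) : deg (lprodm F) = fdeg F.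
Proof. by rewrite /lprodm deg_tevm leaves_ltree big_enum. Qed.

Lemma lprodm_pr (X Y : J -> ob) (F : fam X Y) v i x :
  lprodm F v (pr _ i x) = pr _ (i + fdeg F) (lprodm F v x).
Proof. by rewrite gvalP deg_lprodm. Qed.

Lemma tevm_id (K : Type) (t : tree K) (X : K -> ob) :
  tevm t (fun j => gid (X j)) = gid (tev t X).
Proof.
elim: t => //= l -> r ->; apply: gmor_ext => // v.
pose L : {linear ov (otens (tev l X) (tev r X)) v -> _} :=
  htens 0 (hid (tev l X)) (hid (tev r X)) v.
apply: (@tprod_ext _ _ _ _ L idfun) => x y.
change (htens 0 (hid (tev l X)) (hid (tev r X)) v (tmk x y) = tmk x y).
by rewrite htensE kpar0.
Qed.

Lemma lprodm_id (X : J -> ob) v x : lprodm (fid X) v x = x.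
Proof. by rewrite /lprodm /fid tevm_id. Qed.

Lemma lprodm_slin j a X Y (F F1 F2 : fam X Y) v x :
  slin j a F F1 F2 -> lprodm F v x = a *: lprodm F1 v x + lprodm F2 v x.
Proof.
move=> h; apply: glinE; apply: tevm_slin h _ _; rewrite leaves_ltree.
  exact: enum_uniq.
exact: mem_enum.
Qed.

(* For v = w these are the components at v of the cochains; those from e1 to e2 measure
   the failure of such components to commute with the arrows. *)
Definition vcochain (v w : vertex) : Type :=
  forall X Y : J -> ob, chain X Y -> ov (lprod X) v -> ov (lprod Y) w.

Record vok (v w : vertex) (q : nat) (r : int) (phi : vcochain v w) : Prop := VOk {
  vok_lin : forall X Y c, linear (phi X Y c);
  vok_mlin : forall j a X Y (c c1 c2 : chain X Y) t, lin3 j a c c1 c2 ->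
    phi X Y c t = a *: phi X Y c1 t + phi X Y c2 t;
  vok_id : forall X Y (c : chain X Y) t, idc c -> phi X Y c t = 0;
  vok_deg : forall X Y (c : chain X Y) i t, csize c = q ->
    phi X Y c (pr _ i t) = pr _ (i + (r + cdeg c)) (phi X Y c t)
}.

Lemma vok_dead v w q r (phi : vcochain v w) X Y (c : chain X Y) t :
  vok q r phi -> dead c -> phi X Y c t = 0.
Proof.
move=> ok [/(vok_id ok) //|[j h]].
by rewrite (vok_mlin ok _ h) scaleN1r addNr.
Qed.

Section Differential.
Variables (v w : vertex) (r : int).

Definition vdiff0 (phi : vcochain v w) : vcochain v w := fun X Y c =>
  match c in Defs.chain X Y return ov (lprod X) v -> ov (lprod Y) w with
  | cnil _ => fun=> 0
  | ccons X _ Y F c' => fun t =>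
      let: existT W (d, G) := clast F c' in
      phi _ _ c' (lprodm F v t)
      + msum (fun d => phi _ _ d t) (ccons F c')
      + ((-1) ^+ (csize c').+1 * (-1) ^ (r * fdeg G)) *:
          lprodm G w (phi X W d t)
  end.

Definition vlast (phi : vcochain v w) X Y (t : ov (lprod X) v)
    (s : {W : J -> ob & (chain X W * fam W Y)%type}) : ov (lprod Y) w :=
  let: existT W (d, G) := s in (-1) ^ (r * fdeg G) *: lprodm G w (phi X W d t).

Lemma vdiff0E (phi : vcochain v w) X Z Y (F : fam X Z) (c : chain Z Y) t :
  vdiff0 phi (ccons F c) t = phi _ _ c (lprodm F v t)
    + msum (fun d => phi _ _ d t) (ccons F c)
    + (-1) ^+ (csize c).+1 *: vlast phi t (clast F c).
Proof. by rewrite /=; case: (clast F c) => W [d G]; rewrite /= scalerA. Qed.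

Lemma vlast_lin q (phi : vcochain v w) X Y s : vok q r phi ->
  linear (fun t => @vlast phi X Y t s).
Proof.
move=> ok a x y; case: s => [W [d G]] /=.
by rewrite (vok_lin ok) hvD hvZ scalerDr !scalerA mulrC.
Qed.

Lemma vlast_rel q (phi : vcochain v w) X Y t j a s s1 s2 : vok q r phi ->
  lrel_last j a s s1 s2 ->
  @vlast phi X Y t s = a *: vlast phi t s1 + vlast phi t s2.
Proof.
move=> ok [W [d [d1 [d2 [G [G1 [G2 [-> -> ->]]]]]]]] /=.
case=> [[h [-> ->]]|[h [-> ->]]].
  have [e1 e2] := slin_fdeg h.
  by rewrite e1 e2 (lprodm_slin _ h) scalerDr !scalerA mulrC.
by rewrite (vok_mlin ok _ h) hvD hvZ scalerDr !scalerA mulrC.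
Qed.

Lemma vlast_dead q (phi : vcochain v w) X Y W (d : chain X W) (G : fam W Y) t :
  vok q r phi -> dead d -> vlast phi t (existT _ W (d, G)) = 0.
Proof. by move=> ok /(vok_dead t ok) /= ->; rewrite hv0 scaler0. Qed.

Lemma vlast_id (phi : vcochain v w) X Y (d : chain X Y) t :
  vlast phi t (existT _ Y (d, fid Y)) = phi X Y d t.
Proof. by rewrite /= fdeg_id mulr0 expr0z scale1r lprodm_id. Qed.

Lemma vdiff0_ok q (phi : vcochain v w) : vok q r phi -> vok q.+1 r (vdiff0 phi).
Proof.
move=> ok; split.
- move=> X Y [X1|X1 Z Y1 F c] a x y; first by rewrite /= scaler0 addr0.
  rewrite !vdiff0E hvD hvZ (vok_lin ok) (vlast_lin _ ok).
  rewrite [msum _ _](_ : _ = a *: msum (fun d => phi _ _ d x) (ccons F c)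
    + msum (fun d => phi _ _ d y) (ccons F c)); last first.
    rewrite /msum scaler_sumr -big_split; apply: eq_bigr => z _ /=.
    by rewrite (vok_lin ok) scalerDr !scalerA mulrC.
  by rewrite !scalerDr !scalerA (mulrC _ a) addr3ACA.
- move=> j a X Y c c1 c2 t.
  case: c c1 c2 t => // X1 Z Y1 F c d1 d2 t hl.
  have := lrel_cmerges hl => /lrel_sum.
  move=> /(_ _ _ (fun x => (-1) ^ x.1 *: phi X1 Y1 x.2 t) _).
  have E s x x1 x2 : lin3 j a x x1 x2 -> (-1) ^ s *: phi X1 Y1 x t =
      a *: ((-1) ^ s *: phi X1 Y1 x1 t) + (-1) ^ s *: phi X1 Y1 x2 t.
    by move=> /(vok_mlin ok) ->; rewrite scalerDr !scalerA mulrC.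
  move=> /(_ a E); rewrite -/(msum (fun d => phi _ _ d t) _).
  case: hl => [[F1 [F2 [h -> ->]]]|[c1' [c2' [h -> ->]]]] eM; rewrite !vdiff0E.
    rewrite [msum _ _]eM (lprodm_slin _ h) (vok_lin ok).
    rewrite (vlast_rel _ ok (lrel_clast1 _ h)).
    by rewrite !scalerDr !scalerA (mulrC _ a) addr3ACA.
  have [-> ->] := lin3_csize h.
  rewrite [msum _ _]eM (vok_mlin ok _ h) (vlast_rel _ ok (lrel_clast _ h)).
  by rewrite !scalerDr !scalerA (mulrC _ a) addr3ACA.
(* If the first column is the identity, the first term of d_0 cancels the first merge; if a later
   one is, the first term vanishes and [msum_id] treats the rest. *)
- move=> X Y [//|X1 Z Y1 F c] t [[c'' ->]|h]; rewrite vdiff0E.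
    rewrite lprodm_id msum_idhead; last by move=> d hd; exact: (vok_dead t ok hd).
    case: c'' t => [Y2|Z1 Z2 Y2 H c''] t /=.
      by rewrite fdeg_id mulr0 expr0z expr1 scale1r addr0 lprodm_id scaleN1r subrr.
    rewrite subrr add0r; case: (clast H c'') => W [d G] /=.
    rewrite (vok_id ok) ?hv0 ?scaler0 //.
    by left; exists d.
  rewrite (vok_id ok) // add0r; apply: (@msum_id _ _ _ _ _ _ _ _ F c (fun d => phi _ _ d t) (@vlast phi _ _ t)) => //.
  - by move=> d hd; exact: (vok_dead t ok hd).
  - by move=> W d G hd; exact: (vlast_dead G t ok hd).
  - by move=> d; exact: vlast_id.
- move=> X Y [//|X1 Z Y1 F c] i t [sc]; rewrite !vdiff0E.
  rewrite lprodm_pr (vok_deg ok) //=.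
  have -> : i + fdeg F + (r + cdeg c) = i + (r + (cdeg c + fdeg F)).
    by rewrite -!addrA; congr (_ + _); rewrite addrC addrA.
  rewrite !linearD linearZ; congr (_ + _ + _).
    rewrite /msum linear_sum; apply: lall_sum (cmerges_size _) _ => s x /= [sx dx].
    by rewrite linearZ (vok_deg ok) ?dx //; case: sx; rewrite sc.
  congr (_ *: _); have := clast_size F c; case: (clast F c) => W [d G] /= [sd dd].
  rewrite linearZ (vok_deg ok) ?sd // lprodm_pr; congr (_ *: pr _ _ _).
  by rewrite -!addrA dd.
Qed.

End Differential.

Lemma hom_sumE (X Y : ob) I (s : seq I) (F : I -> hom X Y) v x :
  (\sum_(i <- s) F i) v x = \sum_(i <- s) F i v x.
Proof. by elim: s => [|i s ih]; rewrite ?big_nil // !big_cons homDE ih. Qed.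

Definition vcomp (phi : cochain p) v : vcochain v v :=
  fun X Y c t => phi X Y c v t.
Arguments vcomp phi v [X Y] c t.

Lemma diff0E r (phi : cochain p) X Y (c : chain X Y) v t :
  diff0 r phi c v t = vdiff0 r (vcomp phi v) c t.
Proof.
case: c t => [//|X1 Z Y1 F c] t; rewrite /diff0 /vdiff0.
case: (clast F c) => W [d G]; rewrite !homDE homZE hom_sumE.
by congr (_ + _ + _); apply: eq_bigr => x _; rewrite homZE.
Qed.

(* C^{p,q} in degree r; nothing is required of the degree on chains of size other than q. *)
Record cok (q : nat) (r : int) (phi : cochain p) : Prop := COk {
  cok_mlin : mlinear phi;
  cok_id : idreduced phi;
  cok_deg : forall X Y (c : chain X Y), csize c = q -> homog (r + cdeg c) (phi X Y c)
}.

Lemma vcomp_ok q r (phi : cochain p) v : cok q r phi -> vok q r (vcomp phi v).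
Proof.
case=> h1 h2 h3; split.
- by move=> X Y c; exact: hv_linear.
- by move=> j a X Y c c1 c2 t h; rewrite /vcomp (h1 _ _ _ _ _ _ _ h).
- by move=> X Y c t h; rewrite /vcomp h2.
- by move=> X Y c i t h; rewrite /vcomp h3.
Qed.

Lemma cok_vcomp q r (phi : cochain p) :
  (forall v, vok q r (vcomp phi v)) -> cok q r phi.
Proof.
move=> ok; split.
- by move=> j a X Y c c1 c2 h; apply: homP => v t; exact: (vok_mlin (ok v) _ h).
- by move=> X Y c h; apply: homP => v t; exact: (vok_id (ok v) _ h).
- by move=> X Y c h v i t; exact: (vok_deg (ok v)).
Qed.

Lemma diff0_ok q r (phi : cochain p) : cok q r phi -> cok q.+1 r (diff0 r phi).
Proof.
move=> ok; apply: cok_vcomp => v; rewrite (_ : vcomp _ v = vdiff0 r (vcomp phi v)).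
  exact/vdiff0_ok/vcomp_ok.
do 3 (apply: functional_extensionality_dep => ?); apply/funext => t.
exact: diff0E.
Qed.

End VertexCochains.
Arguments vcomp {k n fg p} phi v [X Y] c t.

(** * The contracting homotopy of [d_0] at a vertex *)

Lemma linear_fun0 (k : fieldType) (U V : lmodType k) (f : U -> V) :
  linear f -> f 0 = 0.
Proof. by move=> /(_ (-1) 0 0); rewrite scaler0 addr0 scaleN1r addNr. Qed.

Lemma scalable_linear_fun (k : fieldType) (U V : lmodType k) (f : U -> V) a x :
  linear f -> f (a *: x) = a *: f x.
Proof.
by move=> lf; have := lf a x 0; rewrite addr0 (linear_fun0 lf) addr0.
Qed.

Section Multilinear.
Context {k : fieldType} {n : nat} {fg : bool} {p : nat}.
Local Notation ob := (ob k n fg).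
Local Notation J := 'I_p.+1.
Local Notation chain := (@chain k n fg p).
Local Notation fam := (@fam k n fg J).
Variable v : vertex.
Local Notation P := (fun _ : J => @pob k n fg v).

Lemma glin_prep (X : ob) d a (x y : ov X v) :
  glin a (prep d (a *: x + y)) (prep d x) (prep d y).
Proof.
split=> //; apply: hom_pob_ext; rewrite homDE homZE.
by rewrite !prepE linearP.
Qed.

Lemma glin_zero (X Y : ob) (f : gmor X Y) :
  (f : hom X Y) = 0 -> glin (-1) f f f.
Proof. by move=> e; split=> //; rewrite e scaler0 addr0. Qed.

(** Since f is homogeneous, its value at the generator has only a component of degree [deg f]; the
    other summands are values of g at zero morphisms, which vanish by linearity. *)
Lemma sum_prep (W : lmodType k) (X : ob) (g : gmor (pob v) X -> W) (f : gmor (pob v) X) :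
  (forall a f f1 f2, glin a f f1 f2 -> g f = a *: g f1 + g f2) ->
  \sum_(d <- degs (ov X v)) g (prep d (f v (pgen v))) = g f.
Proof.
move=> gl.
have g0 (f0 : gmor (pob v) X) : f0 v (pgen v) = 0 -> g f0 = 0.
  move=> e; have /gl : glin (-1) f0 f0 f0.
    by apply: glin_zero; apply: hom_pob_ext; exact: e.
  by rewrite scaleN1r addNr.
have hf : ishom (deg f) (f v (pgen v)).
  by have := ishom_gmor f (ishom_pob (pgen v)); rewrite add0r.
have [dX|dX] := boolP (deg f \in degs (ov X v)); last first.
  have f0 := ishom_degs hf dX.
  by rewrite (g0 f) // big1 // => d _; apply: g0; rewrite prepE f0 linear0.
rewrite (bigD1_seq (deg f)) ?degs_uniq //= prep_gmor big1 ?addr0 // => d dj.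
by apply: g0; rewrite prepE (ishomE _ hf) (negPf dj).
Qed.

Variable X : J -> ob.

(** A filler for the rows above [m] in [mlift]; none is left when m = p. *)
Definition fam0 : fam P X := fun j => prep 0 0.

Definition mlinfam m (W : lmodType k) (G : fam P X -> W) : Prop :=
  forall (j : J) a F F1 F2, (j <= m)%N -> slin j a F F1 F2 -> G F = a *: G F1 + G F2.

Local Notation lt m := (trelabel (@inord p) (lcomb m)).

(** By the Yoneda lemma a family P -> X amounts to a tuple of homogeneous elements of the X j at v,
    so a multilinear G induces a map on the tensor product. An element of a factor is first split
    into its finitely many homogeneous components, since only these come from graded morphisms. *)
Fixpoint mlift m (W : lmodType k) (G : fam P X -> W) {struct m} : ov (tev (lt m) X) v -> W :=
  match m return ov (tev (lt m) X) v -> W with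
  | 0 => fun x => \sum_(d <- degs (ov (X (inord 0)) v))
           G (dfwith (i := inord 0) fam0 (prep d x))
  | m'.+1 => tlift (fun x y => \sum_(d <- degs (ov (X (inord m'.+1)) v))
           mlift (fun F => G (dfwith (i := inord m'.+1) F (prep d y))) x)
  end.

Lemma mlift_linG m (W : lmodType k) a (G1 G2 : fam P X -> W) x :
  @mlift m W (fun F => a *: G1 F + G2 F) x = a *: mlift G1 x + mlift G2 x.
Proof.
elim: m G1 G2 x => [|m ih] G1 G2 x /=.
  by rewrite scaler_sumr -big_split.
rewrite /tlift /sum_of scaler_sumr -big_split; apply: eq_bigr => y _ /=.
by rewrite scaler_sumr -big_split; apply: eq_bigr => d _ /=.
Qed.

Lemma slin_swap (j i : J) a (F F1 F2 : fam P X) f : j != i ->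
  slin j a F F1 F2 ->
  slin j a (dfwith (i := i) F f) (dfwith (i := i) F1 f) (dfwith (i := i) F2 f).
Proof.
move=> ji [h hj]; split; last by rewrite !dfwith_out 1?eq_sym.
by move=> l lj; have [<-|il] := eqVneq i l; [rewrite !dfwith_in|rewrite !dfwith_out //; apply: h].
Qed.

Lemma mlinfam_dfwith m (W : lmodType k) (G : fam P X -> W) f :
  (m < p)%N -> mlinfam m.+1 G ->
  mlinfam m (fun F => G (dfwith (i := inord m.+1) F f)).
Proof.
move=> mp h j a F F1 F2 jm hs; apply: (h j); first exact: leqW.
apply: slin_swap hs; apply: contraTneq jm => ->.
by rewrite inordK ?ltnn // ltnS.
Qed.

Lemma mlift_bilin m (W : lmodType k) (G : fam P X -> W) : (m < p)%N ->
  mlinfam m.+1 G ->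
  (forall G' : fam P X -> W, mlinfam m G' -> linear (@mlift m W G')) ->
  is_bilin (fun (x : ov (tev (lt m) X) v) y =>
    \sum_(d <- degs (ov (X (inord m.+1)) v))
      mlift (fun F => G (dfwith (i := inord m.+1) F (prep d y))) x).
Proof.
move=> mp hG ih; split=> [x a y z|y a x z]; last first.
  rewrite scaler_sumr -big_split; apply: eq_bigr => d _ /=.
  by rewrite ih //; exact: mlinfam_dfwith.
rewrite scaler_sumr -big_split; apply: eq_bigr => d _ /=.
rewrite -mlift_linG; congr (mlift _ x); apply/funext => F.
apply: (hG (inord m.+1)); first by rewrite inordK // ltnS.
exact/slin_dfwith/glin_prep.
Qed.

Lemma mlift_linear m (W : lmodType k) (G : fam P X -> W) : (m <= p)%N ->
  mlinfam m G -> linear (@mlift m W G).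
Proof.
elim: m G => [|m ih] G mp hG.
  move=> a x y /=; rewrite scaler_sumr -big_split; apply: eq_bigr => d _ /=.
  apply: (hG (inord 0)); first by rewrite inordK.
  exact/slin_dfwith/glin_prep.
apply: tlift_linear; apply: mlift_bilin => // G' hG'.
by apply: ih => //; exact: ltnW.
Qed.

Local Notation u t := (pt t (fun _ : J => pgen v)).

Lemma leaf_lt m j : (m <= p)%N -> j \in leaves (lt m) -> (j <= m)%N.
Proof.
move=> mp; rewrite leaves_trelabel leaves_lcomb => /mapP [i].
by rewrite mem_iota => /andP [_ im] ->; rewrite inordK // (leq_trans im).
Qed.

Lemma tevm_lt_S m (F : fam P X) :
  tevm (lt m.+1) F v (u (lt m.+1)) =
  tmk (tevm (lt m) F v (u (lt m))) (F (inord m.+1) v (pgen v)).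
Proof.
rewrite [LHS]tevm_NdE; congr (tmk (tevm _ _ _ _) _).
rewrite (kpar_hom _ (@ishom0_pt _ _ _ _ _ _ (lt m) _ _)) ?mulr0 ?expr0z ?scale1r //.
Qed.

Lemma mliftE m (W : lmodType k) (G : fam P X -> W) (F : fam P X) : (m <= p)%N ->
  mlinfam m G ->
  mlift G (tevm (lt m) F v (u (lt m))) = G (fun j => if (j <= m)%N then F j else fam0 j).
Proof.
elim: m G => [|m ih] G mp hG.
  rewrite /= (sum_prep (g := fun f => G (dfwith (i := inord 0) fam0 f))); last first.
    move=> a f f1 f2 hf; apply: (hG (inord 0)); first by rewrite inordK.
    exact: slin_dfwith.
  congr G; apply: functional_extensionality_dep => j; case: dfwithP => [|j' ij].
    by rewrite inordK.
  rewrite leqn0; case: eqP => // j0.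
  case/eqP: ij; apply: val_inj; rewrite /= inordK // j0.
rewrite tevm_lt_S [mlift _]/= tlift_mk; last first.
  by apply: mlift_bilin => // G' hG'; apply: mlift_linear => //; exact: ltnW.
transitivity (\sum_(d <- degs (ov (X (inord m.+1)) v))
    G (dfwith (i := inord m.+1) (fun j : J => if (j <= m)%N then F j else fam0 j)
         (prep d (F (inord m.+1) v (pgen v))))).
  by apply: eq_bigr => d _; rewrite ih ?(ltnW mp) //; exact: mlinfam_dfwith.
rewrite (sum_prep (g := fun f => G (dfwith (i := inord m.+1) _ f))); last first.
  move=> a f f1 f2 hf; apply: (hG (inord m.+1)); first by rewrite inordK // ltnS.
  exact: slin_dfwith.
congr G; apply: functional_extensionality_dep => j; case: dfwithP => [|j' ij].
  by rewrite inordK ?ltnS // leqnn.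
rewrite [(_ <= m.+1)%N]leq_eqVlt ltnS; case: eqP => //= jm.
by case/eqP: ij; apply: val_inj; rewrite /= inordK ?ltnS // jm.
Qed.

(** The vectors compared are the pure tensors of homogeneous elements, and these span because the
    complexes are bounded. *)
Lemma lt_ext m (W : lmodType k) (f g : {linear ov (tev (lt m) X) v -> W}) :
  (m <= p)%N ->
  (forall F, f (tevm (lt m) F v (u (lt m))) = g (tevm (lt m) F v (u (lt m)))) ->
  f =1 g.
Proof.
elim: m f g => [|m ih] f g mp fgE.
  apply: cplx_ext => d x.
  have := fgE (dfwith (i := inord 0) fam0 (prep d x)).
  by rewrite /= dfwith_in prepE.
apply: tprod_ext => x y.
rewrite -[y]pr_degs tmk_sumr !linear_sum; apply: eq_bigr => d _.
have lin (h : {linear ov (tev (lt m.+1) X) v -> W}) :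
    linear (fun x : ov (tev (lt m) X) v => h (tmk x (pr _ d y))).
  by move=> a z z'; rewrite tmkD1 tmkZl linearP.
pose L (h : {linear ov (tev (lt m.+1) X) v -> W}) : {linear ov (tev (lt m) X) v -> W} :=
  HB.pack (fun x : ov (tev (lt m) X) v => h (tmk x (pr _ d y)))
    (GRing.isLinear.Build k _ W *:%R _ (lin h)).
apply: (ih (L f) (L g)); first exact: ltnW.
move=> F; have := fgE (dfwith (i := inord m.+1) F (prep d y)).
rewrite tevm_lt_S dfwith_in prepE.
rewrite (_ : tevm (lt m) (dfwith _ _) = tevm (lt m) F) //.
apply: eq_tevm => j /(leaf_lt (ltnW mp)) jm; rewrite dfwith_out //.
by apply: contraTneq jm => <-; rewrite inordK ?ltnn // ltnS.
Qed.

End Multilinear.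

Section Contraction.
Context {k : fieldType} {n : nat} {fg : bool} {p : nat}.
Local Notation ob := (ob k n fg).
Local Notation J := 'I_p.+1.
Local Notation chain := (@chain k n fg p).
Local Notation fam := (@fam k n fg J).
Local Notation P v := (fun _ : J => @pob k n fg v).

Definition ugen v : ov (lprod (P v)) v := pt (ltree p) (fun _ : J => pgen v).

Lemma ishom_ugen v : ishom 0 (ugen v).
Proof. by apply: ishom0_pt => j; exact: ishom_pob. Qed.

Lemma lprod_ext v (X : J -> ob) (W : lmodType k) (f g : ov (lprod X) v -> W) :
  linear f -> linear g ->
  (forall F : fam (P v) X, f (lprodm F v (ugen v)) = g (lprodm F v (ugen v))) ->
  f =1 g.
Proof.
move=> lf lg fgE.
pose f' : {linear ov (lprod X) v -> W} := HB.pack f (GRing.isLinear.Build k _ W *:%R f lf).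
pose g' : {linear ov (lprod X) v -> W} := HB.pack g (GRing.isLinear.Build k _ W *:%R g lg).
exact: (@lt_ext _ _ _ _ _ _ p W f' g' (leqnn p) fgE).
Qed.

Lemma ishom_lprodm v (X : J -> ob) (F : fam (P v) X) :
  ishom (fdeg F) (lprodm F v (ugen v)).
Proof. by rewrite -[fdeg F]add0r -deg_lprodm; exact/ishom_gmor/ishom_ugen. Qed.

Lemma lprodm_comp v (X Y : J -> ob) (F : fam (P v) X) (G : fam X Y) :
  lprodm G v (lprodm F v (ugen v)) =
  (-1) ^ kcomp G F *: lprodm (fcomp G F) v (ugen v).
Proof.
have h0 : ishom 0 (pgen v : ov (@pob k n fg v) v) by exact: ishom_pob.
have hF j : ishom (deg (F j)) (F j v (pgen v)).
  by have := ishom_gmor (F j) h0; rewrite add0r.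
by rewrite /lprodm /ugen (tevm_pt0 _ F) // (tevm_pt _ G hF) (tevm_pt0 _ (fcomp G F)) // kcompE.
Qed.

(* As P_v represents X |-> X(v), prolonging a chain by a family P_v -> X and evaluating
   at the universal element gives a contracting homotopy for d_0 at v. *)
Definition hop v w (phi : @vcochain k n fg p v w) : @vcochain k n fg p v w := fun X Y c =>
  mlift (m := p) (fun F => phi _ _ (ccons F c) (ugen v)).

Section Ok.
Variables (v w : vertex) (q : nat) (r : int) (phi : @vcochain k n fg p v w).
Hypothesis ok : vok q.+1 r phi.

Lemma hop_mlinfam X Y (c : chain X Y) :
  mlinfam p (fun F : fam (P v) X => phi (ccons F c) (ugen v)).
Proof.
move=> j a F F1 F2 _ h.
have hl : lin3 j a (ccons F c) (ccons F1 c) (ccons F2 c) by left; exists F1, F2.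
by rewrite (vok_mlin ok _ hl).
Qed.

Lemma hop_lin X Y (c : chain X Y) : linear (hop phi c).
Proof. exact: mlift_linear (leqnn p) (hop_mlinfam c). Qed.

Lemma hopE X Y (c : chain X Y) F :
  hop phi c (lprodm F v (ugen v)) = phi (ccons F c) (ugen v).
Proof.
rewrite [LHS](mliftE F (leqnn p) (hop_mlinfam c)); congr (phi (ccons _ c) _).
by apply: functional_extensionality_dep => j; rewrite -ltnS ltn_ord.
Qed.

Lemma hop_ok : vok q r (hop phi).
Proof.
split; first exact: hop_lin.
- move=> j a X Y c c1 c2 t h; move: t; apply: lprod_ext => [||F].
  + exact: hop_lin.
  + by move=> b x y; rewrite !hop_lin !scalerDr !scalerA (mulrC b) addrACA.
  have hl : lin3 j a (ccons F c) (ccons F c1) (ccons F c2) by right; exists c1, c2.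
  by rewrite !hopE (vok_mlin ok _ hl).
- move=> X Y c t h; move: t.
  apply: (@lprod_ext v X _ (hop phi c) (fun=> 0)) => [||F].
  + exact: hop_lin.
  + by move=> b x y; rewrite scaler0 addr0.
  by rewrite hopE (vok_id ok) //; right.
- move=> X Y c i t sc; move: t.
  apply: (@lprod_ext v X _ (fun t => hop phi c (pr _ i t))
     (fun t => pr _ (i + (r + cdeg c)) (hop phi c t))) => [||F].
  + by move=> b x y; rewrite linearP hop_lin.
  + by move=> b x y; rewrite hop_lin linearP.
  have hF : ishom (fdeg F + (r + cdeg c)) (hop phi c (lprodm F v (ugen v))).
    have -> : fdeg F + (r + cdeg c) = 0 + (r + cdeg (ccons F c)).
      by rewrite add0r /= (addrA r) [RHS]addrC.
    by rewrite hopE /ishom -(vok_deg ok) /= ?sc // ishom_ugen.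
  rewrite (ishomE _ (ishom_lprodm F)) (ishomE _ hF) (inj_eq (addIr _)).
  case: eqP => // _; exact: linear_fun0 (hop_lin c).
Qed.

End Ok.
End Contraction.

(** * The homotopy identity and exactness at one vertex *)

Section Exactness.
Context {k : fieldType} {n : nat} {fg : bool} {p : nat}.
Local Notation ob := (ob k n fg).
Local Notation J := 'I_p.+1.
Local Notation chain := (@chain k n fg p).
Local Notation fam := (@fam k n fg J).
Local Notation P v := (fun _ : J => @pob k n fg v).
Local Notation cochain := (@cochain k n fg p).
Local Notation vcochain := (@vcochain k n fg p).

(** Linearity and locality at once: only the values on chains one column shorter count. Vanishing
    and congruence are the cases a = -1 and a = 0. *)
Lemma vdiff0_lin v w r a (phi phi1 phi2 : vcochain v w) X Y (c : chain X Y) t :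
  (forall X' Y' (d : chain X' Y') s, (csize d).+1 = csize c ->
     phi X' Y' d s = a *: phi1 X' Y' d s + phi2 X' Y' d s) ->
  vdiff0 r phi c t = a *: vdiff0 r phi1 c t + vdiff0 r phi2 c t.
Proof.
case: c t => [X1|X1 Z Y1 F c] t h; first by rewrite /= scaler0 addr0.
rewrite !vdiff0E h //.
rewrite [msum _ _](_ : _ = a *: msum (fun d => phi1 _ _ d t) (ccons F c)
    + msum (fun d => phi2 _ _ d t) (ccons F c)); last first.
  rewrite /msum scaler_sumr -big_split; apply: lall_sum (cmerges_size _) _ => s x [sx _] /=.
  by rewrite h // scalerDr !scalerA mulrC.
rewrite [vlast _ _ _ _](_ : _ = a *: vlast r phi1 t (clast F c)
    + vlast r phi2 t (clast F c)); last first.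
  have := clast_size F c; case: (clast F c) => W [d G] /= [sd _].
  by rewrite h ?sd //= hvD hvZ scalerDr !scalerA mulrC.
by rewrite !scalerDr !scalerA (mulrC _ a) addr3ACA.
Qed.

Lemma vdiff0_eq0 v w r (phi : vcochain v w) X Y (c : chain X Y) t :
  (forall X' Y' (d : chain X' Y') s, (csize d).+1 = csize c -> phi X' Y' d s = 0) ->
  vdiff0 r phi c t = 0.
Proof.
move=> h; rewrite (@vdiff0_lin _ _ r (-1) phi phi phi) ?scaleN1r ?addNr //.
by move=> X' Y' d s /h ->; rewrite scaler0 addr0.
Qed.

Lemma eq_vdiff0 v w r (phi psi : vcochain v w) X Y (c : chain X Y) t :
  (forall X' Y' (d : chain X' Y') s, (csize d).+1 = csize c ->
     phi X' Y' d s = psi X' Y' d s) ->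
  vdiff0 r phi c t = vdiff0 r psi c t.
Proof.
move=> h; rewrite (@vdiff0_lin _ _ r 0 phi psi psi) ?scale0r ?add0r //.
by move=> X' Y' d s /h ->; rewrite scale0r add0r.
Qed.

Lemma vdiff0_post v r a (phi : vcochain v e1) X Y (c : chain X Y) t :
  vdiff0 r (fun X Y c t => oact (lprod Y) a (phi X Y c t) : ov (lprod Y) e2) c t =
  oact (lprod Y) a (vdiff0 r phi c t).
Proof.
case: c t => [X1|X1 Z Y1 F c] t; first by rewrite /= linear0.
rewrite !vdiff0E !linearD; congr (_ + _ + _).
  by rewrite /msum linear_sum; apply: eq_bigr => x _ /=; rewrite linearZ.
rewrite linearZ; case: (clast F c) => W [d G] /=.
by rewrite hv_act [in RHS]linearZ.
Qed.

Lemma vdiff0_pre w r a (phi : vcochain e2 w) X Y (c : chain X Y) t :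
  vdiff0 r (fun X Y c t => phi X Y c (oact (lprod X) a t)) c t =
  vdiff0 r phi c (oact (lprod X) a t).
Proof.
case: c t => [X1|X1 Z Y1 F c] t //; rewrite !vdiff0E hv_act; congr (_ + _ *: _).
Qed.

Lemma vok_comb v w q r a (phi psi : vcochain v w) : vok q r phi -> vok q r psi ->
  vok q r (fun X Y c t => a *: phi X Y c t + psi X Y c t).
Proof.
move=> h1 h2; split.
- move=> X Y c b x y; rewrite (vok_lin h1) (vok_lin h2) !scalerDr !scalerA (mulrC b).
  by rewrite addrACA.
- move=> j b X Y c c1 c2 t h; rewrite (vok_mlin h1 _ h) (vok_mlin h2 _ h).
  by rewrite !scalerDr !scalerA (mulrC b) addrACA.
- by move=> X Y c t h; rewrite (vok_id h1) ?(vok_id h2) // scaler0 addr0.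
- by move=> X Y c i t h; rewrite (vok_deg h1) ?(vok_deg h2) // linearP.
Qed.

Lemma vok_post v q r a (phi : vcochain v e1) : vok q r phi ->
  vok q r (fun X Y c t => oact (lprod Y) a (phi X Y c t) : ov (lprod Y) e2).
Proof.
move=> h; split.
- by move=> X Y c b x y; rewrite (vok_lin h) linearP.
- by move=> j b X Y c c1 c2 t hl; rewrite (vok_mlin h _ hl) linearP.
- by move=> X Y c t hc; rewrite (vok_id h) // linear0.
- by move=> X Y c i t hc; rewrite (vok_deg h) // oact_pr.
Qed.

Lemma vok_pre w q r (phi : vcochain e2 w) (A : forall X : J -> ob, {linear ov (lprod X) e1 -> ov (lprod X) e2}) :
  (forall X i t, A X (pr _ i t) = pr _ i (A X t)) ->
  vok q r phi -> vok q r (fun X Y c t => phi X Y c (A X t)).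
Proof.
move=> hA h; split.
- by move=> X Y c b x y; rewrite linearP (vok_lin h).
- by move=> j b X Y c c1 c2 t hl; rewrite (vok_mlin h _ hl).
- by move=> X Y c t hc; rewrite (vok_id h).
- by move=> X Y c i t hc; rewrite hA (vok_deg h).
Qed.

(** This is h d_0 + d_0 h = id, evaluated on a family applied to the generator. In the prolonged
    chain the merges and the last term move one place and change sign, and the merge of [xi] with
    the first column of [c] becomes the first term of d_0 h. *)
Lemma vdiff0_hop v w q r (phi : vcochain v w) (X Y : J -> ob) (xi : fam (P v) X)
    (c : chain X Y) :
  vok q.+1 r phi -> (0 < csize c)%N ->
  vdiff0 r phi (ccons xi c) (ugen v) =
  phi X Y c (lprodm xi v (ugen v))
  - vdiff0 r (hop phi) c (lprodm xi v (ugen v)).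
Proof.
move=> ok; case: c xi => // X1 Z Y1 F c xi _.
rewrite !vdiff0E msum_cons -!addrA; congr (_ + _).
rewrite addrA !opprD; congr (_ + _ + _).
- by rewrite lprodm_comp (scalable_linear_fun _ _ (hop_lin ok c)) (hopE ok).
- by congr (- _); apply: eq_bigr => x _; rewrite (hopE ok).
rewrite clast_ccons; case: (clast F c) => W [d G] /=.
by rewrite (hopE ok) [in LHS]exprS mulN1r scaleNr.
Qed.

(** The generator is its own image under the identity family, and prolonging by that family gives 0
    because [phi] is reduced. So the primitives made by [hop] are normalized at generators. *)
Lemma hop_gen v w q r (phi : vcochain v w) Y (c : chain (P v) Y) :
  vok q.+1 r phi -> hop phi c (ugen v) = 0.
Proof.
move=> ok; rewrite -[ugen v]lprodm_id (hopE ok) (vok_id ok) //.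
by left; exists c.
Qed.

Lemma vexact v w q r (phi : vcochain v w) :
  vok q.+1 r phi ->
  (forall X Y (c : chain X Y) t, csize c = q.+2 -> vdiff0 r phi c t = 0) ->
  forall X Y (c : chain X Y) t, csize c = q.+1 -> phi X Y c t = vdiff0 r (hop phi) c t.
Proof.
move=> ok d0 X Y c t sc; move: t; apply: (@lprod_ext _ _ _ _ v X _ (phi X Y c) (vdiff0 r (hop phi) c)).
- exact: (vok_lin ok).
- exact: (vok_lin (vdiff0_ok (hop_ok ok))).
move=> F; apply/eqP; rewrite -subr_eq0 -(vdiff0_hop _ ok) ?sc //.
by rewrite d0 //= sc.
Qed.

Lemma cok_comb q r a (phi psi : cochain) : cok q r phi -> cok q r psi ->
  cok q r (fun X Y c => a *: phi X Y c + psi X Y c).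
Proof.
move=> h1 h2; apply: cok_vcomp => v.
exact: vok_comb (vcomp_ok v h1) (vcomp_ok v h2).
Qed.

(** The difference of [x] and d_0 w is a cocycle, hence d_0 of its contraction, and the contraction
    is computed from chains that begin with a family out of P_v. *)
Lemma exact_of_gen q r (x w : cochain) : cok q.+1 r x -> cok q r w ->
  (forall X Y (c : chain X Y), csize c = q.+2 -> diff0 r x c = 0) ->
  (forall X Y (c : chain X Y), csize c = q.+2 -> diff0 r (diff0 r w) c = 0) ->
  (forall v X Y (xi : fam (P v) X) (c : chain X Y), csize c = q ->
     diff0 r w (ccons xi c) v (ugen v) = x _ _ (ccons xi c) v (ugen v)) ->
  forall X Y (c : chain X Y), csize c = q.+1 -> x X Y c = diff0 r w c.
Proof.
move=> hx hw dx ddw e X Y c sc; apply: homP => v t.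
pose f : cochain := fun X Y c => (-1) *: diff0 r w c + x X Y c.
have hf : cok q.+1 r f by apply: cok_comb => //; exact: diff0_ok.
suff: vcomp f v c t = 0.
  by rewrite /vcomp /f homDE homZE scaleN1r addrC => /eqP; rewrite subr_eq0 => /eqP.
rewrite (vexact (vcomp_ok v hf)) //.
  apply: vdiff0_eq0 => X' Y' d s; rewrite sc => -[sd]; move: s.
  apply: (@lprod_ext _ _ _ _ v X' _ (hop (vcomp f v) d) (fun=> 0)).
  - exact: (hop_lin (vcomp_ok v hf)).
  - by move=> b y z; rewrite scaler0 addr0.
  by move=> F; rewrite (hopE (vcomp_ok v hf)) /vcomp /f homDE homZE e // scaleN1r addNr.
move=> X' Y' d s sd.
rewrite (@vdiff0_lin _ _ r (-1) _ (vcomp (diff0 r w) v) (vcomp x v)); last first.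
  by move=> X1 Y1 d1 s1 _; rewrite /vcomp /f homDE homZE.
by rewrite -!diff0E dx // ddw // scaler0 addr0.
Qed.

End Exactness.

(** * Exactness of [d_0] *)

Section ExactnessLow.
Context {k : fieldType} {n : nat} {fg : bool}.
Local Notation ob := (ob k n fg).

(** The arrows preserve degrees, so the degree-preserving part of a retraction still satisfies the
    same identities; a correction built from it then has the right degree. *)
Lemma homogeneous_retract (X : ob) :
  exists rho : 'I_n -> {linear ov X e2 -> ov X e1},
    (forall a b x, rho b (oact X a x) = if a == b then x else 0) /\
    (forall a i x, rho a (pr _ i x) = pr _ i (rho a x)).
Proof.
have [r0 r0P] := projective_retract (@ob_proj _ _ _ X).
have {r0 r0P} [r rP] : exists r : 'I_n -> {linear ov X e2 -> ov X e1},
  forall a b x, r b (oact X a x) = if a == b then x else 0 by exists r0.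
pose s := undup (degs (ov X e1) ++ degs (ov X e2)).
have us : uniq s by exact: undup_uniq.
pose f a (x : ov X e2) : ov X e1 := \sum_(i <- s) pr _ i (r a (pr _ i x)).
have lf a : linear (f a).
  move=> c x y; rewrite /f scaler_sumr -big_split; apply: eq_bigr => i _ /=.
  by rewrite !linearP.
pose R a : {linear ov X e2 -> ov X e1} :=
  HB.pack (f a) (GRing.isLinear.Build k (ov X e2) (ov X e1) *:%R (f a) (lf a)).
exists R.
split=> [a b x|a i x] /=.
  rewrite -[x in RHS](@pr_sub _ _ s) //; last first.
    by move=> i id; rewrite mem_undup mem_cat id.
  case: (altP (a =P b)) => [<-|ab].
    by apply: eq_bigr => i _; rewrite -oact_pr rP eqxx pr_pr eqxx.
  by apply: big1 => i _; rewrite -oact_pr rP (negPf ab) linear0.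
have fE j y : pr _ j (f a y) = pr _ j (r a (pr _ j y)).
  rewrite /f linear_sum /=.
  have [js|js] := boolP (j \in s).
    rewrite (bigD1_seq j) //= pr_pr eqxx big1 ?addr0 // => l lj.
    by rewrite pr_pr eq_sym (negPf lj).
  rewrite big_seq big1 => [|l ls]; last first.
    by rewrite pr_pr; case: eqP => // jl; rewrite -jl (negPf js) in ls.
  rewrite [pr _ j y]pr_out ?linear0 //.
  by apply: contra js => jd; rewrite mem_undup mem_cat jd orbT.
rewrite fE /f; have [js|js] := boolP (i \in s).
  rewrite (bigD1_seq i) //= pr_pr eqxx big1 ?addr0 // => l li.
  by rewrite pr_pr (negPf li) !linear0.
rewrite big_seq big1 => [|l ls]; last first.
  rewrite pr_pr; case: eqP => [li|_]; last by rewrite !linear0.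
  by rewrite -li ls in js.
rewrite pr_out //.
by apply: contra js => jd; rewrite mem_undup mem_cat jd.
Qed.

Definition ret (X : ob) : 'I_n -> {linear ov X e2 -> ov X e1} :=
  sval (cid (homogeneous_retract X)).

Lemma retE (X : ob) a b x : ret X b (oact X a x) = if a == b then x else 0.
Proof. by rewrite /ret; case: cid => r [] /= h _; exact: h. Qed.

Lemma ret_pr (X : ob) a i x : ret X a (pr _ i x) = pr _ i (ret X a x).
Proof. by rewrite /ret; case: cid => r [] /= _ h; exact: h. Qed.

Context {p : nat}.
Local Notation J := 'I_p.+1.
Local Notation chain := (@chain k n fg p).
Local Notation fam := (@fam k n fg J).
Local Notation P v := (fun _ : J => @pob k n fg v).
Local Notation cochain := (@cochain k n fg p).
Local Notation vcochain := (@vcochain k n fg p).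
Local Notation gen v := (@ugen k n fg p v).

Lemma lprod_pob21 (t : ov (lprod (P e2)) e1) : t = 0.
Proof.
have h (j : J) (x : ov (@pob k n fg e2) e1) : exists c : k, x = c *: 0.
  by exists 0; rewrite scaler0 (pob21_0 x).
have z (s : tree J) : pt s (fun _ : J => 0 : ov (@pob k n fg e2) e1) = 0.
  by elim: s => //= l -> r _; exact: tmk0l.
by have [c ->] := pt_span h t; rewrite z scaler0.
Qed.

(** The arrow [a], seen by Yoneda as a map P_2 -> P_1, in every row at once. The value of an arity 1
    cocycle on it is the obstruction tensor. *)
Definition eps (a : 'I_n) : fam (P e2) (P e1) := fun _ => prep 0 (pbas a).

Lemma epsE a : lprodm (eps a) e2 (gen e2) = oact (lprod (P e1)) a (gen e1).
Proof.
rewrite /lprodm /ugen tevm_pt0 ?oact_pt //.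
apply: eq_pt; apply: functional_extensionality_dep => j.
by rewrite /eps prepE ishom_pob.
Qed.

(** Compatibility of the two vertex components is known only on chains of size q. Extending by 0 to
    other sizes keeps multilinearity, as related chains have equal size. *)
Definition vres v w (q : nat) (phi : vcochain v w) : vcochain v w :=
  fun X Y c t => if csize c == q then phi X Y c t else 0.

Lemma vres_ok v w q r (phi : vcochain v w) : vok q r phi -> vok q r (vres q phi).
Proof.
move=> ok; split; rewrite /vres.
- move=> X Y c a x y; case: ifP => _; first exact: (vok_lin ok).
  by rewrite scaler0 addr0.
- move=> j a X Y c c1 c2 t h; have [-> ->] := lin3_csize h.
  by case: ifP => _; rewrite ?scaler0 ?addr0 // (vok_mlin ok t h).
- by move=> X Y c t h; case: ifP => // _; rewrite (vok_id ok).
- by move=> X Y c i t sc; rewrite sc eqxx (vok_deg ok).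
Qed.

Lemma pair_cochain q r (phi1 : vcochain e1 e1) (phi2 : vcochain e2 e2) :
  vok q r phi1 -> vok q r phi2 ->
  (forall X Y (c : chain X Y) a t, csize c = q ->
    phi2 _ _ c (oact (lprod X) a t) = oact (lprod Y) a (phi1 _ _ c t)) ->
  exists2 w : cochain, cok q r w &
    forall X Y (c : chain X Y), csize c = q ->
      w X Y c e1 =1 phi1 X Y c /\ w X Y c e2 =1 phi2 X Y c.
Proof.
move=> ok1 ok2 h.
pose f X Y (c : chain X Y) v : ov (lprod X) v -> ov (lprod Y) v :=
  match v return ov (lprod X) v -> ov (lprod Y) v with
  | e1 => vres q phi1 c | e2 => vres q phi2 c end.
have okf v : vok q r (fun X Y (c : chain X Y) => f X Y c v).
  by case: v; apply: vres_ok.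
have fl X Y (c : chain X Y) v : linear (f X Y c v) by exact: (vok_lin (okf v)).
have fa X Y (c : chain X Y) a t :
    f X Y c e2 (oact (lprod X) a t) = oact (lprod Y) a (f X Y c e1 t).
  by rewrite /f /vres; case: eqP => [/h ->//|_]; rewrite linear0.
exists (fun X Y c => Hom (@fl X Y c) (@fa X Y c)).
  by apply: cok_vcomp => v; exact: (okf v).
by move=> X Y c sc; split=> t; rewrite /= /vres sc eqxx.
Qed.

(* As A is hereditary with Hom-complex [prod_v Hom(X v, Y v) -> prod_a Hom(X 1, Y 2)],
   the primitives at the two vertices, which exist as X |-> X(v) is representable,
   can be corrected by a lift [T] of the defect [m_a] to make them compatible. *)
Lemma exact_ge2 q r (x : cochain) : cok q.+2 r x ->
  (forall X Y (c : chain X Y), csize c = q.+3 -> diff0 r x c = 0) ->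
  (forall w, cok q.+1 r w ->
     forall X Y (c : chain X Y), csize c = q.+3 -> diff0 r (diff0 r w) c = 0) ->
  exists2 w, cok q.+1 r w &
    forall X Y (c : chain X Y), csize c = q.+2 -> x X Y c = diff0 r w c.
Proof.
move=> hx dx dd.
have xex v X Y (c : chain X Y) t : csize c = q.+2 ->
    x X Y c v t = vdiff0 r (hop (vcomp x v)) c t.
  move=> sc; rewrite -(vexact (vcomp_ok v hx)) // => X' Y' d s sd.
  by rewrite -diff0E dx.
pose y v := hop (vcomp x v); have oky v : vok q.+1 r (y v).
  exact/hop_ok/vcomp_ok.
pose m a : vcochain e1 e2 := fun X Y c t =>
  (-1) *: y e2 X Y c (oact (lprod X) a t) + oact (lprod Y) a (y e1 X Y c t).
have okm a : vok q.+1 r (m a).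
  apply: vok_comb; last exact: vok_post.
  apply: (@vok_pre _ _ _ _ _ _ _ (y e2) (fun X => oact (lprod X) a)) => //.
  by move=> X i t; exact: oact_pr.
have dm a X Y (c : chain X Y) t : csize c = q.+2 -> vdiff0 r (m a) c t = 0.
  move=> sc; rewrite (vdiff0_lin r (a := -1)
    (phi1 := fun X Y c t => y e2 X Y c (oact (lprod X) a t))
    (phi2 := fun X Y c t => oact (lprod Y) a (y e1 X Y c t))) //.
  by rewrite vdiff0_pre vdiff0_post -!xex // hv_act scaleN1r addNr.
(* This is where arity at least 2 enters: [m a] has positive arity, so the cocycle [m a] equals d_0
   of its contraction. *)
pose tt a := hop (m a); have okt a : vok q r (tt a) by exact: hop_ok.
pose T : vcochain e2 e2 := fun X Y c t => \sum_a tt a X Y c (ret (lprod X) a t).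
have okT : vok q r T.
  split; rewrite /T.
  - move=> X Y c a s t; rewrite scaler_sumr -big_split; apply: eq_bigr => b _ /=.
    by rewrite linearP (vok_lin (okt b)).
  - move=> j a X Y c c1 c2 t h; rewrite scaler_sumr -big_split.
    by apply: eq_bigr => b _; exact: (vok_mlin (okt b) _ h).
  - by move=> X Y c t h; rewrite big1 // => b _; exact: (vok_id (okt b) _ h).
  - move=> X Y c i t h; rewrite linear_sum; apply: eq_bigr => b _ /=.
    by rewrite ret_pr (vok_deg (okt b)).
have Tact X Y (c : chain X Y) a t : T X Y c (oact (lprod X) a t) = tt a X Y c t.
  rewrite /T (bigD1 a) //= retE eqxx big1 ?addr0 // => b ba.
  by rewrite retE eq_sym (negPf ba) (linear_fun0 (vok_lin (okt b) c)).
(* [ret] lands in the fibre at e1, which is zero for tensor powers of P_2. Hence d_0 T, on a chain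
   prolonged by a family out of P_2 and evaluated at the generator, reduces to its first term. *)
have T0 Y (c : chain (P e2) Y) t : T _ _ c t = 0.
  by rewrite /T big1 // => a _; rewrite (lprod_pob21 (ret _ a t))
    (linear_fun0 (vok_lin (okt a) c)).
pose y2 : vcochain e2 e2 := fun X Y c t => 1 *: vdiff0 r T c t + y e2 X Y c t.
have oky2 : vok q.+1 r y2 by apply: vok_comb => //; exact: vdiff0_ok.
have [|w okw wE] := pair_cochain (oky e1) oky2.
  move=> X Y c a t sc; rewrite /y2 scale1r -vdiff0_pre.
  rewrite (eq_vdiff0 r (psi := tt a)); last by move=> X' Y' d s _; exact: Tact.
  rewrite -(vexact (okm a)) //; last by move=> X' Y' d s; exact: dm.
  by rewrite /m scaleN1r addrC addrA subrr add0r.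
exists w => //; apply: exact_of_gen => //; first exact: dd.
move=> v X Y xi c sc; rewrite diff0E (vdiff0_hop _ (vcomp_ok v okw)) ?sc //.
(* The original primitives are contractions and vanish at generators, so contracting [w] leaves only
   the correction. *)
have hopw X' Y' (d : chain X' Y') : csize d = q ->
    hop (vcomp w v) d =1 (match v return ov (lprod X') v -> ov (lprod Y') v with
       e1 => fun=> 0 | e2 => T X' Y' d end).
  move=> sd; apply: (@lprod_ext _ _ _ _ v) => [||F].
  - exact: (hop_lin (vcomp_ok v okw)).
  - case: v {xi} => [a s t|]; first by rewrite scaler0 addr0.
    exact: (vok_lin okT).
  rewrite (hopE (vcomp_ok v okw)) /vcomp.
  have [|w1 w2] := wE _ _ (ccons F d); first by rewrite /= sd.
  case: v F w1 w2 {xi} => F w1 w2.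
    by rewrite w1 /y (hop_gen _ (vcomp_ok e1 hx)).
  rewrite w2 /y2 /y (hop_gen _ (vcomp_ok e2 hx)) addr0 scale1r vdiff0E.
  rewrite (msum_dead (P := fun=> True)); last by move=> *; exact: T0.
    by case: (clast F d) => W [d' G]; rewrite /= T0 hv0 !scaler0 !addr0.
  by elim: (cmerges _).
have [w1 w2] := wE _ _ c sc.
case: v xi hopw => xi hopw.
  rewrite (eq_vdiff0 r (psi := fun _ _ _ _ => 0)); last first.
    by move=> X' Y' d s; rewrite sc => -[/hopw].
  rewrite vdiff0_eq0 // subr0 /vcomp w1.
  exact: (hopE (vcomp_ok e1 hx)).
rewrite (eq_vdiff0 r (psi := T)); last by move=> X' Y' d s; rewrite sc => -[/hopw].
rewrite /vcomp w2 /y2 scale1r addrAC subrr add0r.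
exact: (hopE (vcomp_ok e2 hx)).
Qed.

End ExactnessLow.

(** * Arity 1 cocycles with scalar obstruction *)

Section ExactnessOne.
Context {k : fieldType} {n : nat} {fg : bool} {p : nat}.
Local Notation J := 'I_p.+1.
Local Notation chain := (@chain k n fg p).
Local Notation P v := (fun _ : J => @pob k n fg v).
Local Notation cochain := (@cochain k n fg p).
Local Notation vcochain := (@vcochain k n fg p).
Local Notation gen v := (@ugen k n fg p v).

Definition vscal (lam : k) v : vcochain v v := fun X Y c =>
  match c in Defs.chain X Y return ov (lprod X) v -> ov (lprod Y) v with
  | cnil _ => fun t => lam *: t
  | ccons _ _ _ _ _ => fun=> 0
  end.

Lemma vscal_ok lam v r : r = 0 \/ lam = 0 -> vok 0 r (vscal lam (v := v)).
Proof.
move=> h; split.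
- move=> X Y [X1|X1 Z Y1 F c] a x y /=; last by rewrite scaler0 addr0.
  by rewrite scalerDr !scalerA mulrC.
- by move=> j a X Y [X1|X1 Z Y1 F c] // c1 c2 t [[F1 [F2 [_ -> ->]]]|[d1 [d2 [_ -> ->]]]];
    rewrite /= scaler0 addr0.
- by move=> X Y [].
- move=> X Y [X1|//] i t _ /=; rewrite addr0.
  by case: h => ->; rewrite ?addr0 ?scale0r ?linear0 // linearZ.
Qed.

(** The defect of the two primitives now has arity 0: it is natural and determined at the generator.
    If it is the same multiple of every arrow, adding that scalar to the primitive at e1 removes it.
    A scalar cochain has degree 0, whence the alternative on [r] and [lam]. *)
Lemma exact_1 r (x : cochain) lam : cok 1 r x ->
  (forall X Y (c : chain X Y), csize c = 2 -> diff0 r x c = 0) ->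
  (forall w, cok 0 r w ->
     forall X Y (c : chain X Y), csize c = 2 -> diff0 r (diff0 r w) c = 0) ->
  r = 0 \/ lam = 0 ->
  (forall a, x _ _ (ccons (eps a) (cnil _)) e2 (gen e2)
     = lam *: oact (lprod (P e1)) a (gen e1)) ->
  exists2 w, cok 0 r w &
    forall X Y (c : chain X Y), csize c = 1%N -> x X Y c = diff0 r w c.
Proof.
move=> hx dx dd rl hlam.
have xex v X Y (c : chain X Y) t : csize c = 1%N ->
    x X Y c v t = vdiff0 r (hop (vcomp x v)) c t.
  move=> sc; rewrite -(vexact (vcomp_ok v hx)) // => X' Y' d s sd.
  by rewrite -diff0E dx.
pose y v := hop (vcomp x v); have oky v : vok 0 r (y v).
  exact/hop_ok/vcomp_ok.
have y0 v Y (c : chain (P v) Y) : y v _ _ c (gen v) = 0.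
  exact: (hop_gen _ (vcomp_ok v hx)).
pose m a : vcochain e1 e2 := fun X Y c t =>
  (-1) *: y e2 X Y c (oact (lprod X) a t) + oact (lprod Y) a (y e1 X Y c t).
have okm a : vok 0 r (m a).
  apply: vok_comb; last exact: vok_post.
  apply: (@vok_pre _ _ _ _ _ _ _ (y e2) (fun X => oact (lprod X) a)) => //.
  by move=> X i t; exact: oact_pr.
have dm a X Y (c : chain X Y) t : csize c = 1%N -> vdiff0 r (m a) c t = 0.
  move=> sc; rewrite (vdiff0_lin r (a := -1)
    (phi1 := fun X Y c t => y e2 X Y c (oact (lprod X) a t))
    (phi2 := fun X Y c t => oact (lprod Y) a (y e1 X Y c t))) //.
  by rewrite vdiff0_pre vdiff0_post -!xex // hv_act scaleN1r addNr.
have sgn d : (-1) ^ (r * d) * lam = lam.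
  by case: rl => ->; rewrite ?mul0r ?expr0z ?mul1r ?mulr0.
(* Being an arity 0 cocycle, [m a] commutes with [lprodm F] up to sign; at the generator the
   primitive at e1 vanishes, and the one at e2 gives the value of [x] on [eps a]. *)
have mE a X t : m a X X (cnil X) t = - (lam *: oact (lprod X) a t).
  move: t; apply: (@lprod_ext _ _ _ _ e1 X _ (m a X X (cnil X))
    (fun t => - (lam *: oact (lprod X) a t))) => [||F].
  - exact: (vok_lin (okm a)).
  - by move=> b s t; rewrite linearP scalerDr opprD !scalerN !scalerA mulrC.
  have := dm a _ _ (ccons F (cnil X)) (gen e1) erefl.
  rewrite vdiff0E msum1 addr0 expr1 scaleN1r => /eqP; rewrite subr_eq0 => /eqP -> /=.
  rewrite {1}/m y0 linear0 addr0 -epsE /y (hopE (vcomp_ok e2 hx)) /vcomp hlam.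
  by rewrite !hvZ hv_act scaleN1r scalerN scalerA sgn.
pose w1 : vcochain e1 e1 := fun X Y c t => 1 *: vscal lam c t + y e1 X Y c t.
have okw1 : vok 0 r w1 by apply: vok_comb => //; exact: vscal_ok.
have [|w okw wE] := pair_cochain okw1 (oky e2).
  move=> X Y c a t; case: c t => // X1 t _.
  rewrite /w1 linearD scale1r /= linearZ /=.
  have := mE a X1 t; rewrite /m scaleN1r => /eqP.
  rewrite addrC subr_eq => /eqP ->; rewrite addrA.
  by rewrite subrr add0r.
exists w => //; apply: exact_of_gen => //; first exact: dd.
move=> v X Y xi c; case: c xi => // X1 xi _; rewrite diff0E vdiff0E msum1 addr0 /=.
have [w1E w2E] := wE _ _ (cnil X1) erefl.
have [w1P _] := wE _ _ (cnil (P e1)) erefl.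
have [_ w2P] := wE _ _ (cnil (P e2)) erefl.
rewrite /vcomp; case: v xi => xi; rewrite ?w1E ?w1P ?w2E ?w2P.
  rewrite /w1 y0 addr0 !scale1r /y (hopE (vcomp_ok e1 hx)) /vcomp.
  by rewrite expr1 scaleN1r hvZ scalerA sgn addrAC subrr add0r.
by rewrite y0 hv0 !scaler0 addr0 /y (hopE (vcomp_ok e2 hx)).
Qed.

End ExactnessOne.

(** * Closure of the cochains under the differential *)

Section DegreeZeroIsos.
Context {k : fieldType} {n : nat} {fg : bool}.
Local Notation ob := (ob k n fg).

Lemma deg_gcast (X Y : ob) : deg (gcast X Y) = 0.
Proof.
by rewrite /gcast; case: pselect => // e; case: Y / e.
Qed.

Section Rebracketing.
Variables (J : Type) (X : J -> ob).

Lemma deg_push A t : deg (push X A t) = 0.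
Proof. by elim: t A => //= l hl r hr A; rewrite hl hr. Qed.

Lemma deg_pull A t : deg (pull X A t) = 0.
Proof. by elim: t A => //= l hl r hr A; rewrite hl hr. Qed.

Lemma deg_to_lnorm t : deg (to_lnorm X t) = 0.
Proof. by elim: t => //= l -> r _; rewrite deg_push. Qed.

Lemma deg_of_lnorm t : deg (of_lnorm X t) = 0.
Proof. by elim: t => //= l -> r _; rewrite deg_pull. Qed.

Lemma deg_can s t : deg (can X s t) = 0.
Proof. by rewrite /= deg_to_lnorm deg_of_lnorm deg_gcast. Qed.
End Rebracketing.

Lemma homog_gmor0 (X Y : ob) (f : gmor X Y) : deg f = 0 -> homog 0 f.
Proof. by move=> <-; exact: gvalP. Qed.

Lemma hcomp_lin1 (X Y Z : ob) a (g g1 : hom Y Z) (f : hom X Y) :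
  hcomp (a *: g + g1) f = a *: hcomp g f + hcomp g1 f.
Proof. by apply: homP. Qed.

Lemma hcomp_lin2 (X Y Z : ob) a (g : hom Y Z) (f f1 : hom X Y) :
  hcomp g (a *: f + f1) = a *: hcomp g f + hcomp g f1.
Proof. by apply: homP => v x; rewrite /= hvD hvZ. Qed.

Lemma htens_lin1 (X Y X' Y' : ob) a s (f f1 f2 : hom X Y) (g : hom X' Y') :
  f = a *: f1 + f2 -> htens s f g = a *: htens s f1 g + htens s f2 g.
Proof.
move=> ->; apply: homP => v.
pose L : {linear ov (otens X X') v -> ov (otens Y Y') v} :=
  htens s (a *: f1 + f2) g v.
pose M : {linear ov (otens X X') v -> ov (otens Y Y') v} :=
  a \*: htens s f1 g v \+ htens s f2 g v.
apply: (@tprod_ext _ _ _ _ L M) => x y.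
change (htens s (a *: f1 + f2) g v (tmk x y) =
  a *: htens s f1 g v (tmk x y) + htens s f2 g v (tmk x y)).
by rewrite !htensE homDE homZE tmkD1 tmkZl.
Qed.

Lemma htens_lin2 (X Y X' Y' : ob) a s (f : hom X Y) (g g1 g2 : hom X' Y') :
  g = a *: g1 + g2 -> htens s f g = a *: htens s f g1 + htens s f g2.
Proof.
move=> ->; apply: homP => v.
pose L : {linear ov (otens X X') v -> ov (otens Y Y') v} :=
  htens s f (a *: g1 + g2) v.
pose M : {linear ov (otens X X') v -> ov (otens Y Y') v} :=
  a \*: htens s f g1 v \+ htens s f g2 v.
apply: (@tprod_ext _ _ _ _ L M) => x y.
change (htens s f (a *: g1 + g2) v (tmk x y) =
  a *: htens s f g1 v (tmk x y) + htens s f g2 v (tmk x y)).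
by rewrite !htensE homDE homZE tmkDr2 tmkZr.
Qed.

Section Rebracket.
Variables (p : nat) (X Y : 'I_p.+1 -> ob) (s t : tree 'I_p.+1) (A B : ob).

Lemma rebracket_lin a (f g : hom A B) :
  rebracket X Y s t (a *: f + g) = a *: rebracket X Y s t f + rebracket X Y s t g.
Proof. by rewrite /rebracket hcomp_lin1 !hcomp_lin2. Qed.

Lemma rebracket_homog r (f : hom A B) :
  homog r f -> homog r (rebracket X Y s t f).
Proof.
move=> hf; rewrite -[r]add0r; apply: homog_comp; first exact/homog_gmor0/deg_can.
rewrite -[r]add0r; apply: homog_comp; first exact/homog_gmor0/deg_gcast.
rewrite -[r]addr0; apply: homog_comp => //.
rewrite -[0]addr0; apply: homog_comp; first exact/homog_gmor0/deg_gcast.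
exact/homog_gmor0/deg_can.
Qed.
End Rebracket.

Lemma lin_hom0 (A B C D : ob) (R : hom A B -> hom C D) :
  (forall a f g, R (a *: f + g) = a *: R f + R g) -> R 0 = 0.
Proof. by move=> /(_ (-1) 0 0); rewrite scaler0 addr0 scaleN1r addNr. Qed.

End DegreeZeroIsos.

(** * Substituting bracketings for rows *)

Section TreeSubstitution.
Context {k : fieldType} {n : nat} {fg : bool} {p p' : nat}.
Local Notation ob := (ob k n fg).
Local Notation chain := (@chain k n fg).
Variable T : 'I_p'.+1 -> tree 'I_p.+1.

(** Each old row is used at most once; a row used twice would make [cmap] quadratic in it. *)
Definition affine : Prop :=
  (forall l, uniq (leaves (T l))) /\
  (forall l l' j, j \in leaves (T l) -> j \in leaves (T l') -> l = l').

(** The new rows read in order spell the old word: no row is lost, so the total degree of a chain is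
    preserved as well. *)
Definition good : Prop :=
  flatten [seq leaves (T l) | l <- enum 'I_p'.+1] = enum 'I_p.+1.

Lemma good_count j : good -> (\sum_l count_mem j (leaves (T l)) = 1)%N.
Proof.
move=> h; have := congr1 (count_mem j) h; rewrite count_flatten -map_comp sumnE big_map.
by rewrite big_enum /= => ->; rewrite count_uniq_mem ?enum_uniq // mem_enum.
Qed.

Lemma good_affine : good -> affine.
Proof.
move=> h; split=> [l|l l' j jl jl'].
  have : uniq (flatten [seq leaves (T l) | l <- enum 'I_p'.+1]).
    by rewrite h enum_uniq.
  elim: (enum _) (mem_enum 'I_p'.+1 l) => //= l0 s ih; rewrite inE cat_uniq.
  by move=> /orP[/eqP ->|ls] /and3P[u1 _ u2] //; apply: ih.
apply/eqP/negPn/negP => ll'; have := good_count j h.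
rewrite (bigD1 l) //= (bigD1 l') 1?eq_sym //=.
rewrite -!has_pred1 !has_count in jl jl'; move: jl jl'.
case: (count _ (leaves (T l))) => // a _; case: (count _ (leaves (T l'))) => // b _.
by rewrite addSn addSn addnS.
Qed.

Lemma good_cover j : good -> exists l, j \in leaves (T l).
Proof.
move=> h; have : j \in flatten [seq leaves (T l) | l <- enum 'I_p'.+1].
  by rewrite h mem_enum.
by move=> /flattenP [s /mapP [l _ ->] jl]; exists l.
Qed.

Lemma slin_tevsm j a (X Y : 'I_p.+1 -> ob) (F F1 F2 : fam X Y) l : affine ->
  j \in leaves (T l) -> slin j a F F1 F2 ->
  slin l a (tevsm T F) (tevsm T F1) (tevsm T F2).
Proof.
move=> [hu hd] jl h; split=> [l' ll'|]; last exact: tevm_slin h _ jl.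
apply: (tevm_slin_out h); apply/negP => jl'.
by move/eqP: ll'; apply; exact: hd jl' jl.
Qed.

Lemma slin_tevsm_out j a (X Y : 'I_p.+1 -> ob) (F F1 F2 : fam X Y) :
  (forall l, j \notin leaves (T l)) -> slin j a F F1 F2 ->
  tevsm T F1 = tevsm T F /\ tevsm T F2 = tevsm T F.
Proof.
move=> jl h; split; apply: functional_extensionality_dep => l;
  by have [] := tevm_slin_out h (jl l).
Qed.

Lemma tevsm_id (X : 'I_p.+1 -> ob) : tevsm T (fid X) = fid (tevs T X).
Proof. by apply: functional_extensionality_dep => l; exact: tevm_id. Qed.

Lemma fdeg_tevsm (X Y : 'I_p.+1 -> ob) (F : fam X Y) : good ->
  fdeg (tevsm T F) = fdeg F.
Proof.
move=> h; rewrite /fdeg -[RHS]big_enum -h big_flatten big_map big_enum /=.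
by apply: eq_bigr => l _; exact: deg_tevm.
Qed.

Lemma lin3_cmap j a X Y (c c1 c2 : @Defs.chain k n fg p X Y) l : affine ->
  j \in leaves (T l) -> lin3 j a c c1 c2 ->
  lin3 l a (cmap T c) (cmap T c1) (cmap T c2).
Proof.
move=> aT jl; elim: c c1 c2 => //= {}X Z {}Y F c ih c1 c2 [].
  move=> [F1 [F2 [h -> ->]]]; left; exists (tevsm T F1), (tevsm T F2); split=> //.
  exact: slin_tevsm h.
move=> [d1 [d2 [h -> ->]]]; right; exists (cmap T d1), (cmap T d2).
by split=> //; exact: ih.
Qed.

Lemma lin3_cmap_out j a X Y (c c1 c2 : @Defs.chain k n fg p X Y) :
  (forall l, j \notin leaves (T l)) -> lin3 j a c c1 c2 ->
  cmap T c1 = cmap T c /\ cmap T c2 = cmap T c.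
Proof.
move=> jl; elim: c c1 c2 => //= {}X Z {}Y F c ih c1 c2 [].
  by move=> [F1 [F2 [h -> ->]]] /=; have [-> ->] := slin_tevsm_out jl h.
by move=> [d1 [d2 [/ih [e1 e2] -> ->]]] /=; rewrite e1 e2.
Qed.

Lemma idc_cmap X Y (c : @Defs.chain k n fg p X Y) : idc c -> idc (cmap T c).
Proof.
elim: c => //= {}X Z {}Y F c ih [[c'' e]|/ih]; last by right.
left; exists (cmap T c''); have := congr1 (fun d => cmap T d) e.
by rewrite /= tevsm_id.
Qed.

Lemma csize_cmap X Y (c : @Defs.chain k n fg p X Y) : csize (cmap T c) = csize c.
Proof. by elim: c => //= {}X Z {}Y F c ->. Qed.

Lemma cdeg_cmap X Y (c : @Defs.chain k n fg p X Y) : good -> cdeg (cmap T c) = cdeg c.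
Proof. by move=> h; elim: c => //= {}X Z {}Y F c ->; rewrite fdeg_tevsm. Qed.

End TreeSubstitution.

(** * Chains read along a path *)

Section PathChains.
Context {k : fieldType} {n : nat} {fg : bool} {p p' : nat}.
Local Notation chain := (@chain k n fg).
Variables i j : nat.
Local Notation bl s := (@block p p' i j s).

Fixpoint good_path (s : tree nat) (st : seq (option (tree nat))) : Prop :=
  good (bl s) /\
  match st with
  | [::] => True
  | Some t :: st' => good_path t st'
  | None :: st' => good_path s st'
  end.

Lemma lin3_cpath l a s st X Y (c c1 c2 : @Defs.chain k n fg p X Y) : good_path s st ->
  lin3 l a c c1 c2 ->
  exists l', lin3 l' a (cpath p' i j s st c) (cpath p' i j s st c1) (cpath p' i j s st c2).
Proof.
elim: st s X Y c c1 c2 => [|[t|] st ih] s X Y c c1 c2 /= [gs gst] h.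
- have [l' ll'] := good_cover l gs; exists l'.
  exact: lin3_cmap (good_affine gs) ll' h.
- have [l' h'] := ih _ _ _ _ _ _ gst h; exists l'; right.
  by do 2 eexists; split; first exact: h'.
case: c c1 c2 h => //= X1 Z Y1 F c c1 c2 [[F1 [F2 [h -> ->]]]|[d1 [d2 [h -> ->]]]].
  have [l' ll'] := good_cover l gs; exists l'; left.
  by do 2 eexists; split; first exact: slin_tevsm (good_affine gs) ll' h.
have [l' h'] := ih _ _ _ _ _ _ gst h; exists l'; right.
by do 2 eexists; split; first exact: h'.
Qed.

Lemma idc_cpath s st X Y (c : @Defs.chain k n fg p X Y) : idc c -> idc (cpath p' i j s st c).
Proof.
elim: st s X Y c => [|[t|] st ih] s X Y c h /=; first exact: idc_cmap.
  by right; exact: ih.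
case: c h => //= X1 Z Y1 F c [[c'' e]|h]; last by right; exact: ih.
left; exists (cpath p' i j s st c'').
have := congr1 (fun d => cpath p' i j s (None :: st) d) e.
by rewrite /= tevsm_id.
Qed.

(** Vertical steps only consume columns of [c], and horizontal ones insert a column of associators.
    Columns left at the end of the path are still copied, and vertical steps after the last column
    insert nothing, so the count holds for any list of steps. *)
Lemma csize_cpath s st X Y (c : @Defs.chain k n fg p X Y) :
  csize (cpath p' i j s st c) = (csize c + count isSome st)%N.
Proof.
elim: st s X Y c => [|[t|] st ih] s X Y c /=; first by rewrite csize_cmap addn0.
  by rewrite ih addnCA addnA.
by case: c => [X1|X1 Z Y1 F c] /=; rewrite ih.
Qed.

Lemma cdeg_cpath s st X Y (c : @Defs.chain k n fg p X Y) : good_path s st ->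
  cdeg (cpath p' i j s st c) = cdeg c.
Proof.
elim: st s X Y c => [|[t|] st ih] s X Y c /= [gs gst]; first exact: cdeg_cmap.
  rewrite ih // /fdeg big1 ?addr0 // => l _; exact: deg_can.
by case: c => [X1|X1 Z Y1 F c] /=; rewrite ih // fdeg_tevsm.
Qed.

End PathChains.

(** * Closure under d_1 and under the path terms *)

Section CochainClosure.
Context {k : fieldType} {n : nat} {fg : bool}.
Local Notation ob := (ob k n fg).
Local Notation cochain := (@cochain k n fg).

Lemma cok_zero p q r : cok q r ((fun X Y c => 0) : cochain p).
Proof.
split=> // [j a X Y c c1 c2 _|X Y c _]; first by rewrite scaler0 addr0.
exact: homog0.
Qed.

Lemma cok_scale p q r a (phi : cochain p) : cok q r phi ->
  cok q r (fun X Y c => a *: phi X Y c).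
Proof.
move=> h; have := cok_comb a h (cok_zero p q r).
congr cok; do 3 (apply: functional_extensionality_dep => ?).
by rewrite addr0.
Qed.

Lemma cok_add p q r (phi psi : cochain p) : cok q r phi -> cok q r psi ->
  cok q r (fun X Y c => phi X Y c + psi X Y c).
Proof.
move=> h h'; have := cok_comb 1 h h'.
congr cok; do 3 (apply: functional_extensionality_dep => ?).
by rewrite scale1r.
Qed.

Lemma cok_sum p q r (I : eqType) (s : seq I) (phi : I -> cochain p) :
  (forall i, i \in s -> cok q r (phi i)) ->
  cok q r (fun X Y c => \sum_(i <- s) phi i X Y c).
Proof.
elim: s => [|i s ih] hs.
  have := cok_zero p q r; congr cok; do 3 (apply: functional_extensionality_dep => ?).
  by rewrite big_nil.
have hs' j : j \in s -> cok q r (phi j) by move=> js; apply: hs; rewrite inE js orbT.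
have := cok_add (hs i (mem_head i s)) (ih hs').
congr cok; do 3 (apply: functional_extensionality_dep => ?).
by rewrite big_cons.
Qed.

(** The common shape of the middle terms of d_1 and of the path terms: a cochain evaluated on a
    transformed chain, followed by rebracketing. *)
Lemma cok_op p p' q q' r (phi : cochain p')
    (A B : ('I_p.+1 -> ob) -> ('I_p'.+1 -> ob))
    (op : forall X Y, chain X Y -> chain (A X) (B Y))
    (R : forall X Y, hom (lprod (A X)) (lprod (B Y)) -> hom (lprod X) (lprod Y)) :
  (forall X Y a f g, R X Y (a *: f + g) = a *: R X Y f + R X Y g) ->
  (forall X Y d f, homog d f -> homog d (R X Y f)) ->
  (forall j a X Y (c c1 c2 : chain X Y), lin3 j a c c1 c2 ->
     exists l, lin3 l a (op _ _ c) (op _ _ c1) (op _ _ c2)) ->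
  (forall X Y (c : chain X Y), idc c -> idc (op _ _ c)) ->
  (forall X Y (c : chain X Y), csize c = q -> csize (op _ _ c) = q') ->
  (forall X Y (c : chain X Y), cdeg (op _ _ c) = cdeg c) ->
  cok q' r phi -> cok q r (fun X Y c => R X Y (phi _ _ (op X Y c))).
Proof.
move=> hR hRd hl hi hs hd ok; split.
- by move=> j a X Y c c1 c2 /hl [l /(cok_mlin ok) ->]; rewrite hR.
- by move=> X Y c /hi /(cok_id ok) ->; apply: (lin_hom0 (R := R X Y)); exact: hR.
by move=> X Y c sc; apply: hRd; rewrite -hd; apply: (cok_deg ok); exact: hs.
Qed.

Lemma good_block p p' i j s : leaves s = iota 0 i.+1 -> p = (p' + i)%N ->
  (j <= p')%N -> good (@block p p' i j s).
Proof.
move=> hs hp jp.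
pose f l := if (l < j)%N then [:: l] else if l == j then iota j i.+1 else [:: (l + i)%N].
have bE (l : 'I_p'.+1) : leaves (@block p p' i j s l) = map inord (f l).
  rewrite /block /f; case: ifP => // _; case: ifP => // _.
  rewrite leaves_trelabel hs (_ : iota j i.+1 = map (addn j) (iota 0 i.+1)).
    by rewrite -map_comp.
  by rewrite -iotaDl addn0.
rewrite /good (eq_map bE) (map_comp (map inord) (fun l : 'I_p'.+1 => f l)).
rewrite -map_flatten (map_comp f val) val_enum_ord.
rewrite (_ : flatten _ = iota 0 p.+1) ?map_inord_iota //.
have -> : p.+1 = (j + (i.+1 + (p' - j)))%N by rewrite addnCA subnKC // hp addSn addnC.
rewrite -[in X in iota 0 X.+1](subnKC jp) -addnS iotaD map_cat flatten_cat add0n /=.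
rewrite (_ : f j = iota j i.+1); last by rewrite /f ltnn eqxx.
have -> : flatten [seq f l | l <- iota 0 j] = iota 0 j.
  rewrite (_ : [seq f l | l <- iota 0 j] = [seq [:: id l] | l <- iota 0 j]).
    by rewrite flatten_map1 map_id.
  by apply/eq_in_map => l; rewrite mem_iota /f => /andP[_ ->].
have -> : flatten [seq f l | l <- iota j.+1 (p' - j)] = iota (j + i.+1) (p' - j).
  rewrite (_ : [seq f l | l <- _] = [seq [:: addn i l] | l <- iota j.+1 (p' - j)]).
    by rewrite flatten_map1 -iotaDl addnC addSnnS.
  apply/eq_in_map => l; rewrite mem_iota /f => /andP[jl _].
  by rewrite ltnNge (ltnW jl) /= gtn_eqF // addnC.
by rewrite !iotaD add0n.
Qed.

Lemma homogZ (X Y : ob) a d (f : hom X Y) : homog d f -> homog d (a *: f).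
Proof. by move=> h v i x; rewrite !homZE h linearZ. Qed.

Lemma crow_lin3 p j a (X Y : 'I_p.+1 -> ob) (c c1 c2 : chain X Y) :
  lin3 j a c c1 c2 -> glin a (crow j c) (crow j c1) (crow j c2) /\
  forall i, i != j -> crow i c1 = crow i c /\ crow i c2 = crow i c.
Proof.
elim: c c1 c2 => //= {}X Z {}Y F c ih c1 c2 [[F1 [F2 [[h hj] -> ->]]]|] /=.
  split; first exact: glin_comp2.
  by move=> i /h [-> ->].
move=> [d1 [d2 [/ih [hj h] -> ->]]] /=; split; first exact: glin_comp1.
by move=> i /h [-> ->].
Qed.

Lemma crow_deg p j a (X Y : 'I_p.+1 -> ob) (c c1 c2 : chain X Y) : lin3 j a c c1 c2 ->
  forall i, deg (crow i c1) = deg (crow i c) /\ deg (crow i c2) = deg (crow i c).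
Proof.
by move=> /crow_lin3 [[e1 e2 _] h] i; have [->|/h [-> ->]] := eqVneq i j.
Qed.

Lemma slin_degE p j a (X Y : 'I_p.+1 -> ob) (F F1 F2 : fam X Y) : slin j a F F1 F2 ->
  forall i, deg (F1 i) = deg (F i) /\ deg (F2 i) = deg (F i).
Proof.
move=> /slin_deg [h1 h2] i; split; first by have := congr1 (@^~ i) h1.
by have := congr1 (@^~ i) h2.
Qed.

Lemma kleft_lin3 p j a (X Y : 'I_p.+1 -> ob) (c c1 c2 : chain X Y) i :
  lin3 j a c c1 c2 -> kleft i c1 = kleft i c /\ kleft i c2 = kleft i c.
Proof.
elim: c c1 c2 => //= {}X Z {}Y F c ih c1 c2 [[F1 [F2 [h -> ->]]]|] /=.
  by have [-> ->] := slin_degE h i.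
move=> [d1 [d2 [h -> ->]]] /=; have [-> ->] := ih _ _ h.
by have [-> ->] := crow_deg h i; have [-> ->] := lin3_cdeg h.
Qed.

Lemma kright_lin3 p j a (X Y : 'I_p.+1 -> ob) (c c1 c2 : chain X Y) i :
  lin3 j a c c1 c2 -> kright i c1 = kright i c /\ kright i c2 = kright i c.
Proof.
elim: c c1 c2 => //= {}X Z {}Y F c ih c1 c2 [[F1 [F2 [h -> ->]]]|] /=.
  by have [-> ->] := slin_degE h i; have [-> ->] := slin_fdeg h.
move=> [d1 [d2 [h -> ->]]] /=; have [-> ->] := ih _ _ h.
by have [-> ->] := crow_deg h i.
Qed.

Section DropRow.
Variables (p : nat) (i : 'I_p.+2).

Definition drop_row (l : 'I_p.+1) : tree 'I_p.+2 := Lf (lift i l).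

Lemma affine_drop_row : affine drop_row.
Proof.
by split=> // l l' j; rewrite !inE => /eqP -> /eqP /lift_inj.
Qed.

Lemma drop_row_out l : i \notin leaves (drop_row l).
Proof. by rewrite inE neq_lift. Qed.

Lemma drop_row_in j : j != i -> exists l, j \in leaves (drop_row l).
Proof.
by rewrite eq_sym => /unlift_some [l -> _]; exists l; rewrite inE.
Qed.

Lemma cdeg_drop_row (X Y : 'I_p.+2 -> ob) (c : chain X Y) :
  deg (crow i c) + cdeg (cmap drop_row c) = cdeg c.
Proof.
elim: c => //= {}X Z {}Y F c ih; rewrite -ih addrACA; congr (_ + _).
by rewrite /fdeg [RHS](bigD1_ord i) //=.
Qed.

End DropRow.

Section FirstDifferential.
Variables (p : nat) (r : int) (phi : cochain p).

Definition diff1_left : cochain p.+1 := fun X Y c =>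
  let T := drop_row ord0 in
  let t := Nd (Lf ord0) (tbind (ltree p) T) in
  (-1) ^ (r * deg (crow ord0 c) + kleft ord0 c) *:
    rebracket X Y t t (htens (r + cdeg (cmap T c)) (crow ord0 c) (phi (cmap T c))).

Definition diff1_mid (i : nat) : cochain p.+1 := fun X Y c =>
  let T := @block p.+1 p 1 i (rcomb 0 1) in
  rebracket X Y (tbind (ltree p) T) (tbind (ltree p) T) (phi (cmap T c)).

Definition diff1_right : cochain p.+1 := fun X Y c =>
  let T := drop_row ord_max in
  let t := Nd (tbind (ltree p) T) (Lf ord_max) in
  ((-1) ^+ p * (-1) ^ (kright ord_max c)) *:
    rebracket X Y t t (htens (deg (crow ord_max c)) (phi (cmap T c)) (crow ord_max c)).

Lemma diff1E X Y (c : chain X Y) :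
  diff1 r phi c = diff1_left c + \sum_(i < p.+1) (-1) ^+ i.+1 *: diff1_mid i c
    + diff1_right c.
Proof. by []. Qed.

Variable q : nat.
Hypothesis ok : cok q r phi.

Lemma diff1_left_ok : cok q r diff1_left.
Proof.
split.
- move=> j a X Y c c1 c2 h; rewrite /diff1_left /=.
  have [-> ->] := kleft_lin3 ord0 h; have [-> ->] := crow_deg h ord0.
  rewrite scalerA (mulrC a) -[(_ * a) *: _]scalerA -scalerDr; congr (_ *: _).
  rewrite -rebracket_lin; congr rebracket.
  (* A slot in row 0 is seen only by the outer tensor factor, a slot in any other row only by [phi];
     linearity is used in the corresponding argument of [htens]. *)
  have [hj hi] := crow_lin3 h; have [ej|ej] := eqVneq ord0 j.
    subst j; have [-> ->] := lin3_cmap_out (drop_row_out ord0) h.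
    by apply: htens_lin1; case: hj.
  have [-> ->] := hi _ ej.
  have [|l jl] := @drop_row_in _ ord0 j; first by rewrite eq_sym.
  have hl := lin3_cmap (affine_drop_row ord0) jl h.
  have [-> ->] := lin3_cdeg hl.
  by apply: htens_lin2; exact: (cok_mlin ok hl).
- move=> X Y c h; rewrite /diff1_left /= (cok_id ok (idc_cmap _ h)).
  rewrite (lin_hom0 (R := fun f => rebracket X Y _ _ (htens _ _ f))) ?scaler0 //.
  by move=> a f g; rewrite -rebracket_lin (htens_lin2 _ _ (erefl _)).
move=> X Y c sc; apply: homogZ; apply: rebracket_homog.
rewrite -(cdeg_drop_row ord0) addrCA; apply: homog_tens; first exact: gvalP.
by apply: (cok_deg ok); rewrite csize_cmap.
Qed.

Lemma diff1_mid_ok i : (i <= p)%N -> cok q r (diff1_mid i).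
Proof.
move=> ip.
have gT : good (@block p.+1 p 1 i (rcomb 0 1)) by apply: good_block; rewrite ?addn1.
apply: (cok_op (op := fun X Y c => cmap (@block p.+1 p 1 i (rcomb 0 1)) c)
  (R := fun X Y f => rebracket X Y _ _ f) _ _ _ _ _ _ ok) => X.
- by move=> Y a f g; exact: rebracket_lin.
- by move=> Y d f; exact: rebracket_homog.
- move=> a X' Y c c1 c2 h; have [l jl] := good_cover X gT.
  by exists l; exact: lin3_cmap (good_affine gT) jl h.
- by move=> Y c; exact: idc_cmap.
- by move=> Y c sc; rewrite csize_cmap.
- by move=> Y c; exact: cdeg_cmap.
Qed.

Lemma diff1_right_ok : cok q r diff1_right.
Proof.
split.
- move=> j a X Y c c1 c2 h; rewrite /diff1_right /=.
  have [-> ->] := kright_lin3 ord_max h; have [-> ->] := crow_deg h ord_max.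
  rewrite scalerA (mulrC a) -[(_ * a) *: _]scalerA -scalerDr; congr (_ *: _).
  rewrite -rebracket_lin; congr rebracket.
  have [hj hi] := crow_lin3 h; have [ej|ej] := eqVneq ord_max j.
    subst j; have [-> ->] := lin3_cmap_out (drop_row_out ord_max) h.
    by apply: htens_lin2; case: hj.
  have [-> ->] := hi _ ej.
  have [|l jl] := @drop_row_in _ ord_max j; first by rewrite eq_sym.
  have hl := lin3_cmap (affine_drop_row ord_max) jl h.
  by apply: htens_lin1; exact: (cok_mlin ok hl).
- move=> X Y c h; rewrite /diff1_right /= (cok_id ok (idc_cmap _ h)).
  rewrite (lin_hom0 (R := fun f => rebracket X Y _ _ (htens _ f _))) ?scaler0 //.
  by move=> a f g; rewrite -rebracket_lin (htens_lin1 _ _ (erefl _)).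
move=> X Y c sc; apply: homogZ; apply: rebracket_homog.
rewrite -(cdeg_drop_row ord_max) addrCA addrC; apply: homog_tens; last exact: gvalP.
by apply: (cok_deg ok); rewrite csize_cmap.
Qed.

Lemma diff1_ok : cok q r (diff1 r phi).
Proof.
apply: cok_add; last exact: diff1_right_ok.
apply: cok_add; first exact: diff1_left_ok.
apply: (@cok_sum _ _ _ _ _ (fun i : 'I_p.+1 => fun X Y c => (-1) ^+ i.+1 *: diff1_mid i c)).
by move=> i _; apply: cok_scale; apply: diff1_mid_ok; rewrite -ltnS.
Qed.

End FirstDifferential.

Lemma diff_path_ok p i j (phi : cochain (p - i)) (P : seq (tree nat * nat)) q q' r :
  (i <= p)%N -> (j <= p - i)%N ->
  (forall x, x \in P -> leaves x.1 = iota 0 i.+1) ->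
  q' = (q + count isSome (steps 0 (behead P)))%N ->
  cok q' r phi -> cok q r (@diff_path _ _ _ p i phi j P).
Proof.
case: P => [|[s m] P] ip jp hP -> ok; first exact: cok_zero.
have gs x : leaves x = iota 0 i.+1 -> good (@block p (p - i) i j x).
  by move=> hx; apply: good_block => //; rewrite subnK.
have gp (Q : seq (tree nat * nat)) s' m0 :
    (forall x, x \in Q -> leaves x.1 = iota 0 i.+1) -> leaves s' = iota 0 i.+1 ->
    @good_path p (p - i) i j s' (steps m0 Q).
  elim: Q s' m0 => [|[t m'] Q ih] s' m0 hQ hs /=; first by split=> //; exact: gs.
  have ht : leaves t = iota 0 i.+1 by apply: (hQ (t, m')); rewrite mem_head.
  have hQ' x : x \in Q -> leaves x.1 = iota 0 i.+1.
    by move=> xP; apply: hQ; rewrite inE xP orbT.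
  by case: ifP => _; split; try exact: gs; exact: ih.
have {gp}gp : @good_path p (p - i) i j s (steps 0 P).
  apply: gp => [x xP|]; first by apply: hP; rewrite inE xP orbT.
  by apply: (hP (s, m)); rewrite mem_head.
apply: (cok_op (op := fun X Y c => cpath (p - i) i j s (steps 0 P) c)
  (R := fun X Y f => rebracket X Y _ _ f) _ _ _ _ _ _ ok) => X.
- by move=> Y a f g; exact: rebracket_lin.
- by move=> Y d f; exact: rebracket_homog.
- by move=> a X' Y c c1 c2 h; exact: lin3_cpath h.
- by move=> Y c; exact: idc_cpath.
- by move=> Y c sc; rewrite csize_cpath sc.
- by move=> Y c; exact: cdeg_cpath.
Qed.

End CochainClosure.

(** * Lengths and words of admissible paths *)

Section AdmissiblePaths.

Lemma stairsE (S T : Type) (q : S) Q (u : T) U :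
  stairs q Q u U = map (cons (q, u))
    match Q, U with
    | [::], [::] => [:: [::]]
    | q' :: Q', [::] => stairs q' Q' u [::]
    | [::], u' :: U' => stairs q [::] u' U'
    | q' :: Q', u' :: U' => stairs q' Q' u U ++ stairs q Q u' U'
    end.
Proof. by case: Q; case: U. Qed.

(** The nested fixpoint decreases either list, so the induction runs on the sum of their lengths. *)
Lemma stairs_ind (S T : eqType) (K : S -> seq S -> T -> seq T -> seq (S * T) -> Prop) :
  (forall q u, K q [::] u [::] [:: (q, u)]) ->
  (forall q q' Q u U R, R \in stairs q' Q u U -> K q' Q u U R ->
     K q (q' :: Q) u U ((q, u) :: R)) ->
  (forall q Q u u' U R, R \in stairs q Q u' U -> K q Q u' U R ->
     K q Q u (u' :: U) ((q, u) :: R)) ->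
  forall q Q u U R, R \in stairs q Q u U -> K q Q u U R.
Proof.
move=> h0 h1 h2 q Q u U R.
have [N] := ubnP (size Q + size U); elim: N q Q u U R => // N ih q Q u U R.
rewrite ltnS stairsE => sz /mapP [R' hR' ->].
case: Q U sz hR' => [|q' Q] [|u' U] /= sz hR'.
- by move: hR'; rewrite inE => /eqP ->.
- by apply: h2 => //; apply: ih.
- by apply: h1 => //; apply: ih.
move: hR'; rewrite mem_cat => /orP[hR'|hR'].
  by apply: h1 => //; apply: ih.
by apply: h2 => //; apply: ih => //; rewrite /= -addnS.
Qed.

Lemma stairs_size (S T : eqType) (q : S) Q (u : T) U R : R \in stairs q Q u U ->
  size R = (size Q + size U).+1 /\
  forall x, x \in R -> x.1 \in q :: Q /\ x.2 \in u :: U.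
Proof.
move: q Q u U R; apply: stairs_ind.
- by move=> q u; split=> // x; rewrite !inE => /eqP ->; rewrite !eqxx.
- move=> q q' Q u U R _ [sR h]; split=> [|x]; first by rewrite /= sR.
  rewrite in_cons => /orP[/eqP ->|/h [h1 h2]].
    by split; apply/orP; left.
  by split=> //; apply/orP; right.
move=> q Q u u' U R _ [sR h]; split=> [|x]; first by rewrite /= sR addnS.
rewrite in_cons => /orP[/eqP ->|/h [h1 h2]].
  by split; apply/orP; left.
by split=> //; apply/orP; right.
Qed.

(** As U counts upwards by one, the height is unchanged exactly at horizontal steps, which is the
    test made by [steps]. *)
Lemma stairs_steps (q : tree nat) Q u U R : R \in stairs q Q u U ->
  U = iota u.+1 (size U) ->
  exists2 R', R = (q, u) :: R' & count isSome (steps u R') = size Q.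
Proof.
move: q Q u U R; apply: (@stairs_ind _ _ (fun q Q u U R => U = iota u.+1 (size U) ->
  exists2 R', R = (q, u) :: R' & count isSome (steps u R') = size Q)).
- by move=> q u _; exists [::].
- move=> q q' Q u U R _ ih /ih [R' -> h]; exists ((q', u) :: R') => //.
  by rewrite /= eqxx /= h.
move=> q Q u u' U R _ ih [eu eU]; subst u'; have [R' -> h] := ih eU.
by exists ((q, u.+1) :: R') => //; rewrite /= gtn_eqF.
Qed.

Lemma adm_prodP (S T : eqType) (PS : seq (seq S)) (PT : seq (seq T)) P :
  P \in adm_prod PS PT -> exists q Q u U,
  [/\ q :: Q \in PS, u :: U \in PT & P \in stairs q Q u U].
Proof.
rewrite mem_undup => /flattenP [s /allpairsP [[Q U] /= [hQ hU ->]]].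
case: Q hQ => // q Q hQ; case: U hU => // u U hU hP.
by exists q, Q, u, U.
Qed.

Definition bracketing_path (m : nat) (P : seq (tree nat)) : Prop :=
  size P = m.+1 /\ forall t, t \in P -> leaves t = iota 0 m.+2.

Lemma leaves_graft a kk l s u : (a <= kk.+1)%N ->
  leaves s = iota 0 kk.+2 -> leaves u = iota 0 l.+2 ->
  leaves (graft a l (s, u)) = iota 0 (kk + l.+3).
Proof.
move=> ak hs hu; have e : kk.+2 = (a + (kk.+1 - a).+1)%N by rewrite addnS subnKC.
rewrite /graft leaves_tbind [(s, u).1]/= hs [(s, u).2]/= e iotaD map_cat flatten_cat add0n.
rewrite -[iota a _.+1]/(a :: iota a.+1 _) map_cons -[flatten (_ :: _)]/(_ ++ _).
rewrite ltnn eqxx leaves_trelabel hu -iotaDl.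
rewrite (_ : (kk + l.+3 = a + (l.+2 + (kk.+1 - a)))%N); last first.
  by rewrite addnCA subnKC // addnC addSnnS.
rewrite [in RHS]iotaD [in RHS]iotaD add0n addn0; congr (_ ++ (_ ++ _)).
  transitivity (flatten [seq [:: id b] | b <- iota 0 a]); last first.
    by rewrite flatten_map1 map_id.
  congr flatten; apply/eq_in_map => b; rewrite mem_iota => /andP[_ ba].
  by rewrite ba.
transitivity (flatten [seq [:: addn l.+1 b] | b <- iota a.+1 (kk.+1 - a)]).
  congr flatten; apply/eq_in_map => b; rewrite mem_iota => /andP[ab _].
  by rewrite ltnNge (ltnW ab) /= gtn_eqF // addnC.
by rewrite flatten_map1 -iotaDl addnC addSnnS.
Qed.

(** A staircase in A_k x A_l has k + l + 1 vertices, and the terminal vertex is appended; for a face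
    of A_{m+1} one has k + l = m. *)
Lemma adm_upto_path m i P : (i <= m)%N -> P \in adm_upto m i -> bracketing_path i P.
Proof.
elim: m i P => [|m ih] i P im.
  move: im; rewrite leqn0 => /eqP ->; rewrite inE => /eqP ->; split=> // t.
  by rewrite inE => /eqP ->.
change (P \in (if (i <= m)%N then adm_upto m i else adm_succ (adm_upto m) m) ->
  bracketing_path i P).
case: ifP => [im'|im']; first exact: ih.
have -> : i = m.+1 by apply/eqP; rewrite eqn_leq im ltnNge im'.
rewrite mem_filter => /andP [_]; rewrite mem_undup => /mapP [P' hP' ->].
move: hP' => /flattenP [s /allpairsPdep [kk [a [hk ha ->]]]] /mapP [R hR ->].
move: hk ha; rewrite !mem_iota !add0n !ltnS => km ak.
have [q [Q [u [U [hQ hU /stairs_size [sR mR]]]]]] := adm_prodP hR.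
have [sQ lQ] := ih _ _ km hQ; have [sU lU] := ih _ _ (leq_subr kk m) hU.
split.
  rewrite size_rcons size_map sR; congr _.+1.
  move: sQ sU => /= [->] [->].
  by rewrite subnKC.
move=> t; rewrite mem_rcons inE => /orP[/eqP ->|]; first exact: leaves_rcomb.
move=> /mapP [[s' u'] /mR [/= /lQ ls /lU lu] ->].
by rewrite (leaves_graft ak ls lu) !addnS subnKC.
Qed.

Lemma adm_path i q P : P \in adm_prod (adm_A i) (adm_I q) ->
  (forall x, x \in P -> leaves x.1 = iota 0 i.+2) /\
  count isSome (steps 0 (behead P)) = i.
Proof.
move=> /adm_prodP [s [Q [u [U [hQ hU hP]]]]].
have [sQ lQ] := adm_upto_path (leqnn i) hQ.
split; first by move=> x xP; apply: lQ; case: ((stairs_size hP).2 x xP).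
move: hU hP; rewrite inE => /eqP [-> ->] hP.
have [|R' -> h] := stairs_steps hP; first by rewrite size_iota.
by rewrite h; move: sQ => [].
Qed.

End AdmissiblePaths.

(** * The internal differential *)

Section InternalDifferential.
Context {k : fieldType} {n : nat} {fg : bool} {p : nat}.
Local Notation ob := (ob k n fg).
Local Notation J := 'I_p.+1.
Local Notation chain := (@chain k n fg p).
Local Notation fam := (@fam k n fg J).
Local Notation cochain := (@cochain k n fg).

Lemma hdiff_lin (X Y : ob) r a (f g : hom X Y) :
  hdiff r (a *: f + g) = a *: hdiff r f + hdiff r g.
Proof.
rewrite /hdiff hcomp_lin1 hcomp_lin2 scalerBr scalerDr opprD addrACA.
by rewrite !scalerA mulrC.
Qed.

Lemma glin_diff a (X Y : ob) (f f1 f2 : gmor X Y) :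
  glin a f f1 f2 -> glin a (gdiff f) (gdiff f1) (gdiff f2).
Proof.
case=> d1 d2 e; split; rewrite /= ?d1 ?d2 //.
by rewrite e hdiff_lin.
Qed.

Lemma lrel_mapl (I T : Type) (R : T -> T -> T -> Prop) (s : seq I) (u : I -> int)
    (f f1 f2 : I -> T) :
  (forall i, R (f i) (f1 i) (f2 i)) ->
  lrel R [seq (u i, f i) | i <- s] [seq (u i, f1 i) | i <- s] [seq (u i, f2 i) | i <- s].
Proof. by move=> h; elim: s => /=; constructor. Qed.

Lemma slin_diff j a (X Y : J -> ob) (F F1 F2 : fam X Y) i : slin j a F F1 F2 ->
  slin j a (dfwith (i := i) F (gdiff (F i))) (dfwith (i := i) F1 (gdiff (F1 i)))
    (dfwith (i := i) F2 (gdiff (F2 i))).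
Proof.
move=> [h hj]; split=> [l lj|].
  have [e1 e2] := h _ lj; have [il|il] := eqVneq i l.
    by subst l; rewrite !dfwith_in e1 e2.
  by rewrite !dfwith_out.
have [ij|ij] := eqVneq i j; first by subst j; rewrite !dfwith_in; exact: glin_diff.
by rewrite !dfwith_out.
Qed.

Lemma lrel_cdiffs j a X Y (c c1 c2 : chain X Y) :
  lin3 j a c c1 c2 -> lrel (@lin3 _ _ _ _ j a X Y) (cdiffs c) (cdiffs c1) (cdiffs c2).
Proof.
elim: c c1 c2 => //= {}X Z {}Y F c ih c1 c2 [[F1 [F2 [h -> ->]]]|].
  apply: lrel_cat; last first.
    apply: (@lrel_map _ _ _ _ id); last exact: lrel_diag.
    by move=> x _ _ [<- <-]; left; exists F1, F2.
  have e i : \sum_(l : J | (l < i)%N) deg (F1 l) = \sum_(l : J | (l < i)%N) deg (F l)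
    /\ \sum_(l : J | (l < i)%N) deg (F2 l) = \sum_(l : J | (l < i)%N) deg (F l).
    by split; apply: eq_bigr => l _; have [e1 e2] := slin_degE h l; rewrite ?e1 ?e2.
  rewrite [X in lrel _ _ X](eq_map (g := fun i : J => (cdeg c + \sum_(l : J | (l < i)%N) deg (F l),
    ccons (dfwith (i := i) F1 (gdiff (F1 i))) c))); last by move=> i; rewrite (e i).1.
  rewrite [X in lrel _ _ _ X](eq_map (g := fun i : J => (cdeg c + \sum_(l : J | (l < i)%N) deg (F l),
    ccons (dfwith (i := i) F2 (gdiff (F2 i))) c))); last by move=> i; rewrite (e i).2.
  apply: lrel_mapl => i; left; do 2 eexists; split=> //.
  exact: slin_diff.
move=> [d1 [d2 [h -> ->]]] /=; have [-> ->] := lin3_cdeg h.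
apply: lrel_cat.
  by apply: lrel_mapl => i; right; exists d1, d2.
apply: (@lrel_map _ _ _ _ id); last exact: ih.
by move=> x x1 x2 hx; right; exists x1, x2.
Qed.

Lemma lall_mapl (I T : Type) (P : T -> Prop) (s : seq I) (u : I -> int) (f : I -> T) :
  (forall i, P (f i)) -> lall P [seq (u i, f i) | i <- s].
Proof. by move=> h; elim: s => //= i s ih; split. Qed.

Lemma gdiff_id (X : ob) : (gdiff (gid X) : hom X X) = 0.
Proof. by apply: homP => v x; rewrite /= expr0z scale1r scaleN1r subrr. Qed.

(** Differentiating an entry of an identity column gives a zero entry, as d(Id) = 0; differentiating
    any other column keeps the identity column. *)
Lemma cdiffs_dead X Y (c : chain X Y) : idc c -> lall (@dead _ _ _ _ X Y) (cdiffs c).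
Proof.
elim: c => // {}X Z {}Y F c ih [[c'' ->]|h] /=; apply: lall_cat.
- apply: lall_mapl => i; right; exists i; apply: lin3_zero.
  by rewrite dfwith_in gdiff_id.
- elim: (cdiffs c'') => //= x s ihs; split=> //.
  by left; left; exists x.2.
- by apply: lall_mapl => i; left; right.
apply: lall_map; apply: lall_impl (ih h) => x hx s.
exact: dead_ccons.
Qed.

Lemma cdiffs_size X Y (c : chain X Y) :
  lall (fun x => csize x = csize c /\ cdeg x = cdeg c + 1) (cdiffs c).
Proof.
elim: c => //= {}X Z {}Y F c ih; apply: lall_cat.
  apply: lall_mapl => i; split=> //=; rewrite -addrA; congr (_ + _).
  rewrite /fdeg (bigD1 i) //= dfwith_in [in RHS](bigD1 i) //= addrAC; congr (_ + _).
  by apply: eq_bigr => l li; rewrite dfwith_out // eq_sym.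
apply: lall_map; apply: lall_impl ih => x [h1 h2] s /=; rewrite h1 h2.
by split=> //; rewrite addrAC.
Qed.

Lemma homogD (X Y : ob) d (f g : hom X Y) :
  homog d f -> homog d g -> homog d (f + g).
Proof. by move=> hf hg v i x; rewrite !homDE hf hg linearD. Qed.

Lemma diff_int_ok q r (phi : cochain p) : cok q r phi -> cok q (r + 1) (diff_int r phi).
Proof.
move=> ok; split.
- move=> j a X Y c c1 c2 h; rewrite /diff_int (cok_mlin ok h).
  have [-> ->] := lin3_cdeg h; rewrite hdiff_lin (scalerBr a (hdiff (r + cdeg c) (phi X Y c1))) [RHS]addrACA -opprD; congr (_ - _).
  rewrite scalerA (mulrC a) -[(_ * a) *: _]scalerA -scalerDr; congr (_ *: _).
  apply: (lrel_sum (lrel_cdiffs h)) => s x x1 x2 /(cok_mlin ok) /= ->.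
  by rewrite scalerDr !scalerA mulrC.
- move=> X Y c h; rewrite /diff_int (cok_id ok h).
  rewrite (lin_hom0 (R := fun f => hdiff _ f)); last by move=> *; exact: hdiff_lin.
  rewrite (lall_sum0 (cdiffs_dead h)) ?scaler0 ?subrr // => s x hx /=.
  apply: homP => v t; rewrite homZE.
  by rewrite -[phi X Y x v t]/(vcomp phi v x t) (vok_dead t (vcomp_ok v ok) hx) scaler0.
move=> X Y c sc; rewrite /diff_int -scaleN1r addrAC.
apply: homogD; first by apply: homog_diff; apply: (cok_deg ok).
apply/homogZ/homogZ; have := cdiffs_size c; elim: (cdiffs c) => [|x s ih] /=.
  by rewrite big_nil => _; exact: homog0.
move=> [[sx dx] /ih h]; rewrite big_cons; apply: homogD => //; apply: homogZ.
by rewrite -addrA -dx; apply: (cok_deg ok); rewrite sx.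
Qed.

End InternalDifferential.

Lemma addr4ACA (V : nmodType) (a a' b b' c c' d d' : V) :
  a + a' + (b + b') + (c + c') + (d + d') = (a + b + c + d) + (a' + b' + c' + d').
Proof. by rewrite (addr3ACA a a' b) addrACA. Qed.

(** * The total differential, bidegree by bidegree *)

Section TotalDifferential.
Context {k : fieldType} {n : nat} {fg : bool}.
Local Notation ob := (ob k n fg).
Local Notation cochain := (@cochain k n fg).
Local Notation tcochain := (@tcochain k n fg).

Section Linearity.
Variables (p : nat) (r : int) (a : k).

(** Linearity is stated together with locality here and for the other terms: the hypothesis names
    the bidegrees on which the term depends. *)
Lemma diff_int_lin (phi phi1 phi2 : cochain p) X Y (c : chain X Y) :
  (forall d : chain X Y, csize d = csize c -> phi X Y d = a *: phi1 X Y d + phi2 X Y d) ->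
  diff_int r phi c = a *: diff_int r phi1 c + diff_int r phi2 c.
Proof.
move=> h; rewrite /diff_int h // hdiff_lin (scalerBr a (hdiff _ _)) [RHS]addrACA -opprD.
congr (_ - _); rewrite scalerA (mulrC a) -[(_ * a) *: _]scalerA -scalerDr; congr (_ *: _).
rewrite scaler_sumr -big_split; apply: lall_sum (cdiffs_size c) _ => s x [sx _] /=.
by rewrite h // scalerDr !scalerA mulrC.
Qed.

Lemma diff0_lin (phi phi1 phi2 : cochain p) X Y (c : chain X Y) :
  (forall X' Y' (d : chain X' Y'), (csize d).+1 = csize c ->
     phi X' Y' d = a *: phi1 X' Y' d + phi2 X' Y' d) ->
  diff0 r phi c = a *: diff0 r phi1 c + diff0 r phi2 c.
Proof.
move=> h; apply: homP => v t; rewrite homDE homZE !diff0E; apply: vdiff0_lin.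
by move=> X' Y' d s sd; rewrite /vcomp h.
Qed.

Lemma diff1_lin (phi phi1 phi2 : cochain p) X Y (c : chain X Y) :
  (forall X' Y' (d : chain X' Y'), csize d = csize c ->
     phi X' Y' d = a *: phi1 X' Y' d + phi2 X' Y' d) ->
  diff1 r phi c = a *: diff1 r phi1 c + diff1 r phi2 c.
Proof.
move=> h; rewrite !diff1E !scalerDr -addr3ACA; congr (_ + _ + _).
- rewrite /diff1_left /= h ?csize_cmap // (htens_lin2 _ _ (erefl _)) rebracket_lin.
  by rewrite scalerDr !scalerA (mulrC a).
- rewrite scaler_sumr -big_split; apply: eq_bigr => i _ /=.
  by rewrite /diff1_mid /= h ?csize_cmap // rebracket_lin scalerDr !scalerA (mulrC a).
rewrite /diff1_right /= h ?csize_cmap // (htens_lin1 _ _ (erefl _)) rebracket_lin.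
by rewrite scalerDr !scalerA (mulrC a).
Qed.

Lemma diff0_scale (phi phi1 : cochain p) X Y (c : chain X Y) :
  (forall X' Y' (d : chain X' Y'), (csize d).+1 = csize c ->
     phi X' Y' d = a *: phi1 X' Y' d) ->
  diff0 r phi c = a *: diff0 r phi1 c.
Proof.
move=> h; apply: homP => v t; rewrite homZE !diff0E.
have := @vdiff0_lin _ _ _ _ _ _ r a (vcomp phi v) (vcomp phi1 v)
  (fun _ _ _ _ => 0) X Y c t.
rewrite [X in _ + X]vdiff0_eq0 // addr0; apply=> X' Y' d s sd.
by rewrite /vcomp h // addr0.
Qed.

End Linearity.

Lemma diff_path_lin a p i j P (phi phi1 phi2 : cochain (p - i)) X Y (c : chain X Y) :
  (forall X' Y' (d : chain X' Y'),
     csize d = (csize c + count isSome (steps 0 (behead P)))%N ->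
     phi X' Y' d = a *: phi1 X' Y' d + phi2 X' Y' d) ->
  @diff_path _ _ _ p i phi j P X Y c =
  a *: @diff_path _ _ _ p i phi1 j P X Y c + @diff_path _ _ _ p i phi2 j P X Y c.
Proof.
case: P => [|[s m] P] h /=; first by rewrite scaler0 addr0.
by rewrite h ?csize_cpath // rebracket_lin.
Qed.

Section Signs.
Variable sg : signs.

Definition tdiff1 (q : nat) (r : int) (z : tcochain) (p : nat) : cochain p :=
  match p return cochain p with
  | 0 => fun X Y c => 0
  | p'.+1 => fun X Y c => (-1) ^+ sgn1 sg p' q r *: diff1 r (z p') c
  end.

Definition tdiff2 (q : nat) (r : int) (z : tcochain) (p : nat) : cochain p :=
  fun X Y c => \sum_(2 <= i < p.+1) \sum_(0 <= j < (p - i).+1%N)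
      \sum_(P <- adm_prod (adm_A i.-1) (adm_I q))
        (-1) ^+ sgn_path sg (p - i)%N (q + i.-1)%N r i j P *:
          @diff_path _ _ _ p i (z (p - i)%N) j P X Y c.

Lemma tdiffE (m : int) (z : tcochain) p X Y (c : @chain k n fg p X Y) :
  let q := csize c in let r := m + 1 - p%:Z - q%:Z in
  tdiff sg m z c =
  (-1) ^+ sgn_int sg p q (r - 1) *: diff_int (r - 1) (z p) c
  + (-1) ^+ sgn0 sg p q.-1 r *: diff0 r (z p) c
  + tdiff1 q r z c + tdiff2 q r z c.
Proof. by case: p X Y c. Qed.

Lemma tdiff1_lin a q r (z z1 z2 : tcochain) p X Y (c : @chain k n fg p X Y) :
  (forall p' X' Y' (d : @chain k n fg p' X' Y'), p'.+1 = p -> csize d = csize c ->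
     z p' X' Y' d = a *: z1 p' X' Y' d + z2 p' X' Y' d) ->
  tdiff1 q r z c = a *: tdiff1 q r z1 c + tdiff1 q r z2 c.
Proof.
case: p X Y c => [|p] X Y c h /=; first by rewrite scaler0 addr0.
rewrite (@diff1_lin _ _ a _ (z1 p) (z2 p)) => [|X' Y' d sd]; last exact: h.
by rewrite scalerDr !scalerA (mulrC a).
Qed.

Lemma tdiff2_lin a r (z z1 z2 : tcochain) p X Y (c : @chain k n fg p X Y) :
  (forall p' X' Y' (d : @chain k n fg p' X' Y'), (p'.+1 < p)%N ->
     (p' + csize d).+1 = (p + csize c)%N ->
     z p' X' Y' d = a *: z1 p' X' Y' d + z2 p' X' Y' d) ->
  tdiff2 (csize c) r z c = a *: tdiff2 (csize c) r z1 c + tdiff2 (csize c) r z2 c.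
Proof.
move=> h; rewrite /tdiff2 scaler_sumr -big_split; apply: eq_big_nat => i /andP[i2 ip] /=.
rewrite scaler_sumr -big_split; apply: eq_bigr => j _ /=.
rewrite scaler_sumr -big_split big_seq [RHS]big_seq; apply: eq_bigr => P hP /=.
have [_ cP] := adm_path hP.
rewrite (@diff_path_lin a _ _ _ _ _ (z1 (p - i)%N) (z2 (p - i)%N)).
  by rewrite scalerDr !scalerA (mulrC a).
move=> X' Y' d; rewrite cP => sd; apply: h.
  case: i i2 ip {P hP cP sd d X' Y'} => [|[|i]] // _; rewrite ltnS => ip.
  by rewrite subnSK // ltn_subrL (leq_trans _ ip).
by rewrite sd -!addnS prednK ?(ltnW i2) // addnCA subnK // addnC.
Qed.

Lemma tdiff_lin a m (z z1 z2 : tcochain) p X Y (c : @chain k n fg p X Y) :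
  (forall p' X' Y' (d : @chain k n fg p' X' Y'), (p' <= p)%N ->
     (p' + csize d = p + csize c)%N \/ ((p' + csize d).+1 = p + csize c)%N ->
     z p' X' Y' d = a *: z1 p' X' Y' d + z2 p' X' Y' d) ->
  tdiff sg m z c = a *: tdiff sg m z1 c + tdiff sg m z2 c.
Proof.
move=> h; rewrite !tdiffE.
rewrite (@diff_int_lin _ _ a _ (z1 p) (z2 p)); last by move=> d sd; apply: h; rewrite ?sd; auto.
rewrite (@diff0_lin _ _ a _ (z1 p) (z2 p)); last first.
  by move=> X' Y' d sd; apply: h => //; right; rewrite -addnS sd.
rewrite (@tdiff1_lin a _ _ _ z1 z2); last first.
  move=> p' X' Y' d hp sd; apply: h; first by apply: ltnW; rewrite hp.
  by right; rewrite -addSn hp sd.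
rewrite (@tdiff2_lin a _ _ z1 z2); last first.
  by move=> p' X' Y' d hp sd; apply: h; rewrite ?sd; auto; exact: ltnW (ltnW hp).
by rewrite !scalerDr !scalerA !(mulrC a) addr4ACA.
Qed.

(** Turns linearity into vanishing: a cochain that is zero on the chains concerned is there -1 times
    itself plus itself, and hence so is its differential. *)
Lemma lin_eq0 (V : lmodType k) (x : V) : x = -1 *: x + x -> x = 0.
Proof. by rewrite scaleN1r addNr. Qed.

Lemma zero_lin (V : lmodType k) (x : V) : x = 0 -> x = -1 *: x + x.
Proof. by move=> ->; rewrite scaler0 addr0. Qed.

(** The internal differential stays in the total arity of [c], and the d_i with i >= 1 start from
    fewer rows in the total arity below; both inputs are zero, and d_0 remains. *)
Lemma tdiff_lead0 m (z : tcochain) p X Y (c : @chain k n fg p X Y) :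
  (forall p' X' Y' (d : @chain k n fg p' X' Y'), (p' + csize d)%N = (p + csize c)%N ->
     z p' X' Y' d = 0) ->
  (forall p' X' Y' (d : @chain k n fg p' X' Y'), (p' < p)%N ->
     (p' + csize d).+1 = (p + csize c)%N -> z p' X' Y' d = 0) ->
  tdiff sg m z c = (-1) ^+ sgn0 sg p (csize c).-1 (m + 1 - p%:Z - (csize c)%:Z) *:
    diff0 (m + 1 - p%:Z - (csize c)%:Z) (z p) c.
Proof.
move=> h1 h2; rewrite tdiffE.
have -> : diff_int (m + 1 - p%:Z - (csize c)%:Z - 1) (z p) c = 0.
  apply/lin_eq0/diff_int_lin => d sd; apply/zero_lin/h1.
  by rewrite sd.
have -> : tdiff1 (csize c) (m + 1 - p%:Z - (csize c)%:Z) z c = 0.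
  apply/lin_eq0/tdiff1_lin => p' X' Y' d hp sd; apply/zero_lin/h2; first by rewrite hp.
  by rewrite -addSn hp sd.
have -> : tdiff2 (csize c) (m + 1 - p%:Z - (csize c)%:Z) z c = 0.
  by apply/lin_eq0/tdiff2_lin => p' X' Y' d hp sd; apply/zero_lin/h2 => //; exact: ltnW.
by rewrite scaler0 add0r !addr0.
Qed.

(** One row further on, the component with p + 1 rows still feeds d_1, while the d_i with i >= 2
    start from earlier components, which are zero. *)
Lemma tdiff_lead1 m (z : tcochain) p X Y (c : @chain k n fg p.+1 X Y) :
  (forall p' X' Y' (d : @chain k n fg p' X' Y'), (p' + csize d)%N = (p.+1 + csize c)%N ->
     z p' X' Y' d = 0) ->
  (forall p' X' Y' (d : @chain k n fg p' X' Y'), (p' < p)%N ->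
     (p' + csize d)%N = (p + csize c)%N -> z p' X' Y' d = 0) ->
  let r := m + 1 - p.+1%:Z - (csize c)%:Z in
  tdiff sg m z c = (-1) ^+ sgn0 sg p.+1 (csize c).-1 r *: diff0 r (z p.+1) c
    + (-1) ^+ sgn1 sg p (csize c) r *: diff1 r (z p) c.
Proof.
move=> h1 h2 r; rewrite tdiffE -/r.
have -> : diff_int (r - 1) (z p.+1) c = 0.
  apply/lin_eq0/diff_int_lin => d sd; apply/zero_lin/h1.
  by rewrite sd.
have -> : tdiff2 (csize c) r z c = 0.
  apply/lin_eq0/tdiff2_lin => p' X' Y' d hp sd; apply/zero_lin/h2 => //.
  by move: sd; rewrite addSn => -[].
by rewrite scaler0 add0r !addr0.
Qed.

Lemma is_TC_cok m (z : tcochain) : is_TC m z ->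
  forall p q, cok q (m - p%:Z - q%:Z) (z p).
Proof.
case=> h1 h2 h3 _ p q; split; first exact/mlinearP/h1.
  exact/idreducedP/h2.
by move=> X Y c <-.
Qed.

(** Degrees and signs depend on the size of the chain, so each q may have its own witness;
    multilinearity and reducedness concern one size at a time. *)
Lemma cok_is_TC m (z : tcochain) :
  (forall p q, exists2 psi : cochain p, cok q (m - p%:Z - q%:Z) psi &
     forall X Y (c : chain X Y), csize c = q -> z p X Y c = psi X Y c) ->
  (exists N : nat, forall p (X Y : 'I_p.+1 -> ob) (c : chain X Y),
    (N < p + csize c)%N -> z p X Y c = 0) ->
  is_TC m z.
Proof.
move=> h fin; split=> //.
- move=> p; apply/mlinearP => j a X Y c c1 c2 hl.
  have [psi ok e] := h p (csize c); have [s1 s2] := lin3_csize hl.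
  by rewrite !e // (cok_mlin ok hl).
- move=> p; apply/idreducedP => X Y c hc.
  by have [psi ok e] := h p (csize c); rewrite e //; exact: (cok_id ok).
move=> p X Y c; have [psi ok e] := h p (csize c).
by rewrite e //; exact: (cok_deg ok).
Qed.

Lemma is_TC_tdiff m (z : tcochain) : is_TC m z -> is_TC (m + 1) (tdiff sg m z).
Proof.
move=> hz; have ok := is_TC_cok hz; apply: cok_is_TC => [p q|].
  pose r := m + 1 - p%:Z - q%:Z.
  exists (fun X Y c => (-1) ^+ sgn_int sg p q (r - 1) *: diff_int (r - 1) (z p) c
    + (if q is _.+1 then (-1) ^+ sgn0 sg p q.-1 r *: diff0 r (z p) c else 0)
    + tdiff1 q r z c + tdiff2 q r z c); last first.
    move=> X Y c sc; rewrite tdiffE /r -sc {sc}; case: c => [X1|X1 Z Y1 F c]; last by [].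
    by rewrite [diff0 _ _ _]/= scaler0.
  (* d_0, d_1 and the path terms take their input in total arity p + q - 1, and all bidegrees there
     have the same internal degree [r]. *)
  have rE p' q' : (p' + q').+1%N = (p + q)%N -> r = m - p'%:Z - q'%:Z.
    move=> /(congr1 Posz); rewrite -addn1 !PoszD => e.
    by rewrite /r -[_ - _ - _]addrA -opprD -e; ring.
  apply: cok_add; first apply: cok_add; first apply: cok_add.
  - apply: cok_scale.
    have r1 : r - 1 = m - p%:Z - q%:Z by rewrite /r (addrAC m) (addrAC (m - _)) addrK.
    by have := diff_int_ok (ok p q); rewrite -r1 subrK.
  - case: q @r rE => [|q] r rE; first exact: cok_zero.
    by apply/cok_scale/diff0_ok; have := ok p q; rewrite -(rE p q) // addnS.
  - case: p @r rE => [|p] r rE; first exact: cok_zero.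
    by apply/cok_scale/diff1_ok; have := ok p q; rewrite -(rE p q).
  apply: (@cok_sum _ _ _ _ _ _ _ _ (fun i => fun X Y c =>
    \sum_(0 <= j < (p - i).+1%N) \sum_(P <- adm_prod (adm_A i.-1) (adm_I q))
        (-1) ^+ sgn_path sg (p - i)%N (q + i.-1)%N r i j P *:
          @diff_path _ _ _ p i (z (p - i)%N) j P X Y c)) => i.
  rewrite mem_index_iota ltnS => /andP[i2 ip].
  apply: (@cok_sum _ _ _ _ _ _ _ _ (fun j => fun X Y c =>
    \sum_(P <- adm_prod (adm_A i.-1) (adm_I q))
        (-1) ^+ sgn_path sg (p - i)%N (q + i.-1)%N r i j P *:
          @diff_path _ _ _ p i (z (p - i)%N) j P X Y c)) => j.
  rewrite mem_index_iota ltnS /= => jp.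
  apply: cok_sum => P hP; apply: cok_scale; have [lP cP] := adm_path hP.
  apply: (@diff_path_ok _ _ _ _ _ _ _ _ q (q + i.-1)) => //.
  - by move=> x /lP; rewrite prednK // ltnW.
  - by rewrite cP.
  have := ok (p - i)%N (q + i.-1)%N; rewrite -rE //.
  by rewrite -!addnS prednK ?(ltnW i2) // addnCA subnK // addnC.
case: hz => _ _ _ [N hN]; exists N.+1 => p X Y c hc.
apply/lin_eq0/tdiff_lin => p' X' Y' d _ h; apply/zero_lin/hN.
by case: h => [->|h]; [exact: ltnW|rewrite -ltnS h].
Qed.

Lemma tdiff_add m (z w : tcochain) p X Y (c : @chain k n fg p X Y) :
  tdiff sg m (fun p X Y c => z p X Y c + w p X Y c) c = tdiff sg m z c + tdiff sg m w c.
Proof.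
rewrite (@tdiff_lin 1 _ _ z w) ?scale1r // => p' X' Y' d _ _.
by rewrite scale1r.
Qed.

Definition single p0 q0 (phi : cochain p0) : tcochain := fun p =>
  match p0 =P p with
  | ReflectT e => fun X Y c =>
      if csize c == q0 then ecast p (cochain p) e phi X Y c else 0
  | ReflectF _ => fun X Y c => 0
  end.

Lemma singleE p q (phi : cochain p) X Y (c : @chain k n fg p X Y) :
  single q phi c = if csize c == q then phi X Y c else 0.
Proof. by rewrite /single; case: eqP => // e; rewrite eq_axiomK. Qed.

Lemma single_size p q (phi : cochain p) X Y (c : @chain k n fg p X Y) :
  csize c = q -> single q phi c = phi X Y c.
Proof. by rewrite singleE => ->; rewrite eqxx. Qed.

Lemma single0 p0 q0 (phi : cochain p0) p X Y (c : @chain k n fg p X Y) :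
  ~ (p = p0 /\ csize c = q0) -> single q0 phi c = 0.
Proof.
move=> h; rewrite /single; case: eqP => // e; subst p; case: eqP => // sc.
by case: h.
Qed.

Lemma single_TC m p q (phi : cochain p) :
  cok q (m - p%:Z - q%:Z) phi -> is_TC m (single q phi).
Proof.
move=> ok; apply: cok_is_TC => [p' q'|].
  have [e|hn] := pselect (p' = p /\ q' = q).
    by case: e => -> ->; exists phi => // X Y c; exact: single_size.
  exists (fun X Y c => 0); first exact: cok_zero.
  by move=> X Y c sc; apply: single0; rewrite sc.
exists (p + q)%N => p' X Y c h; apply: single0 => -[e1 e2].
by subst p'; move: h; rewrite e2 ltnn.
Qed.

Lemma tdiff_single_low m p q (phi : cochain p) p' X Y (c : @chain k n fg p' X Y) :
  (p' < p)%N || ((p + q).+1 < p' + csize c)%N -> tdiff sg m (single q phi) c = 0.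
Proof.
move=> h; apply/lin_eq0/tdiff_lin => p1 X1 Y1 d lp hs; apply/zero_lin.
apply: single0 => -[e1 e2]; subst p1; case/orP: h => h.
  by move: (leq_ltn_trans lp h); rewrite ltnn.
by move: h; rewrite e2 in hs; case: hs => <-; rewrite ?ltnn // ltnNge leqnSn.
Qed.

Lemma tdiff_single0 m p q (phi : cochain p) X Y (c : @chain k n fg p X Y) :
  csize c = q.+1 -> let r := m - p%:Z - q%:Z in
  tdiff sg m (single q phi) c = (-1) ^+ sgn0 sg p q r *: diff0 r phi c.
Proof.
move=> sc r; rewrite tdiff_lead0.
- have -> : m + 1 - p%:Z - (csize c)%:Z = r by rewrite sc /r -addn1 PoszD !opprD; ring.
  rewrite sc /=; congr (_ *: _).
  rewrite (@diff0_scale _ _ 1 _ phi) ?scale1r // => X1 Y1 d.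
  by rewrite sc => -[sd]; rewrite scale1r single_size.
- move=> p' X1 Y1 d h; apply: single0 => -[e1 e2]; subst p'.
  by move/eqP: h; rewrite e2 sc addnS ltn_eqF.
by move=> p' X1 Y1 d h _; apply: single0 => -[e _]; rewrite e ltnn in h.
Qed.

Lemma tdiff_single1 m p q (phi : cochain p) X Y (c : @chain k n fg p.+1 X Y) :
  csize c = q -> let r := m - p%:Z - q%:Z in
  tdiff sg m (single q phi) c = (-1) ^+ sgn1 sg p q r *: diff1 r phi c.
Proof.
move=> sc r; rewrite tdiff_lead1.
- have -> : m + 1 - p.+1%:Z - (csize c)%:Z = r.
    by rewrite sc /r -addn1 PoszD !opprD; ring.
  have -> : diff0 r (single q phi (p := p.+1)) c = 0.
    apply/lin_eq0/diff0_lin => X1 Y1 d _; apply/zero_lin/single0 => -[e _].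
    by move/eqP: e; rewrite eqn_leq ltnn.
  rewrite scaler0 add0r sc; congr (_ *: _).
  pose o : cochain p := fun X Y c => 0.
  have h0 X1 Y1 (d : chain X1 Y1) : csize d = csize c ->
      single q phi (p := p) d = 1 *: phi _ _ d + o _ _ d.
    by rewrite sc => sd; rewrite single_size // scale1r addr0.
  rewrite (diff1_lin r h0) scale1r -[RHS]addr0; congr (_ + _).
  by apply/lin_eq0/diff1_lin => X1 Y1 d _; apply/zero_lin.
- move=> p' X1 Y1 d h; apply: single0 => -[e1 e2]; subst p'.
  by move/eqP: h; rewrite e2 sc addSn ltn_eqF.
by move=> p' X1 Y1 d h _; apply: single0 => -[e _]; rewrite e ltnn in h.
Qed.

Hypothesis d_sq0 : @tdiff_sq0 k n fg sg.

Lemma sign_neq0 (b : bool) : (-1) ^+ b != 0 :> k.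
Proof. by rewrite signr_eq0. Qed.

(** The component of d^2 at (p, q + 2), for a cochain concentrated in (p, q): the total arity rises
    by two while p stays, so d_0 has acted twice. The signs are non-zero factors. *)
Lemma diff0_diff0 p q r (phi : cochain p) : cok q r phi ->
  forall X Y (c : chain X Y), csize c = q.+2 -> diff0 r (diff0 r phi) c = 0.
Proof.
move=> ok X Y c sc; pose m := r + p%:Z + q%:Z.
have em : m - p%:Z - q%:Z = r by rewrite /m addrAC addrK addrK.
have hz : is_TC m (single q phi) by apply: single_TC; rewrite em.
have := d_sq0 hz c; rewrite tdiff_lead0.
- have -> : m + 1 + 1 - p%:Z - (csize c)%:Z = r.
    by rewrite sc -addn2 PoszD -em !opprD; ring.
  move=> /eqP; rewrite scaler_eq0 (negPf (sign_neq0 _)) /=.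
  rewrite (@diff0_scale _ _ ((-1) ^+ sgn0 sg p q r) _ (diff0 r phi)).
    by rewrite scaler_eq0 (negPf (sign_neq0 _)) /= => /eqP.
  by move=> X' Y' d; rewrite sc => -[sd]; rewrite tdiff_single0 // em.
- move=> p' X' Y' d h; apply: tdiff_single_low.
  by rewrite h sc !addnS ltnSn orbT.
by move=> p' X' Y' d h _; apply: tdiff_single_low; rewrite h.
Qed.

(** At (p + 1, q + 1) only d_0 d_1 and d_1 d_0 contribute to d^2, and the second is zero on a
    d_0-cocycle. *)
Lemma diff0_diff1 p q r (phi : cochain p) : cok q r phi ->
  (forall X Y (c : chain X Y), csize c = q.+1 -> diff0 r phi c = 0) ->
  forall X Y (c : chain X Y), csize c = q.+1 -> diff0 r (diff1 r phi) c = 0.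
Proof.
move=> ok dphi X Y c sc; pose m := r + p%:Z + q%:Z.
have em : m - p%:Z - q%:Z = r by rewrite /m addrAC addrK addrK.
have hz : is_TC m (single q phi) by apply: single_TC; rewrite em.
have := d_sq0 hz c; rewrite tdiff_lead1.
- have -> : m + 1 + 1 - p.+1%:Z - (csize c)%:Z = r.
    by rewrite sc -addn1 -(addn1 q) !PoszD -em !opprD; ring.
  have -> : diff1 r (tdiff sg m (single q phi) (p := p)) c = 0.
    apply/lin_eq0/diff1_lin => X' Y' d; rewrite sc => sd; apply/zero_lin.
    by rewrite tdiff_single0 // em dphi // scaler0.
  rewrite scaler0 addr0 => /eqP; rewrite scaler_eq0 (negPf (sign_neq0 _)) /=.
  rewrite (@diff0_scale _ _ ((-1) ^+ sgn1 sg p q r) _ (diff1 r phi)).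
    by rewrite scaler_eq0 (negPf (sign_neq0 _)) /= => /eqP.
  by move=> X' Y' d; rewrite sc => -[sd]; rewrite tdiff_single1 // em.
- move=> p' X' Y' d h; apply: tdiff_single_low.
  by rewrite h sc addSn addnS ltnSn orbT.
by move=> p' X' Y' d h _; apply: tdiff_single_low; rewrite h.
Qed.

End Signs.
End TotalDifferential.

(** * Values of [d_1] on pure tensors *)

Section CanonicalIsos.
Context {k : fieldType} {n : nat} {fg : bool}.
Local Notation ob := (ob k n fg).

Lemma gcast_refl (X : ob) v x : gcast X X v x = x.
Proof.
rewrite /gcast; case: pselect => // e.
by rewrite (Prop_irrelevance e (erefl X)).
Qed.

(* Elements of objects that are equal, but not definitionally, are compared as
   pointed objects. *)
Definition pointed (v : vertex) : Type := {A : ob & ov A v}.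

Lemma gcast_pointed v (A B : ob) (a : ov A v) (b : ov B v) :
  existT (fun A => ov A v : Type) A a = existT _ B b -> gcast A B v a = b.
Proof.
pose K (s t : pointed v) := gcast (projT1 s) (projT1 t) v (projT2 s) = projT2 t.
move=> e; rewrite -[gcast _ _ _ _ = _]/(K (existT _ A a) (existT _ B b)) -e.
exact: gcast_refl.
Qed.

Definition ptens v (s t : pointed v) : pointed v :=
  existT _ (otens (projT1 s) (projT1 t)) (tmk (projT2 s) (projT2 t)).

Section Words.
Variables (J : Type) (X : J -> ob) (v : vertex) (xi : forall j, ov (X j) v).

Definition plf j : pointed v := existT _ (X j) (xi j).
Definition ppt (t : tree J) : pointed v := existT _ (tev t X) (pt t xi).

Fixpoint lpt (A : ob) (a : ov A v) (t : tree J) {struct t} : ov (lpush X A t) v :=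
  match t return ov (lpush X A t) v with
  | Lf j => (tmk a (xi j) : ov (otens A (X j)) v)
  | Nd l r => lpt (lpt a l) r
  end.

Fixpoint lnpt (t : tree J) : ov (lnorm X t) v :=
  match t return ov (lnorm X t) v with Lf j => xi j | Nd l r => lpt (lnpt l) r end.

Lemma push_pt A (a : ov A v) t :
  push X A t v (tmk a (pt t xi) : ov (otens A (tev t X)) v) = lpt a t.
Proof.
elim: t A a => // l hl r hr A a.
rewrite -[RHS]/(lpt (lpt a l) r) -hr -hl.
rewrite [LHS]/= -[tassoc_inv _]/(cassoc_inv _ _ _ _) cassoc_invE.
congr (push X _ r v _).
rewrite -[LHS]/(htens (deg (gid (tev r X))) (push X A l) (gid (tev r X)) v
  (tmk (tmk a (pt l xi) : ov (otens A (tev l X)) v) (pt r xi))).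
by rewrite htensE kpar0.
Qed.

Lemma pull_pt A (a : ov A v) t :
  pull X A t v (lpt a t) = (tmk a (pt t xi) : ov (otens A (tev t X)) v).
Proof.
elim: t A a => // l hl r hr A a.
rewrite -[LHS]/(hassoc A (tev l X) (tev r X) v
  (htens (deg (gid (tev r X))) (pull X A l) (gid (tev r X)) v
     (pull X (lpush X A l) r v (lpt (lpt a l) r)))).
by rewrite hr htensE kpar0 hl; exact: tassocE.
Qed.

Lemma to_lnorm_pt t : to_lnorm X t v (pt t xi) = lnpt t.
Proof.
elim: t => // l hl r _.
rewrite -[LHS]/(push X (lnorm X l) r v
  (htens (deg (gid (tev r X))) (to_lnorm X l) (gid (tev r X)) v
     (tmk (pt l xi) (pt r xi)))).
by rewrite htensE kpar0 hl; exact: push_pt.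
Qed.

Lemma of_lnorm_pt t : of_lnorm X t v (lnpt t) = pt t xi.
Proof.
elim: t => // l hl r _.
rewrite -[LHS]/(htens (deg (gid (tev r X))) (of_lnorm X l) (gid (tev r X)) v
  (pull X (lnorm X l) r v (lpt (lnpt l) r))).
by rewrite pull_pt htensE kpar0 hl.
Qed.

Lemma lpt_foldl A (a : ov A v) t :
  existT (fun A => ov A v : Type) (lpush X A t) (lpt a t) =
  foldl (fun s j => ptens s (plf j)) (existT _ A a) (leaves t).
Proof. by elim: t A a => // l hl r hr A a; rewrite [RHS]foldl_cat -hl -hr. Qed.

(** The left-normed tensor depends on the word only, as object and element together. A tree always
    has a leaf, but its list of leaves does not show this, hence the option type. *)
Lemma lnpt_foldl t :
  Some (existT (fun A => ov A v : Type) (lnorm X t) (lnpt t)) =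
  if leaves t is j :: s then Some (foldl (fun s j => ptens s (plf j)) (plf j) s)
  else None.
Proof.
elim: t => // l hl r _; rewrite [leaves _]/=.
case: (leaves l) hl => // j s [e]; rewrite cat_cons foldl_cat -e.
by rewrite -lpt_foldl.
Qed.

(** Both bracketings have the same left-normed tensor because their words agree, and the two halves
    of [can] send pure tensors to pure tensors without sign. *)
Lemma can_pt (s t : tree J) : leaves s = leaves t ->
  can X s t v (pt s xi) = pt t xi.
Proof.
move=> e; rewrite -[LHS]/(of_lnorm X t v (gcast (lnorm X s) (lnorm X t) v
  (to_lnorm X s v (pt s xi)))) to_lnorm_pt.
rewrite (gcast_pointed (b := lnpt t)) ?of_lnorm_pt //.
by have := lnpt_foldl s; rewrite e -lnpt_foldl => -[].
Qed.

End Words.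

Lemma ppt_tbind (J J' : Type) (X : J -> ob) v (xi : forall j, ov (X j) v)
    (t : tree J') (T : J' -> tree J) :
  ppt xi (tbind t T) = ppt (X := tevs T X) (fun l => pt (T l) xi) t.
Proof.
elim: t => // l hl r hr.
by rewrite -[LHS]/(ptens (ppt xi (tbind l T)) (ppt xi (tbind r T))) hl hr.
Qed.

Section Rebracket.
Variables (p : nat) (X Y : 'I_p.+1 -> ob) (s t : tree 'I_p.+1) (A B : ob) (v : vertex).

(** The part of [rebracket] that comes after the map. It is kept apart as a linear map because
    values of cochains are only sums of pure tensors. *)
Definition reb_out (b : ov B v) : ov (lprod Y) v :=
  can Y t (ltree p) v (gcast B (tev t Y) v b).

Lemma reb_outD b b' : reb_out (b + b') = reb_out b + reb_out b'.
Proof. by rewrite /reb_out !hvD. Qed.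
Lemma reb_outZ c b : reb_out (c *: b) = c *: reb_out b.
Proof. by rewrite /reb_out !hvZ. Qed.
Lemma reb_out_sum I (r : seq I) (F : I -> ov B v) :
  reb_out (\sum_(i <- r) F i) = \sum_(i <- r) reb_out (F i).
Proof. by rewrite /reb_out !hv_sum. Qed.

Lemma rebracket_pt (f : hom A B) (xi : forall j, ov (X j) v) (a : ov A v) :
  leaves s = leaves (ltree p) -> ppt xi s = existT _ A a ->
  rebracket X Y s t f v (pt (ltree p) xi) = reb_out (f v a).
Proof.
move=> e h; rewrite -[LHS]/(reb_out (f v (gcast (tev s X) A v
  (can X (ltree p) s v (pt (ltree p) xi))))) can_pt //.
by rewrite (gcast_pointed (b := a)).
Qed.

Lemma reb_out_pt (eta : forall j, ov (Y j) v) (b : ov B v) :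
  leaves t = leaves (ltree p) -> ppt eta t = existT _ B b ->
  reb_out b = pt (ltree p) eta.
Proof.
by move=> e h; rewrite /reb_out (gcast_pointed (b := pt t eta)) ?can_pt.
Qed.

End Rebracket.

Section FirstDifferentialPure.
Variables (p : nat) (r : int) (phi : @cochain k n fg p).
Variables (X Y : 'I_p.+2 -> ob) (c : chain X Y) (v : vertex).
Variables (xi : forall j, ov (X j) v).

Definition out_left :=
  @reb_out p.+1 Y (Nd (Lf ord0) (tbind (ltree p) (drop_row ord0)))
    (otens (Y ord0) (lprod (tevs (drop_row ord0) Y))) v.
Definition out_right :=
  @reb_out p.+1 Y (Nd (tbind (ltree p) (drop_row ord_max)) (Lf ord_max))
    (otens (lprod (tevs (drop_row ord_max) Y)) (Y ord_max)) v.
Definition out_mid i :=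
  @reb_out p.+1 Y (tbind (ltree p) (@block p.+1 p 1 i (rcomb 0 1)))
    (lprod (tevs (@block p.+1 p 1 i (rcomb 0 1)) Y)) v.
Arguments out_mid i b : clear implicits.

Lemma leaves_left :
  leaves (Nd (Lf ord0) (tbind (ltree p) (drop_row (ord0 : 'I_p.+2)))) = leaves (ltree p.+1).
Proof.
rewrite !leaves_ltree enum_ordSl /= leaves_tbind leaves_ltree.
by rewrite flatten_map1.
Qed.

Lemma leaves_right :
  leaves (Nd (tbind (ltree p) (drop_row (ord_max : 'I_p.+2))) (Lf ord_max)) =
  leaves (ltree p.+1).
Proof.
rewrite !leaves_ltree enum_ordSr /= leaves_tbind leaves_ltree flatten_map1.
rewrite -cats1; congr (_ ++ _); apply: eq_map => l; apply: val_inj.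
by rewrite /= /bump leqNgt ltn_ord.
Qed.

Lemma leaves_mid i : (i <= p)%N ->
  leaves (tbind (ltree p) (@block p.+1 p 1 i (rcomb 0 1))) = leaves (ltree p.+1).
Proof.
by move=> ip; rewrite leaves_tbind !leaves_ltree; apply: good_block; rewrite ?addn1.
Qed.

Lemma diff1_left_pt :
  r * deg (crow ord0 c) + kleft ord0 c = 0 -> r + cdeg (cmap (drop_row ord0) c) = 0 ->
  diff1_left r phi c v (pt (ltree p.+1) xi) =
  out_left (tmk (crow ord0 c v (xi ord0))
    (phi (cmap (drop_row ord0) c) v (pt (ltree p) (fun l => xi (lift ord0 l))))).
Proof.
move=> h1 h2; pose T := drop_row (ord0 : 'I_p.+2).
pose t := Nd (Lf ord0) (tbind (ltree p) T).
rewrite -[LHS]/((-1) ^ (r * deg (crow ord0 c) + kleft ord0 c) *: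
  rebracket X Y t t (htens (r + cdeg (cmap T c)) (crow ord0 c) (phi (cmap T c))) v
    (pt (ltree p.+1) xi)) h1 h2 expr0z scale1r.
rewrite (@rebracket_pt _ _ _ _ _ _ _ _ _ xi
  (tmk (xi ord0) (pt (ltree p) (fun l => xi (lift ord0 l))) :
     ov (otens (X ord0) (lprod (tevs (drop_row ord0) X))) v)).
- by rewrite htensE kpar0.
- exact: leaves_left.
by rewrite -[LHS]/(ptens (plf xi ord0) (ppt xi (tbind (ltree p) (drop_row ord0)))) ppt_tbind.
Qed.

Lemma diff1_right_pt :
  kright ord_max c = 0 -> deg (crow ord_max c) = 0 ->
  diff1_right phi c v (pt (ltree p.+1) xi) =
  (-1) ^+ p *: out_right (tmk
    (phi (cmap (drop_row ord_max) c) v (pt (ltree p) (fun l => xi (lift ord_max l))))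
    (crow ord_max c v (xi ord_max))).
Proof.
move=> h1 h2; pose T := drop_row (ord_max : 'I_p.+2).
pose t := Nd (tbind (ltree p) T) (Lf ord_max).
rewrite -[LHS]/(((-1) ^+ p * (-1) ^ (kright ord_max c)) *:
  rebracket X Y t t (htens (deg (crow ord_max c)) (phi (cmap T c)) (crow ord_max c)) v
    (pt (ltree p.+1) xi)) h1 h2 expr0z mulr1; congr (_ *: _).
rewrite (@rebracket_pt _ _ _ _ _ _ _ _ _ xi
  (tmk (pt (ltree p) (fun l => xi (lift ord_max l))) (xi ord_max) :
     ov (otens (lprod (tevs (drop_row ord_max) X)) (X ord_max)) v)).
- by rewrite htensE kpar0.
- exact: leaves_right.
by rewrite -[LHS]/(ptens (ppt xi (tbind (ltree p) (drop_row ord_max))) (plf xi ord_max)) ppt_tbind.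
Qed.

Lemma diff1_mid_pt i : (i <= p)%N ->
  diff1_mid phi i c v (pt (ltree p.+1) xi) =
  out_mid i (phi (cmap (@block p.+1 p 1 i (rcomb 0 1)) c) v
    (pt (ltree p) (fun l => pt (@block p.+1 p 1 i (rcomb 0 1) l) xi))).
Proof.
move=> ip; rewrite /diff1_mid.
rewrite (@rebracket_pt _ _ _ _ _ _ _ _ _ xi
  (pt (ltree p) (fun l => pt (@block p.+1 p 1 i (rcomb 0 1) l) xi) :
     ov (lprod (tevs (@block p.+1 p 1 i (rcomb 0 1)) X)) v)) //.
  exact: leaves_mid.
exact: ppt_tbind.
Qed.

Lemma out_left_pt (eta : forall j, ov (Y j) v) :
  out_left (tmk (eta ord0) (pt (ltree p) (fun l => eta (lift ord0 l)))) =
  pt (ltree p.+1) eta.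
Proof.
apply: reb_out_pt; first exact: leaves_left.
by rewrite -[LHS]/(ptens (plf eta ord0) (ppt eta (tbind (ltree p) (drop_row ord0)))) ppt_tbind.
Qed.

Lemma out_right_pt (eta : forall j, ov (Y j) v) :
  out_right (tmk (pt (ltree p) (fun l => eta (lift ord_max l))) (eta ord_max)) =
  pt (ltree p.+1) eta.
Proof.
apply: reb_out_pt; first exact: leaves_right.
by rewrite -[LHS]/(ptens (ppt eta (tbind (ltree p) (drop_row ord_max))) (plf eta ord_max)) ppt_tbind.
Qed.

Lemma out_mid_pt i (eta : forall j, ov (Y j) v) : (i <= p)%N ->
  out_mid i (pt (ltree p) (fun l => pt (@block p.+1 p 1 i (rcomb 0 1) l) eta)) =
  pt (ltree p.+1) eta.
Proof.
by move=> ip; apply: reb_out_pt; [exact: leaves_mid|exact: ppt_tbind].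
Qed.

End FirstDifferentialPure.
#[global] Arguments out_mid {p Y v} i b.
End CanonicalIsos.

(** * Cocycles of low degree *)

Section Generators.
Context {k : fieldType} {n : nat} {fg : bool}.
Local Notation ob := (ob k n fg).
Local Notation cochain := (@cochain k n fg).
Local Notation gen p v := (@ugen k n fg p v).

Lemma ishom_sum (X : cplx k) d I (s : seq I) (F : I -> X) :
  (forall i, ishom d (F i)) -> ishom d (\sum_(i <- s) F i).
Proof. by move=> h; rewrite /ishom linear_sum; apply: eq_bigr => i _; exact: h. Qed.

Lemma ishom_tev_pob (J : Type) (t : tree J) v w (x : ov (tev t (fun _ : J => @pob k n fg v)) w) :
  ishom 0 x.
Proof.
elim: t x => [j|l hl r hr] x; first exact: ishom_pob.
have [s ->] := tspan x; apply: (@ishom_sum (ov (tev (Nd l r) _) w)) => yz.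
by rewrite -[0]addr0; exact: ishom_tens.
Qed.

(** Tensor powers of the P_w are concentrated in degree 0. So obstructions in low arity can occur
    only in internal degree 0. *)
Lemma gen_value0 p q r (x : cochain p) v w (c : chain (fun=> pob v) (fun=> pob w)) :
  cok q r x -> csize c = q -> cdeg c = 0 -> r != 0 -> x _ _ c v (gen p v) = 0.
Proof.
move=> ok sc dc r0; have := cok_deg ok sc 0 (gen p v).
rewrite (ishom_ugen v) dc addr0 add0r => ->.
by rewrite (ishomE _ (ishom_tev_pob _)) (negPf r0).
Qed.

Section DegreeZero.
Variables (p : nat) (r : int) (x : cochain p).
Hypothesis dx : forall X Y (c : chain X Y), csize c = 1%N -> diff0 r x c = 0.

Lemma diff0_natural X Y (F : fam X Y) v t :
  x (cnil Y) v (lprodm F v t) = (-1) ^ (r * fdeg F) *: lprodm F v (x (cnil X) v t).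
Proof.
have := diff0E r x (ccons F (cnil Y)) t; rewrite dx // vdiff0E msum1 addr0 expr1.
by rewrite scaleN1r => /esym/eqP; rewrite subr_eq0 => /eqP.
Qed.

(** By naturality, an arity 0 cocycle is determined by its values at the generators. *)
Lemma diff0_natural_eq0 : (forall v, x (cnil (fun=> pob v)) v (gen p v) = 0) ->
  forall X Y (c : chain X Y), csize c = 0%N -> x c = 0.
Proof.
move=> h X Y [X1|//] _; apply: homP => v; apply: (@lprod_ext _ _ _ _ v).
- exact: hv_linear.
- exact: (hv_linear (0 : hom (lprod X1) (lprod X1))).
by move=> F; rewrite diff0_natural h hv0 scaler0.
Qed.

End DegreeZero.

(** The iterated comultiplication of P_v for the vertexwise tensor product. It is compatible with
    the arrows, so the basis vectors of P_1 at e2 are grouplike: this is the coalgebra of the cobar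
    complex. *)
Definition diag (J J' : Type) (T : J -> tree J') v :
    fam (fun _ : J => @pob k n fg v) (tevs T (fun=> pob v)) :=
  fun l => prep 0 (pt (T l) (fun=> pgen v)).

Lemma diagE (J J' : Type) (T : J -> tree J') v l :
  diag T v l v (pgen v) = pt (T l) (fun=> pgen v).
Proof. by rewrite prepE; exact: ishom0_pt. Qed.

Lemma lprodm_diag p (J' : Type) (T : 'I_p.+1 -> tree J') v :
  lprodm (diag T v) v (gen p v) = pt (ltree p) (fun l => pt (T l) (fun=> pgen v)).
Proof.
rewrite /lprodm /ugen tevm_pt0 //.
by apply: eq_pt; apply: functional_extensionality_dep => l; exact: diagE.
Qed.

Lemma gen_span p v (t : ov (lprod (fun _ : 'I_p.+1 => @pob k n fg v)) v) :
  exists c, t = c *: gen p v.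
Proof. by apply: pt_span => j x; exact: pgen_span. Qed.

Lemma gen2_span p (J' : Type) (T : 'I_p.+1 -> tree J') v
    (t : ov (lprod (tevs T (fun=> @pob k n fg v))) v) :
  exists c, t = c *: pt (ltree p) (fun l => pt (T l) (fun=> pgen v)).
Proof.
apply: pt_span => l x; apply: pt_span => j y; exact: pgen_span.
Qed.

(* Each of the p + 3 terms of d_1 acts by lam. *)
Lemma diff1_scalar p (x : cochain p) v lam :
  (forall X Y (c : chain X Y), csize c = 1%N -> diff0 0 x c = 0) ->
  x _ _ (cnil (fun=> pob v)) v (gen p v) = lam *: gen p v ->
  diff1 0 x (cnil (fun=> pob v)) v (gen p.+1 v) =
  (1 + \sum_(i < p.+1) (-1) ^+ i.+1 + (-1) ^+ p) *: (lam *: gen p.+1 v).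
Proof.
move=> dx hx; rewrite diff1E !homDE hom_sumE !scalerDl scale1r.
congr (_ + _ + _).
- rewrite diff1_left_pt ?mul0r //.
  have -> : x _ _ (cmap (drop_row ord0) (cnil (fun=> pob v))) v
      (pt (ltree p) (fun=> pgen v)) = lam *: gen p v by exact: hx.
  rewrite tmkZr /out_left reb_outZ; congr (_ *: _).
  exact: (@out_left_pt k n fg p (fun=> pob v) v (fun=> pgen v)).
- rewrite scaler_suml; apply: eq_bigr => i _; rewrite homZE diff1_mid_pt; last first.
    by rewrite -ltnS.
  congr (_ *: _); rewrite [cmap _ _]/= -lprodm_diag (diff0_natural dx).
  rewrite mul0r expr0z scale1r hx hvZ lprodm_diag /out_mid reb_outZ; congr (_ *: _).
  by apply: out_mid_pt; rewrite -ltnS.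
rewrite diff1_right_pt; try by [].
congr (_ *: _).
have -> : x _ _ (cmap (drop_row ord_max) (cnil (fun=> pob v))) v
    (pt (ltree p) (fun=> pgen v)) = lam *: gen p v by exact: hx.
rewrite tmkZl /out_right reb_outZ; congr (_ *: _).
exact: (@out_right_pt k n fg p (fun=> pob v) v (fun=> pgen v)).
Qed.

(** Naturality along [eps a] multiplies the same vector, the image of the generator under the arrow,
    by both scalars, and this pure tensor of basis vectors is non-zero. *)
Lemma pob_scalar_eq p (x : cochain p) (lam : vertex -> k) (a : 'I_n) :
  (forall X Y (c : chain X Y), csize c = 1%N -> diff0 0 x c = 0) ->
  (forall v, x _ _ (cnil (fun=> pob v)) v (gen p v) = lam v *: gen p v) -> lam e1 = lam e2.
Proof.
move=> dx hx.
have : x _ _ (cnil (fun=> pob e1)) e2 (lprodm (eps a) e2 (gen p e2)) =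
    lam e1 *: lprodm (eps a) e2 (gen p e2).
  by rewrite epsE hv_act hx linearZ.
rewrite (diff0_natural dx) mul0r expr0z scale1r hx hvZ => /eqP.
rewrite -subr_eq0 -scalerBl scaler_eq0 subr_eq0 => /orP[/eqP -> //|].
rewrite epsE /ugen oact_pt => /eqP e0.
have [f hf] : exists f : {linear ov (lprod (fun _ : 'I_p.+1 => @pob k n fg e1)) e2 -> k^o},
    f (pt (ltree p) (fun=> pbas a)) = 1.
  by apply: (@pt_form k n fg _ _ _ _ _ (fun=> pcoord a)) => j; rewrite pcoordE eqxx.
by move: hf; rewrite e0 linear0 => /eqP; rewrite eq_sym oner_eq0.
Qed.

(** The p + 3 signs of d_1 alternate, starting from +1. So d_1 multiplies scalars by 1 for even p
    and kills them for odd p. *)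
Lemma signs_sum p : 1 + \sum_(i < p.+1) (-1) ^+ i.+1 + (-1) ^+ p = (~~ odd p)%:R :> k.
Proof.
elim: p => [|p ih]; first by rewrite big_ord1 expr1 expr0 subrr add0r.
have {ih} e : 1 + \sum_(i < p.+1) (-1) ^+ i.+1 = (~~ odd p)%:R - (-1) ^+ p :> k.
  by rewrite -ih addrK.
rewrite big_ord_recr /= addrA e -signr_odd !exprS -(signr_odd _ p).
by case: (odd p); rewrite ?expr0 ?expr1 /=; ring.
Qed.

End Generators.

(** * The obstruction tensors in arity 1 *)

Section DegreeOne.
Context {k : fieldType} {n : nat} {fg : bool}.
Local Notation ob := (ob k n fg).
Local Notation cochain := (@cochain k n fg).
Local Notation gen p v := (@ugen k n fg p v).
Local Notation P p v := (fun _ : 'I_p.+1 => @pob k n fg v).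

Lemma eq_pt_in (J : eqType) (t : tree J) (X : J -> ob) v (xi eta : forall j, ov (X j) v) :
  (forall j, j \in leaves t -> xi j = eta j) -> pt t xi = pt t eta.
Proof.
elim: t => [j|l hl r hr] h /=; first by apply: h; rewrite inE.
by rewrite hl ?hr // => j jt; apply: h; rewrite /= mem_cat jt ?orbT.
Qed.

(* The tensor e_(b 0) ⊗ ... ⊗ e_(b p) in (k^n)^(⊗ p+1) = (P_1 ⊗ ... ⊗ P_1)(e2) *)
Definition bten p (b : nat -> 'I_n) : ov (lprod (P p e1)) e2 :=
  pt (ltree p) (fun j => pbas (b j)).

Lemma bten_const p a : bten p (fun=> a) = oact (lprod (P p e1)) a (gen p e1).
Proof. by rewrite /ugen oact_pt. Qed.

Lemma eq_bten p b b' : (forall j, (j <= p)%N -> b j = b' j) -> bten p b = bten p b'.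
Proof.
move=> h; apply: eq_pt; apply: functional_extensionality_dep => j.
by rewrite h // -ltnS.
Qed.

Definition lcomb_bten p (s : seq (k * (nat -> 'I_n))) : ov (lprod (P p e1)) e2 :=
  \sum_(x <- s) x.1 *: bten p x.2.

Lemma bten_span p (t : ov (lprod (P p e1)) e2) : exists s, t = lcomb_bten p s.
Proof.
suff h m : (m <= p)%N -> forall t : ov (tev (trelabel (@inord p) (lcomb m)) (P p e1)) e2,
    exists s : seq (k * (nat -> 'I_n)),
      t = \sum_(x <- s) x.1 *: pt (trelabel inord (lcomb m)) (fun j => pbas (x.2 j)).
  exact: (h p (leqnn p) t).
elim: m {t} => [_ t|m ih mp t].
  have [c ->] := pbas_span t; exists [seq (c a, fun=> a) | a <- enum 'I_n].
  by rewrite big_map big_enum.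
pose S (t : ov (tev (trelabel (@inord p) (lcomb m.+1)) (P p e1)) e2) :=
  exists s : seq (k * (nat -> 'I_n)),
    t = \sum_(x <- s) x.1 *: pt (trelabel inord (lcomb m.+1)) (fun j => pbas (x.2 j)).
have S0 : S 0 by exists [::]; rewrite big_nil.
have SD x y : S x -> S y -> S (x + y).
  by move=> [s ->] [s' ->]; exists (s ++ s'); rewrite big_cat.
have SZ c x : S x -> S (c *: x).
  move=> [s ->]; exists [seq (c * z.1, z.2) | z <- s].
  by rewrite big_map scaler_sumr; apply: eq_bigr => z _; rewrite scalerA.
have [s ->] := tspan t; rewrite -/(S _) /sum_of.
apply: (big_ind S) => // -[x y] _ /=.
have [s1 ->] := ih (ltnW mp) x; have [c ->] := pbas_span y.
rewrite tmk_suml; apply: (big_ind S) => // z _.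
rewrite tmk_sumr; apply: (big_ind S) => // a _.
rewrite tmkZl tmkZr; apply/SZ/SZ.
exists [:: (1, fun j => if j == m.+1 then a else z.2 j)]; rewrite big_seq1 scale1r /=.
congr (tmk _ (pbas _)); last by rewrite inordK ?eqxx // ltnS.
apply: eq_pt_in => j /(leaf_lt (ltnW mp)) jm; case: eqP => // e.
by rewrite e ltnn in jm.
Qed.

(** The first factor is contracted with the coordinate form at [a]. In a left bracketing it lies
    deepest, so the map is built outwards from it. *)
Lemma bten_contract p (a : 'I_n) :
  exists L : {linear ov (lprod (P p.+1 e1)) e2 -> ov (lprod (P p e1)) e2},
    forall b, L (bten p.+1 b) = (b 0 == a)%:R *: bten p (fun j => b j.+1).
Proof.
suff h m : (m <= p)%N -> exists L : {linear ov (tev (trelabel (@inord p.+1) (lcomb m.+1)) (P p.+1 e1)) e2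
      -> ov (tev (trelabel (@inord p) (lcomb m)) (P p e1)) e2},
    forall b : nat -> 'I_n, L (pt (trelabel inord (lcomb m.+1)) (fun j => pbas (b j))) =
      (b 0 == a)%:R *: pt (trelabel inord (lcomb m)) (fun j => pbas (b j.+1)).
  exact: (h p (leqnn p)).
elim: m => [_|m ih mp].
  have bb : is_bilin (fun (x y : ov (@pob k n fg e1) e2) => (pcoord a x : k) *: y).
    split=> z c x y; first by rewrite scalerDr !scalerA mulrC.
    by rewrite linearP scalerDl scalerA.
  exists (HB.pack_for {linear tprod (ov (@pob k n fg e1) e2) (ov (@pob k n fg e1) e2) -> ov (@pob k n fg e1) e2}
    (tlift (fun (x y : ov (@pob k n fg e1) e2) => (pcoord a x : k) *: y))
    (GRing.isLinear.Build k _ _ *:%R _ (tlift_linear bb))).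
  move=> b; rewrite [LHS](tlift_mk _ _ bb) pcoordE eq_sym /= !inordK //.
have [L hL] := ih (ltnW mp).
exists (tmap L idfun) => b; rewrite [LHS]tmapE hL /= tmkZl.
by rewrite !inordK // !ltnS // ltnW.
Qed.

Definition echain p a : @chain k n fg p (P p e2) (P p e1) := ccons (eps a) (cnil _).

Lemma fdeg_eps p a : fdeg (@eps k n fg p a) = 0.
Proof. by rewrite /fdeg big1. Qed.

(** At the generators the arity 0 part of y is a scalar at each vertex, and naturality of the arrow
    turns their difference into a multiple of the a-th diagonal tensor. Neither scalar involves [a];
    [exact_1] needs one scalar for all arrows. *)
Lemma diff0_echain p (y : cochain p) :
  exists lam, forall a, diff0 0 y (echain p a) e2 (gen p e2) = lam *: bten p (fun=> a).
Proof.
have [l1 h1] := gen_span (y _ _ (cnil (P p e1)) e1 (gen p e1)).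
have [l2 h2] := gen_span (y _ _ (cnil (P p e2)) e2 (gen p e2)).
exists (l1 - l2) => a; rewrite diff0E vdiff0E msum1 addr0 expr1 scaleN1r.
rewrite /vlast /= mul0r expr0z scale1r /vcomp h2 epsE hv_act h1 linearZ /= hvZ epsE.
by rewrite bten_const scalerBl.
Qed.

Lemma oactZ (X : ob) a c t : oact X a (c *: t) = c *: oact X a t.
Proof. exact: linearZ. Qed.

Lemma kcomp_deg0 p (X Y Z : 'I_p.+1 -> ob) (F : fam X Y) (G : fam Y Z) :
  (forall i, deg (F i) = 0) -> kcomp G F = 0.
Proof.
move=> h; apply: big1 => i _; apply: big1 => i' _.
by rewrite h mul0r.
Qed.

Section Cocycle.
Local Notation diag := (@diag k n fg _ _).
Local Notation eps := (@eps k n fg _).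
Variables (p : nat) (x : cochain p).
Hypothesis dx : forall X Y (c : chain X Y), csize c = 2 -> diff0 0 x c = 0.

(** On two columns the cocycle condition is the Leibniz rule for composition. *)
Lemma cocycle_comp X Z Y (F : fam X Z) (G : fam Z Y) v t : kcomp G F = 0 ->
  x (ccons (fcomp G F) (cnil Y)) v t =
  x (ccons G (cnil Y)) v (lprodm F v t) + lprodm G v (x (ccons F (cnil Z)) v t).
Proof.
move=> kGF; have := diff0E 0 x (ccons F (ccons G (cnil Y))) t.
rewrite dx // vdiff0E msum_cons msum1 kGF expr0z scale1r addr0 /= mul0r expr0z scale1r.
rewrite sqrrN expr1n scale1r /vcomp => /esym/eqP.
by rewrite addrAC subr_eq0 => /eqP ->.
Qed.

(** Comultiplying after the arrow equals applying the arrow in every factor after comultiplying. The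
    Leibniz rule on both factorizations expresses [x] on the tensored arrow through [x] on [eps a];
    the values of [x] on the two comultiplications contribute scalars l1 and l2 that do not depend
    on [a]. *)
Lemma cocycle_diag (J' : Type) (T : 'I_p.+1 -> tree J') :
  exists lam, forall a s, x (echain p a) e2 (gen p e2) = lcomb_bten p s ->
    x (ccons (tevsm T (fun=> prep 0 (pbas a) : gmor (pob e2) (pob e1))) (cnil _)) e2
      (pt (ltree p) (fun l => pt (T l) (fun=> pgen e2))) =
    \sum_(y <- s) y.1 *: pt (ltree p) (fun l => pt (T l) (fun=> pbas (y.2 l)))
    + lam *: pt (ltree p) (fun l => pt (T l) (fun=> pbas a)).
Proof.
have [l1 h1] := gen2_span (x (ccons (diag T e1) (cnil _)) e1 (gen p e1)).
have [l2 h2] := gen2_span (x (ccons (diag T e2) (cnil _)) e2 (gen p e2)).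
exists (l1 - l2) => a s hs.
pose E : fam (fun _ : J' => @pob k n fg e2) (fun _ : J' => @pob k n fg e1) :=
  fun=> prep 0 (pbas a).
have epsj (l : 'I_p.+1) : eps a l e2 (pgen e2) = pbas a :> ov (@pob k n fg e1) e2.
  by rewrite /eps prepE ishom_pob.
have diag_bas l b : diag T e1 l e2 (pbas b) = pt (T l) (fun=> pbas b).
  by rewrite /pbas hv_act diagE oact_pt.
have e : fcomp (diag T e1) (eps a) = fcomp (tevsm T E) (diag T e2).
  apply: functional_extensionality_dep => l; apply: gmor_pob_ext.
    by rewrite /= deg_tevm big1.
  rewrite -[LHS]/(diag T e1 l e2 (eps a l e2 (pgen e2))) epsj diag_bas.
  rewrite -[RHS]/(tevm (T l) E e2 (diag T e2 l e2 (pgen e2))) diagE tevm_pt0 //.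
  by apply: eq_pt; apply: functional_extensionality_dep => j; rewrite /E prepE ishom_pob.
have k1 : kcomp (diag T e1) (eps a) = 0 by exact: kcomp_deg0.
have k2 : kcomp (tevsm T E) (diag T e2) = 0 by exact: kcomp_deg0.
have := cocycle_comp (gen p e2) k1; rewrite e (cocycle_comp (gen p e2) k2) lprodm_diag.
rewrite h2 hvZ tevm_pt0; last by move=> l; exact: ishom0_pt.
rewrite epsE hv_act h1 oactZ oact_pt -[x (ccons (eps a) _) _ _]/(x (echain p a) e2 (gen p e2)) hs.
have -> : lprodm (diag T e1) e2 (lcomb_bten p s) =
    \sum_(y <- s) y.1 *: pt (ltree p) (fun l => pt (T l) (fun=> pbas (y.2 l))).
  rewrite hv_sum; apply: eq_bigr => y _; rewrite hvZ /bten tevm_pt0 //.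
  congr (_ *: _); apply: eq_pt; apply: functional_extensionality_dep => l.
  exact: diag_bas.
have -> : pt (ltree p) (fun l => tevsm T E l e2 (pt (T l) (fun=> pgen e2))) =
    pt (ltree p) (fun l => pt (T l) (fun=> pbas a)).
  apply: eq_pt; apply: functional_extensionality_dep => l.
  rewrite -[LHS]/(tevm (T l) E e2 (pt (T l) (fun=> pgen e2))) tevm_pt0 //.
  by apply: eq_pt; apply: functional_extensionality_dep => j; rewrite /E prepE ishom_pob.
have -> : pt (ltree p) (fun l => oact (tevs T (fun=> @pob k n fg e1) l) a (pt (T l) (fun=> pgen e1))) =
    pt (ltree p) (fun l => pt (T l) (fun=> pbas a)).
  by apply: eq_pt; apply: functional_extensionality_dep => l; exact: oact_pt.
set D := pt (ltree p) (fun l => pt (T l) (fun=> pbas a)); move=> h; rewrite -[LHS](addrK (l2 *: D)) h.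
by rewrite scalerBl addrA [X in X - _]addrC.
Qed.

End Cocycle.
End DegreeOne.

(** * Comparison of d_1 with the cobar differential *)

Section Cobar.
Context {k : fieldType} {n : nat} {fg : bool}.
Local Notation cochain := (@cochain k n fg).
Local Notation gen p v := (@ugen k n fg p v).
Local Notation P p v := (fun _ : 'I_p.+1 => @pob k n fg v).
Local Notation bten := (@bten k n fg).

Definition bcons (a : 'I_n) (b : nat -> 'I_n) : nat -> 'I_n :=
  fun j => if j is j'.+1 then b j' else a.
(** Places after [i] read one place back, so the letter [b i] occurs at i and at i + 1. *)
Definition bdup (i : nat) (b : nat -> 'I_n) : nat -> 'I_n := fun j => b (j - (i < j))%N.
Definition brcons (m : nat) (a : 'I_n) (b : nat -> 'I_n) : nat -> 'I_n :=
  fun j => if j == m then a else b j.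

(* The differential of the cobar complex of the coalgebra k[{1, ..., n}] of grouplike
   elements, with coefficients in the bicomodule k e_a *)
Definition cob p (a : 'I_n) (b : nat -> 'I_n) : ov (lprod (P p.+1 e1)) e2 :=
  bten p.+1 (bcons a b) + \sum_(i < p.+1) (-1) ^+ i.+1 *: bten p.+1 (bdup i b)
  + (-1) ^+ p *: bten p.+1 (brcons p.+1 a b).

Lemma leaves_block1 p (i : nat) (l : 'I_p.+1) (j : 'I_p.+2) : (i <= p)%N ->
  j \in leaves (@block p.+1 p 1 i (rcomb 0 1) l) -> (j - (i < j))%N = l.
Proof.
move=> ip; have lp : (l <= p)%N by rewrite -ltnS.
have lp2 : (l < p.+2)%N by rewrite ltnS leqW.
rewrite /block; case: (ltngtP l i) => [li|il|li] /=; rewrite !inE.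
- by move=> /eqP ->; rewrite inordK // ltnNge (ltnW li) subn0.
- move=> /eqP ->; rewrite inordK addn1 ?ltnS //.
  by rewrite (ltnW il) subn1.
move=> /orP[] /eqP ->; rewrite -li inordK ?addn0 ?addn1 ?ltnS //.
  by rewrite ltnn subn0.
by rewrite leqnn subn1.
Qed.

Lemma out_left_bten p a b :
  out_left (tmk (pbas a) (bten p b) : ov (otens (@pob k n fg e1) (lprod (P p e1))) e2) =
  bten p.+1 (bcons a b) :> ov (lprod (P p.+1 e1)) e2.
Proof.
rewrite -[RHS](@out_left_pt k n fg p (P p.+1 e1) e2); congr (out_left (tmk _ _)).
Qed.

Lemma out_right_bten p a b :
  out_right (tmk (bten p b) (pbas a) : ov (otens (lprod (P p e1)) (@pob k n fg e1)) e2) =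
  bten p.+1 (brcons p.+1 a b) :> ov (lprod (P p.+1 e1)) e2.
Proof.
rewrite -[RHS](@out_right_pt k n fg p (P p.+1 e1) e2); congr (out_right (tmk _ _)).
  apply: eq_pt; apply: functional_extensionality_dep => l; rewrite lift_max.
  by rewrite /brcons ltn_eqF // ltn_ord.
by rewrite /brcons eqxx.
Qed.

Lemma out_mid_bten p i (b : nat -> 'I_n) : (i <= p)%N ->
  out_mid i (pt (ltree p) (fun l => pt (@block p.+1 p 1 i (rcomb 0 1) l)
     (fun=> pbas (b l)) : ov (tevs _ (P p.+1 e1) l) e2)) =
  bten p.+1 (bdup i b) :> ov (lprod (P p.+1 e1)) e2.
Proof.
move=> ip; rewrite -[RHS](@out_mid_pt k n fg p (P p.+1 e1) e2 i) //.
congr (out_mid i _); apply: eq_pt; apply: functional_extensionality_dep => l.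
by apply: eq_pt_in => j /(leaves_block1 ip) e; rewrite /bdup e.
Qed.

(** The outer terms of d_1 tensor with the value of [eps a] at the generator, which gives the
    coefficients in k e_a. The middle terms go through the comultiplication and double a grouplike
    factor, up to multiples of the a-th diagonal tensor whose signed sum is [lam]. *)
Lemma diff1_echain p (x : cochain p) :
  (forall X Y (c : chain X Y), csize c = 2 -> diff0 0 x c = 0) ->
  exists lam, forall a s, x _ _ (echain p a) e2 (gen p e2) = lcomb_bten p s ->
    diff1 0 x (echain p.+1 a) e2 (gen p.+1 e2) =
    \sum_(y <- s) y.1 *: cob p a y.2 + lam *: bten p.+1 (fun=> a).
Proof.
move=> dx.
have /choice [lam hlam] (i : 'I_p.+1) :=
  cocycle_diag dx (@block p.+1 p 1 i (rcomb 0 1)).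
exists (\sum_(i < p.+1) (-1) ^+ i.+1 * lam i) => a s hs.
have epsE0 : eps (p := p.+1) a ord0 e2 (pgen e2) = pbas a :> ov (@pob k n fg e1) e2.
  by rewrite /eps prepE ishom_pob.
rewrite diff1E !homDE hom_sumE.
have -> : diff1_left 0 x (echain p.+1 a) e2 (gen p.+1 e2) =
    \sum_(y <- s) y.1 *: bten p.+1 (bcons a y.2).
  rewrite diff1_left_pt; first last.
  - by rewrite add0r /= add0r; exact: big1.
  - by rewrite mul0r add0r /= mul0r addr0.
  have -> : x _ _ (cmap (drop_row ord0) (echain p.+1 a)) e2 (pt (ltree p) (fun=> pgen e2))
      = lcomb_bten p s by exact: hs.
  rewrite -[crow _ _ _ _]/(eps (p := p.+1) a ord0 e2 (pgen e2)) epsE0.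
  rewrite /lcomb_bten tmk_sumr /out_left reb_out_sum; apply: eq_bigr => y _.
  rewrite tmkZr reb_outZ; congr (_ *: _); exact: out_left_bten.
have -> : diff1_right x (echain p.+1 a) e2 (gen p.+1 e2) =
    \sum_(y <- s) y.1 *: ((-1) ^+ p *: bten p.+1 (brcons p.+1 a y.2)).
  rewrite diff1_right_pt; first last.
  - by [].
  - by rewrite /= mulr0 addr0.
  have -> : x _ _ (cmap (drop_row ord_max) (echain p.+1 a)) e2 (pt (ltree p) (fun=> pgen e2))
      = lcomb_bten p s by exact: hs.
  rewrite -[crow _ _ _ _]/(eps (p := p.+1) a ord0 e2 (pgen e2)) epsE0.
  rewrite /lcomb_bten tmk_suml /out_right reb_out_sum scaler_sumr; apply: eq_bigr => y _.
  rewrite tmkZl reb_outZ !scalerA [_ * y.1]mulrC; congr (_ *: _); exact: out_right_bten.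
have -> : \sum_(i < p.+1) ((-1) ^+ i.+1 *: diff1_mid x i (echain p.+1 a)) e2 (gen p.+1 e2) =
    \sum_(y <- s) y.1 *: (\sum_(i < p.+1) (-1) ^+ i.+1 *: bten p.+1 (bdup i y.2))
    + (\sum_(i < p.+1) (-1) ^+ i.+1 * lam i) *: bten p.+1 (fun=> a).
  rewrite scaler_suml.
  under [X in _ = X + _]eq_bigr => y _ do rewrite scaler_sumr.
  rewrite exchange_big -big_split; apply: eq_bigr => i _.
  have ip : (i <= p)%N by rewrite -ltnS.
  rewrite homZE diff1_mid_pt; last exact: ip.
  rewrite [x _ _ _ _ _](hlam i a s hs) /out_mid reb_outD reb_outZ reb_out_sum scalerDr.
  rewrite -scalerA; congr (_ + _ *: (_ *: _)); last first.
    exact: (@out_mid_bten p i (fun=> a) ip).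
  rewrite scaler_sumr; apply: eq_bigr => y _.
  rewrite reb_outZ !scalerA mulrC; congr (_ *: _); exact: out_mid_bten.
rewrite addrA [LHS]addrAC; congr (_ + _).
transitivity (\sum_(y <- s) (y.1 *: bten p.+1 (bcons a y.2) +
    y.1 *: (\sum_(i < p.+1) (-1) ^+ i.+1 *: bten p.+1 (bdup i y.2)) +
    y.1 *: ((-1) ^+ p *: bten p.+1 (brcons p.+1 a y.2)))).
  by rewrite !big_split.
apply: eq_bigr => y _.
by rewrite /cob !scalerDr.
Qed.

End Cobar.

(** * Cochains made from natural transformations *)

Section Natural.
Context {k : fieldType} {n : nat} {fg : bool} {p : nat}.
Local Notation ob := (ob k n fg).
Local Notation J := 'I_p.+1.
Local Notation chain := (@chain k n fg p).
Local Notation fam := (@fam k n fg J).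
Local Notation P v := (fun _ : J => @pob k n fg v).
Local Notation cochain := (@cochain k n fg p).
Local Notation vcochain := (@vcochain k n fg p).
Local Notation gen v := (@ugen k n fg p v).

(** Associativity of composing three columns, at the level of signs. *)
Lemma kcomp_cocycle (X Y Z W : J -> ob) (F : fam X Y) (G : fam Y Z) (H : fam Z W) :
  kcomp G F + kcomp H (fcomp G F) = kcomp H G + kcomp (fcomp H G) F.
Proof.
rewrite /kcomp -!big_split; apply: eq_bigr => i _ /=; rewrite -!big_split.
by apply: eq_bigr => j _ /=; ring.
Qed.

Lemma lprodm_fcomp (X Y Z : J -> ob) (F : fam X Y) (G : fam Y Z) v t :
  lprodm G v (lprodm F v t) = (-1) ^ kcomp G F *: lprodm (fcomp G F) v t.
Proof.
move: t; apply: (@lprod_ext k n fg p v X _ (fun t => lprodm G v (lprodm F v t))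
  (fun t => (-1) ^ kcomp G F *: lprodm (fcomp G F) v t)) => [a x y|a x y|H].
- by rewrite !hvD !hvZ.
- by rewrite hvD hvZ scalerDr !scalerA mulrC.
rewrite lprodm_comp hvZ !lprodm_comp !scalerA -!expN1D.
have -> : fcomp G (fcomp F H) = fcomp (fcomp G F) H.
  apply: functional_extensionality_dep => j; apply: gmor_ext; first by rewrite /= addrA.
  by move=> v0 x.
by rewrite kcomp_cocycle.
Qed.

Section Rep.
Variables (v w : vertex) (N : ov (lprod (P v)) w).

(* The natural transformation of lprod X (v) -> lprod X (w) corresponding to N
   by the Yoneda lemma *)
Definition rep (X : J -> ob) : ov (lprod X) v -> ov (lprod X) w :=
  mlift (m := p) (fun F : fam (P v) X => lprodm F w N).

Lemma rep_mlinfam X : mlinfam p (fun F : fam (P v) X => lprodm F w N).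
Proof. by move=> j a F F1 F2 _ h; exact: lprodm_slin h. Qed.

Lemma rep_linear X : linear (rep (X := X)).
Proof. exact: mlift_linear (leqnn p) (rep_mlinfam (X := X)). Qed.

Lemma repE X (F : fam (P v) X) : rep (lprodm F v (gen v)) = lprodm F w N.
Proof.
rewrite [LHS](mliftE F (leqnn p) (rep_mlinfam (X := X))); congr (lprodm _ w N).
by apply: functional_extensionality_dep => j; rewrite -ltnS ltn_ord.
Qed.

Lemma rep_gen : rep (gen v) = N.
Proof. by rewrite -[gen v]lprodm_id repE lprodm_id. Qed.

Lemma rep_natural X Y (G : fam X Y) t : rep (lprodm G v t) = lprodm G w (rep t).
Proof.
move: t; apply: (@lprod_ext k n fg p v X _ (fun t => rep (lprodm G v t))
  (fun t => lprodm G w (rep t))) => [a x y|a x y|F].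
- by rewrite hvD hvZ rep_linear.
- by rewrite rep_linear hvD hvZ.
rewrite lprodm_comp (scalable_linear_fun _ _ (rep_linear (X := Y))) !repE.
by rewrite lprodm_fcomp.
Qed.

Hypothesis hN : ishom 0 N.

Lemma rep_pr X i t : rep (X := X) (pr _ i t) = pr _ i (rep t).
Proof.
move: t; apply: (@lprod_ext k n fg p v X _ (fun t => rep (X := X) (pr _ i t))
  (fun t => pr _ i (rep (X := X) t))) => [a x y|a x y|F].
- by rewrite linearP rep_linear.
- by rewrite rep_linear linearP.
have hF : ishom (fdeg F) (lprodm F w N).
  by rewrite -[fdeg F]add0r -deg_lprodm; exact: ishom_gmor.
rewrite (ishomE _ (ishom_lprodm F)) repE (ishomE _ hF).
case: eqP => _; last exact: linear_fun0 (rep_linear (X := X)).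
exact: repE.
Qed.

End Rep.

Definition vnil v w (T : forall X, ov (lprod X) v -> ov (lprod X) w) : vcochain v w :=
  fun X Y c => match c in Defs.chain X Y return ov (lprod X) v -> ov (lprod Y) w with
  | cnil X => T X
  | ccons _ _ _ _ _ => fun=> 0
  end.

Section Nil.
Variables (v w : vertex) (T : forall X : J -> ob, ov (lprod X) v -> ov (lprod X) w).
Hypothesis linT : forall X, linear (T (X := X)).

Lemma vnil_ok : (forall X i t, T (X := X) (pr _ i t) = pr _ i (T t)) ->
  vok 0 0 (vnil T).
Proof.
move=> prT; split.
- move=> X Y [X1|X1 Z Y1 F c] a x y /=; last by rewrite scaler0 addr0.
  exact: linT.
- by move=> j a X Y [X1|X1 Z Y1 F c] // c1 c2 t [[F1 [F2 [_ -> ->]]]|[d1 [d2 [_ -> ->]]]];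
    rewrite /= scaler0 addr0.
- by move=> X Y [].
- by move=> X Y [X1|//] i t _ /=; rewrite !addr0 prT.
Qed.

Lemma vdiff0_vnil X Y (F : fam X Y) t :
  vdiff0 0 (vnil T) (ccons F (cnil Y)) t = T (lprodm F v t) - lprodm F w (T t).
Proof.
by rewrite vdiff0E msum1 addr0 expr1 scaleN1r /= mul0r expr0z scale1r.
Qed.

(** Checked by hand: d^2 = 0 is given for cochains compatible with the arrows, and T lives at single
    vertices. *)
Lemma vdiff0_vdiff0_vnil X Y (c : chain X Y) t : csize c = 2 ->
  vdiff0 0 (vdiff0 0 (vnil T)) c t = 0.
Proof.
case: c t => // X1 Z Y1 F c; case: c F => // Z1 Z2 Y2 G c; case: c G => // Z3 G F t _.
rewrite vdiff0E msum_cons msum1 !vdiff0_vnil addr0 [clast _ _]/= /vlast mul0r expr0z.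
rewrite scale1r [csize _]/= sqrrN expr1n scale1r !vdiff0_vnil.
rewrite lprodm_fcomp (scalable_linear_fun _ _ (linT (X := Z3))) !hvD -[- lprodm F w _]scaleN1r.
rewrite !hvZ lprodm_fcomp scaleN1r scalerBr.
set a := _ *: _; set b := _ *: _; set d := lprodm G w _.
by rewrite opprB [_ + (b - a)]addrC !subrKA subrr.
Qed.

End Nil.

(** T at e2 composed with the arrow [a] is the natural map given by [N a]. Hence d_0 T vanishes on
    images of arrows and, extended by 0 at e1, is a cochain. T itself need not commute with the
    arrows, so this cocycle can carry a non-trivial obstruction. *)
Lemma cocycle_prescribed (N : 'I_n -> ov (lprod (P e1)) e2) :
  exists v : cochain, [/\ cok 1 0 v,
    forall X Y (c : chain X Y), csize c = 2 -> diff0 0 v c = 0 &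
    forall a, v _ _ (echain p a) e2 (gen e2) = N a].
Proof.
pose T (X : J -> ob) (t : ov (lprod X) e2) : ov (lprod X) e2 :=
  \sum_a rep (N a) (ret (lprod X) a t).
have linT X : linear (T X).
  move=> c x y; rewrite /T scaler_sumr -big_split; apply: eq_bigr => a _ /=.
  by rewrite linearP rep_linear.
have okT : vok 0 0 (vnil T).
  apply: vnil_ok => // X i t; rewrite /T linear_sum; apply: eq_bigr => a _.
  by rewrite ret_pr rep_pr //; exact: ishom_tev_pob.
have Tact X a t : T X (oact (lprod X) a t) = rep (N a) t.
  rewrite /T (bigD1 a) //= retE eqxx big1 ?addr0 // => b ba.
  by rewrite retE eq_sym (negPf ba) (linear_fun0 (rep_linear (N b) (X := X))).
have T0 t : T (P e2) t = 0.
  rewrite /T big1 // => a _; rewrite (lprod_pob21 (ret _ a t)).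
  exact: linear_fun0 (rep_linear (N a) (X := _)).
pose z : vcochain e1 e1 := fun X Y c t => 0.
have ok0 : vok 1 0 z.
  split=> [X Y c a x y|j a X Y c c1 c2 t _|//|X Y c i t _]; rewrite /z.
  - by rewrite scaler0 addr0.
  - by rewrite scaler0 addr0.
  by rewrite linear0.
have [|v okv vE] := pair_cochain ok0 (vdiff0_ok okT).
  move=> X Y c a t; case: c t => // X1 Z Y1 F c; case: c F => // Y2 F t _.
  by rewrite vdiff0_vnil hv_act !Tact rep_natural subrr linear0.
exists v; split=> //.
  move=> X Y c sc; apply: homP => u t; rewrite diff0E.
  case: u t => t.
    rewrite vdiff0_eq0 // => X' Y' d s; rewrite sc => -[sd].
    by rewrite /vcomp; have [-> _] := vE _ _ d sd.
  rewrite (eq_vdiff0 0 (psi := vdiff0 0 (vnil T))) ?vdiff0_vdiff0_vnil //.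
  move=> X' Y' d s; rewrite sc => -[sd].
  by rewrite /vcomp; have [_ ->] := vE _ _ d sd.
move=> a; have [_ ->] := vE _ _ (echain p a) erefl.
by rewrite vdiff0_vnil epsE Tact rep_gen T0 hv0 subr0.
Qed.

End Natural.

(** * Primitives in arity 1 *)

Section Primitives.
Context {k : fieldType} {n : nat} {fg : bool}.
Local Notation cochain := (@cochain k n fg).
Local Notation gen p v := (@ugen k n fg p v).
Local Notation P p v := (fun _ : 'I_p.+1 => @pob k n fg v).
Local Notation bten := (@bten k n fg).
Local Notation cob := (@cob k n fg).
Local Notation lcomb_bten := (@lcomb_bten k n fg).

(* The contraction L with e_a on the first factor is a homotopy of the cobar complex. *)
Lemma cob_contract0 a (L : {linear ov (lprod (P 1 e1)) e2 -> ov (lprod (P 0 e1)) e2}) :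
  (forall b, L (bten 1 b) = (b 0 == a)%:R *: bten 0 (fun j => b j.+1)) ->
  forall b, L (cob 0 a b) = bten 0 b.
Proof.
move=> hL b; rewrite /cob !linearD linear_sum big_ord1 !linearZ /= !hL.
rewrite eqxx scale1r expr1 expr0 scale1r scaleN1r.
rewrite -addrA [X in _ + X](_ : _ = 0) ?addr0 // addrC.
have -> : bdup 0 b 0 = b 0 by [].
have -> : brcons 1 a b 0 = b 0 by [].
case: eqP => [e|_]; last by rewrite !scale0r subrr.
by rewrite !scale1r (@eq_bten _ _ _ 0 _ (fun j => bdup 0 b j.+1)) ?subrr // => -[|//] _.
Qed.

Lemma cob_contractS p a (L : {linear ov (lprod (P p.+2 e1)) e2 -> ov (lprod (P p.+1 e1)) e2}) :
  (forall b, L (bten p.+2 b) = (b 0 == a)%:R *: bten p.+1 (fun j => b j.+1)) ->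
  forall b, L (cob p.+1 a b) = bten p.+1 b - (b 0 == a)%:R *: cob p a (fun j => b j.+1).
Proof.
move=> hL b; rewrite /cob !linearD linear_sum big_ord_recl !linearZ /= !hL.
rewrite eqxx scale1r -!addrA; congr (_ + _).
have -> : bdup 0 b 0 = b 0 by [].
have -> : brcons p.+2 a b 0 = b 0 by [].
set w := (_ == _)%:R; congr (_ + (_ + _)).
(* Contracting the duplicate of the first letter returns [b]; when b 0 = a this is the left outer
   term of the cobar differential of the tail. *)
- rewrite expr1 scaleN1r scalerN /w; case: eqP => [e|_]; last by rewrite !scale0r.
  congr (- (_ *: _)); apply: (@eq_bten k n fg p.+1) => -[|j] _ //=; rewrite ?e // /bdup subn1.
- rewrite -sumrN scaler_sumr; apply: eq_bigr => i _.
  rewrite linearZ /= hL.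
  have -> : bdup (bump 0 i) b 0 = b 0 by [].
  rewrite -/w /bump add1n exprS mulN1r scaleNr scalerN !scalerA mulrC; congr (- (_ *: _)).
  apply: (@eq_bten k n fg p.+1) => j _; rewrite /bdup ltnS; congr b.
  by case: ltnP => [ij|_]; rewrite ?subn0 // !subn1 prednK // (leq_ltn_trans _ ij).
by rewrite exprS mulN1r scaleNr !scalerN !scalerA mulrC.
Qed.

Variables (sg : signs) (d_sq0 : @tdiff_sq0 k n fg sg).

Definition diff1_prev p r : cochain p.-1 -> cochain p :=
  match p return cochain p.-1 -> cochain p with
  | 0 => fun _ X Y c => 0
  | p'.+1 => fun v => diff1 r v
  end.

(* Such an x can be subtracted from the leading component (p, q) of a cocycle: the
   condition d_0 v = 0 prevents d v from having a component at (p - 1, q + 1). *)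
Definition killed p q r (x : cochain p) : Prop :=
  exists u : cochain p, exists v : cochain p.-1,
  [/\ cok q.-1 r u, cok q r v,
      forall X Y (c : chain X Y), csize c = q.+1 -> diff0 r v c = 0 &
      forall X Y (c : chain X Y), csize c = q ->
        x _ _ c = diff0 r u c + diff1_prev r v c].

Lemma diff1_zero p r X Y (c : @chain k n fg p.+1 X Y) :
  diff1 r ((fun X Y c => 0) : cochain p) c = 0.
Proof. by apply/lin_eq0/diff1_lin => X' Y' d _; apply/zero_lin. Qed.

Lemma diff0_zero p r X Y (c : @chain k n fg p X Y) :
  diff0 r ((fun X Y c => 0) : cochain p) c = 0.
Proof. by apply/lin_eq0/diff0_lin => X' Y' d _; apply/zero_lin. Qed.

Lemma diff1_prev_zero p r X Y (c : @chain k n fg p X Y) :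
  diff1_prev r (fun X Y c => 0) c = 0.
Proof. by case: p X Y c => // p X Y c; exact: diff1_zero. Qed.

Lemma killed_diff0 p q r (x : cochain p) :
  (exists2 u, cok q.-1 r u & forall X Y (c : chain X Y), csize c = q ->
     x _ _ c = diff0 r u c) -> killed q r x.
Proof.
case=> u oku xE; exists u, (fun X Y c => 0); split=> //.
- exact: cok_zero.
- by move=> X Y c _; exact: diff0_zero.
by move=> X Y c sc; rewrite diff1_prev_zero addr0 xE.
Qed.

Lemma killed_1 p r (x : cochain p) (y : cochain p.+1) : cok 1 r x ->
  (forall X Y (c : chain X Y), csize c = 2 -> diff0 r x c = 0) -> cok 0 r y ->
  (forall X Y (c : chain X Y), csize c = 1%N -> diff1 r x c = diff0 r y c) ->
  killed 1 r x.
Proof.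
move=> okx dx oky dxy.
have dd q (w : cochain p) : cok q r w -> forall X Y (c : chain X Y), csize c = q.+2 ->
    diff0 r (diff0 r w) c = 0.
  by move=> okw; exact: (diff0_diff0 d_sq0 okw).
have [r0|r0] := eqVneq r 0; last first.
  apply: killed_diff0; apply: (exact_1 (lam := 0) okx dx (dd 0)); first by right.
  move=> a; rewrite scale0r; apply: (gen_value0 okx) => //.
  by rewrite /= add0r; exact: fdeg_eps.
move: okx dx oky dxy dd; rewrite r0 => okx dx oky dxy dd {r r0}.
have [mu hmu] := diff0_echain y.
have [lam hlam] := diff1_echain dx.
have /choice [s hs] (a : 'I_n) := bten_span (x _ _ (echain p a) e2 (gen p e2)).
(* The condition d_1 x = d_0 y, compared on [eps a]: the cobar differential of mu_a plus [lam] times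
   the diagonal tensor equals [mu] times it. *)
have key a : \sum_(y <- s a) y.1 *: cob p a y.2 = (mu - lam) *: bten p.+1 (fun=> a).
  have := hlam a (s a) (hs a); rewrite dxy // hmu => h.
  by rewrite scalerBl h addrK.
have /choice [L hL] (a : 'I_n) := @bten_contract k n fg p a.
have keyL a : \sum_(y <- s a) y.1 *: L a (cob p a y.2) = (mu - lam) *: bten p (fun=> a).
  transitivity (L a (\sum_(y <- s a) y.1 *: cob p a y.2)).
    by rewrite linear_sum; apply: eq_bigr => z _; rewrite linearZ.
  by rewrite key linearZ /= hL eqxx scale1r.
(* For p = 0 there is no row below to subtract from, but the contraction of the cobar differential
   already returns mu_a, so the obstruction is scalar. *)
case: p => [|p] in x y okx dx oky dxy dd mu hmu lam hlam s hs key L hL keyL *.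
  apply: killed_diff0; apply: (exact_1 (lam := mu - lam) okx dx (dd 0)); first by left.
  move=> a; rewrite -bten_const -keyL; apply: etrans (hs a) _.
  by apply: eq_bigr => z _; rewrite (cob_contract0 (hL a)).
(* This is N_a, the contraction of mu_a. By the homotopy formula mu_a is the cobar differential of
   N_a plus (mu - lam) times the diagonal tensor. *)
pose s' a := [seq (z.1 * (z.2 0 == a)%:R, fun j => z.2 j.+1) | z <- s a].
have [v [okv dv hv]] := cocycle_prescribed (fun a => lcomb_bten p (s' a)).
have [nu hnu] := diff1_echain dv.
pose x' : cochain p.+1 := fun X Y c => (-1) *: diff1 0 v c + x X Y c.
have okx' : cok 1 0 x' by apply: cok_comb => //; exact: diff1_ok.
have dx' X Y (c : chain X Y) : csize c = 2 -> diff0 0 x' c = 0.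
  move=> sc; rewrite (@diff0_lin _ _ _ _ 0 (-1) x' (diff1 0 v) x) //.
  by rewrite dx // (diff0_diff1 d_sq0 okv) // scaler0 addr0.
have [u oku xu] : exists2 u, cok 0 0 u &
    forall X Y (c : chain X Y), csize c = 1%N -> x' X Y c = diff0 0 u c.
  (* On [eps a], d_1 v is the cobar differential of N_a plus [nu] times the diagonal tensor; after
     subtracting it from mu_a only this scalar is left. *)
  apply: (exact_1 (lam := mu - lam - nu) okx' dx' (dd 0)); first by left.
  move=> a; rewrite -bten_const /x' homDE homZE [X in _ + X](hs a).
  rewrite [X in -1 *: X](hnu a (s' a) (hv a)) scalerBl -keyL scaleN1r opprD.
  rewrite addrAC; congr (_ - _); rewrite addrC big_map -sumrN -big_split.
  apply: eq_bigr => z _; rewrite /= (cob_contractS (hL a)) scalerBr scalerA.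
  by [].
exists u, v; split=> // X Y c sc; rewrite -xu // /x' /= scaleN1r.
by rewrite addrAC addNr add0r.
Qed.

End Primitives.

(** * Arity 0, and all arities together *)

Section PrimitivesExist.
Context {k : fieldType} {n : nat} {fg : bool}.
Local Notation cochain := (@cochain k n fg).
Local Notation gen p v := (@ugen k n fg p v).
Variables (sg : signs) (d_sq0 : @tdiff_sq0 k n fg sg).

Lemma pgen_form v : exists f : {linear ov (@pob k n fg v) v -> k^o}, f (pgen v) = 1.
Proof.
case: v.
  pose f : ov (@pob k n fg e1) e1 -> k^o := fun x => (x : @psp k n e1 e1) ord0.
  have lf : linear f by move=> c x y; rewrite /f !ffunE.
  pose F : {linear ov (@pob k n fg e1) e1 -> k^o} :=
    HB.pack f (GRing.isLinear.Build k _ k^o *:%R f lf).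
  by exists F; rewrite /F /= /f ffunE.
pose f : ov (@pob k n fg e2) e2 -> k^o := fun x => (x : @psp k n e2 e2) ord0.
have lf : linear f by move=> c x y; rewrite /f !ffunE.
pose F : {linear ov (@pob k n fg e2) e2 -> k^o} :=
  HB.pack f (GRing.isLinear.Build k _ k^o *:%R f lf).
by exists F; rewrite /F /= /f ffunE.
Qed.

Lemma scale_gen_eq0 p v lam : lam *: gen p v = 0 -> lam = 0.
Proof.
have [f hf] := pgen_form v.
have [F hF] := @pt_form k n fg _ (ltree p) (fun=> @pob k n fg v) v (fun=> pgen v)
  (fun=> f) (fun=> hf).
move=> /(congr1 F); rewrite linear0 linearZ /= hF => <-.
exact/esym/mulr1.
Qed.

(** An arrow forces the scalars at its two ends to agree; for n = 0 they are independent, which the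
    form of the hypothesis covers. *)
Lemma scalar_cochain p (lam : vertex -> k) : ('I_n -> lam e1 = lam e2) ->
  exists v : cochain p, [/\ cok 0 0 v,
    forall X Y (c : chain X Y), csize c = 1%N -> diff0 0 v c = 0 &
    forall u, v _ _ (cnil (fun=> @pob k n fg u)) u (gen p u) = lam u *: gen p u].
Proof.
move=> hlam.
have okl u : vok 0 0 (vscal (k := k) (n := n) (fg := fg) (p := p) (lam u) (v := u)).
  by apply: vscal_ok; left.
have [|v okv vE] := pair_cochain (okl e1) (okl e2).
  move=> X Y c a t; case: c t => // X1 t _.
  by rewrite /= -(hlam a) linearZ.
have vu u X t : v _ _ (cnil X) u t = lam u *: t.
  by have [w1 w2] := vE _ _ (cnil X) erefl; case: u t => t; rewrite ?w1 ?w2.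
exists v; split=> // X Y c; case: c => // X1 Z Y1 F c; case: c F => // Y2 F _.
apply: homP => u t; rewrite diff0E vdiff0E msum1 addr0 /vcomp /vlast /= !vu hvZ.
by rewrite mul0r expr0z scale1r expr1 scaleN1r subrr.
Qed.

(** For even p, d_1 is injective on scalars, so d_1 x = 0 forces x = 0. For odd p, the same fact one
    row lower exhibits x as d_1 of the cochain with the same scalars. *)
Lemma killed_0 p r (x : cochain p) : cok 0 r x ->
  (forall X Y (c : chain X Y), csize c = 1%N -> diff0 r x c = 0) ->
  (forall X Y (c : chain X Y), csize c = 0 -> diff1 r x c = 0) ->
  killed 0 r x.
Proof.
move=> okx dx d1x.
have killed_zero : (forall v, x _ _ (cnil (fun=> @pob k n fg v)) v (gen p v) = 0) ->
    killed 0 r x.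
  move=> h; apply: killed_diff0; exists (fun X Y c => 0); first exact: cok_zero.
  by move=> X Y c sc; rewrite diff0_zero; exact: (diff0_natural_eq0 dx).
have [r0|r0] := eqVneq r 0; last first.
  by apply: killed_zero => v; exact: (gen_value0 okx).
move: okx dx d1x killed_zero; rewrite r0 => okx dx d1x killed_zero {r r0}.
have /choice [lam hlam] v := gen_span (x _ _ (cnil (fun=> @pob k n fg v)) v (gen p v)).
have lamE v : (~~ odd p)%:R *: (lam v *: gen p.+1 v) = 0.
  have := diff1_scalar dx (hlam v).
  by rewrite d1x // signs_sum => <-.
case: p => [|p] in x okx dx d1x killed_zero lam hlam lamE *.
  apply: killed_zero => v; rewrite hlam.
  by have := lamE v; rewrite scale1r => /scale_gen_eq0 ->; rewrite scale0r.
(* The cochain now has row index p + 1, so [odd p] is the even case of the argument. *)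
have [op|ep] := boolP (odd p).
  apply: killed_zero => v; rewrite hlam.
  have := lamE v; rewrite [odd _]/= op scale1r => /scale_gen_eq0 ->; exact: scale0r.
have [v [okv dv hv]] := @scalar_cochain p lam
  (fun a => pob_scalar_eq a dx hlam).
exists (fun X Y c => 0), v; split=> //; first exact: cok_zero.
move=> X Y c sc; rewrite diff0_zero add0r; apply/eqP; rewrite -subr_eq0; apply/eqP.
pose x' : cochain p.+1 := fun X Y c => (-1) *: diff1 0 v c + x X Y c.
have : x' X Y c = 0; last by rewrite /x' scaleN1r addrC.
apply: (diff0_natural_eq0 (r := 0)) => //.
  move=> X' Y' d sd; rewrite (@diff0_lin _ _ _ _ 0 (-1) x' (diff1 0 v) x) //.
  by rewrite dx // (diff0_diff1 d_sq0 okv) // scaler0 addr0.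
move=> u; rewrite /x' homDE homZE hlam (diff1_scalar dv (hv u)) signs_sum ep.
by rewrite scale1r scaleN1r addNr.
Qed.

Lemma closed_killed p q r (x : cochain p) (y : cochain p.+1) : cok q r x ->
  (forall X Y (c : chain X Y), csize c = q.+1 -> diff0 r x c = 0) ->
  cok q.-1 r y ->
  (forall X Y (c : chain X Y), csize c = q -> diff1 r x c = diff0 r y c) ->
  killed q r x.
Proof.
case: q => [|[|q]] okx dx oky dxy.
(* On empty chains d_0 y is zero, so the hypothesis becomes d_1 x = 0. *)
- by apply: killed_0 => // X Y c; case: c => // X1 _; rewrite dxy.
- exact: (killed_1 d_sq0 okx dx oky).
apply: killed_diff0; apply: exact_ge2 => // w okw.
exact: (diff0_diff0 d_sq0 okw).
Qed.

End PrimitivesExist.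

(** * Descent *)

Section Descent.
Context {k : fieldType} {n : nat} {fg : bool}.
Local Notation cochain := (@cochain k n fg).
Local Notation tcochain := (@tcochain k n fg).
Variables (sg : signs) (d_sq0 : @tdiff_sq0 k n fg sg) (m : int).

Lemma is_TC_comb m' a (z w : tcochain) : is_TC m' z -> is_TC m' w ->
  is_TC m' (fun p X Y c => a *: z p X Y c + w p X Y c).
Proof.
move=> hz hw; apply: cok_is_TC => [p q|].
  exists (fun X Y c => a *: z p X Y c + w p X Y c) => //.
  by apply: cok_comb; exact: is_TC_cok.
have [N hN] := TC_finite hz; have [M hM] := TC_finite hw.
exists (N + M)%N => p X Y c h.
rewrite hN ?hM ?scaler0 ?addr0 //; apply: leq_ltn_trans h.
  exact: leq_addl.
exact: leq_addr.
Qed.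

Lemma is_TC_zero m' : is_TC m' ((fun p X Y c => 0) : tcochain).
Proof.
apply: cok_is_TC => [p q|]; last by exists 0%N.
by exists (fun X Y c => 0) => //; exact: cok_zero.
Qed.

Lemma tdiff_zero m' p X Y (c : @chain k n fg p X Y) :
  tdiff sg m' (fun p X Y c => 0) c = 0.
Proof. by apply/lin_eq0/tdiff_lin => p' X' Y' d _ _; apply/zero_lin. Qed.

(** The filtration: total arity downwards, and p upwards within a total arity. The first component
    that may be non-zero is the one in C^{p, N-p}. *)
Definition vanish N p (z : tcochain) : Prop := forall p' X Y (c : @chain k n fg p' X Y),
  (N < p' + csize c)%N \/ ((p' + csize c)%N = N /\ (p' < p)%N) -> z p' X Y c = 0.

Definition coboundary (z : tcochain) : Prop := exists2 w : tcochain, is_TC (m - 1) w &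
  forall p X Y (c : @chain k n fg p X Y), z p X Y c = tdiff sg (m - 1) w c.

(** [u] is placed in a single bidegree with the negative of the sign of d_0 as coefficient, so the
    two signs multiply to -1. For q = 0 there is no bidegree to put it in, and d_0 u is zero on
    empty chains. *)
Lemma lift_diff0 p q (u : cochain p) : let r := m - p%:Z - q%:Z in cok q.-1 r u ->
  exists2 w : tcochain, is_TC (m - 1) w & vanish (p + q) p (fun p => @tdiff k n fg sg (m - 1) w p) /\
    forall X Y (c : @chain k n fg p X Y), csize c = q -> tdiff sg (m - 1) w c = - diff0 r u c.
Proof.
case: q => [|q] r oku.
  exists (fun p X Y c => 0); first exact: is_TC_zero.
  split=> [p' X Y c _|X Y c]; rewrite tdiff_zero //.
  by case: c => // X1 _; rewrite oppr0.
have er : m - 1 - p%:Z - q%:Z = r by rewrite /r -[q.+1]addn1 PoszD !opprD; ring.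
pose s : k := (-1) ^+ sgn0 sg p q r.
pose u' : cochain p := fun X Y c => (- s) *: u X Y c.
exists (single q u'); first by apply: single_TC; rewrite er; exact: cok_scale.
split=> [p' X Y c h|X Y c sc].
  by apply: tdiff_single_low; rewrite -addnS; case: h => [->|[_ ->]]; rewrite ?orbT.
rewrite tdiff_single0 // er (diff0_scale r (a := - s) (phi1 := u)) //.
by rewrite scalerA mulrN -/s -expr2 sqrr_sign scaleN1r.
Qed.

Lemma lift_diff1 p q (v : cochain p.-1) : let r := m - p%:Z - q%:Z in cok q r v ->
  (forall X Y (c : chain X Y), csize c = q.+1 -> diff0 r v c = 0) ->
  exists2 w : tcochain, is_TC (m - 1) w & vanish (p + q) p (fun p => @tdiff k n fg sg (m - 1) w p) /\
    forall X Y (c : @chain k n fg p X Y), csize c = q ->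
      tdiff sg (m - 1) w c = - diff1_prev r v c.
Proof.
case: p v => [|p] v r okv dv.
  exists (fun p X Y c => 0); first exact: is_TC_zero.
  by split=> [p' X Y c _|X Y c _]; rewrite tdiff_zero // oppr0.
have er : m - 1 - p%:Z - q%:Z = r by rewrite /r -[p.+1]addn1 PoszD !opprD; ring.
pose s : k := (-1) ^+ sgn1 sg p q r.
pose v' : cochain p := fun X Y c => (- s) *: v X Y c.
exists (single q v'); first by apply: single_TC; rewrite er; exact: cok_scale.
split=> [p' X Y c h|X Y c sc]; last first.
  rewrite tdiff_single1 // er (_ : diff1 r v' c = - s *: diff1 r v c).
    by rewrite scalerA mulrN -/s -expr2 sqrr_sign scaleN1r.
  rewrite -[RHS]addr0 -(diff1_zero r c); apply: diff1_lin => X' Y' d _.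
  by rewrite addr0.
have [lp|] := ltnP p' p; first by apply: tdiff_single_low; rewrite lp.
rewrite leq_eqVlt => /orP[/eqP e|lp].
  subst p'; case: h => [h|[h _]]; first by apply: tdiff_single_low; rewrite -addSn h orbT.
  have sc : csize c = q.+1 by move/eqP: h; rewrite addSnnS eqn_add2l => /eqP.
  rewrite tdiff_single0 // er (diff0_scale r (a := - s) (phi1 := v)) //.
  by rewrite dv // !scaler0.
case: h => [h|[_ h]]; first by apply: tdiff_single_low; rewrite -addSn h orbT.
by move: h; rewrite ltnS leqNgt lp.
Qed.

(** By the filtration, dz at (p, q + 1) is d_0 of the leading component, and at (p + 1, q) it is d_1
    of it plus d_0 of the next one, up to signs. These are the hypotheses of [closed_killed]. *)
Lemma coboundary_step N p z : (p <= N)%N -> is_TC m z ->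
  (forall p X Y (c : @chain k n fg p X Y), tdiff sg m z c = 0) -> vanish N p z ->
  exists2 w, is_TC (m - 1) w & vanish N p.+1 (fun p X Y c => z p X Y c + tdiff sg (m - 1) w c).
Proof.
move=> pN hz dz vz; pose q := (N - p)%N; have eN : N = (p + q)%N by rewrite subnKC.
rewrite {}eN in vz * => {pN}; pose r := m - p%:Z - q%:Z.
have okz p' q' : cok q' (m - p'%:Z - q'%:Z) (z p') by exact: is_TC_cok.
have dx X Y (c : @chain k n fg p X Y) : csize c = q.+1 -> diff0 r (z p) c = 0.
  move=> sc; have := dz _ _ _ c; rewrite tdiff_lead0 => [|p' X' Y' d h|p' X' Y' d h1 h2].
  - have -> : m + 1 - p%:Z - (csize c)%:Z = r by rewrite sc /r -addn1 PoszD !opprD; ring.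
    by move/eqP; rewrite scaler_eq0 (negPf (sign_neq0 _)) => /eqP.
  - by apply: vz; left; rewrite h sc addnS.
  by apply: vz; right; move: h2; rewrite sc addnS => -[].
have dxy X Y (c : @chain k n fg p.+1 X Y) : csize c = q ->
    diff1 r (z p) c = (- ((-1) ^+ sgn1 sg p q r * (-1) ^+ sgn0 sg p.+1 q.-1 r)) *:
      diff0 r (z p.+1) c.
  move=> sc; have := dz _ _ _ c; rewrite tdiff_lead1 => [|p' X' Y' d h|p' X' Y' d h1 h2].
  - have -> : m + 1 - p.+1%:Z - (csize c)%:Z = r by rewrite sc /r -addn1 PoszD !opprD; ring.
    rewrite sc => /eqP; rewrite addr_eq0 => /eqP e.
    rewrite scaleNr -scalerA e scalerN opprK scalerA -expr2 sqrr_sign.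
    by rewrite scale1r.
  - by apply: vz; left; rewrite h sc addSn.
  by apply: vz; right; rewrite h2 sc.
(* [y] is the next component, at (p + 1, q - 1), with both signs moved onto it; for q = 0 there is
   no such component and y = 0. *)
have [y oky dy] : exists2 y : cochain p.+1, cok q.-1 r y &
    forall X Y (c : chain X Y), csize c = q -> diff1 r (z p) c = diff0 r y c.
  case: (q) @r dx dxy => [|q'] r dx dxy.
    exists (fun X Y c => 0); first exact: cok_zero.
    by move=> X Y c sc; rewrite dxy //; case: c sc => // X1 _; rewrite scaler0.
  exists (fun X Y c => (- ((-1) ^+ sgn1 sg p q'.+1 r * (-1) ^+ sgn0 sg p.+1 q' r)) *:
      z p.+1 X Y c).
    apply: cok_scale; have := okz p.+1 q'; congr cok.
    by rewrite /r -[p.+1]addn1 -[q'.+1]addn1 !PoszD !opprD; ring.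
  by move=> X Y c sc; rewrite dxy //; apply/esym/diff0_scale.
have [u [v [oku okv dv xE]]] := closed_killed d_sq0 (okz p q) dx oky dy.
have [w1 ok1 [v1 e1]] := lift_diff0 oku.
have [w2 ok2 [v2 e2]] := lift_diff1 okv dv.
exists (fun p X Y c => 1 *: w1 p X Y c + w2 p X Y c); first exact: is_TC_comb.
move=> p' X Y c h; rewrite (@tdiff_lin _ _ _ sg 1 _ _ w1 w2) // scale1r.
have [lp|] := ltnP p' p.
  by rewrite vz ?v1 ?v2 ?addr0 //; case: h => [h|[h _]]; auto.
rewrite leq_eqVlt => /orP[/eqP e|lp].
  subst p'; case: h => [h|[/eqP h _]]; first by rewrite vz ?v1 ?v2 ?addr0 //; left.
  move: h; rewrite eqn_add2l => /eqP sc.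
  by rewrite e1 // e2 // xE // -opprD subrr.
by case: h => [h|[_ h]]; [rewrite vz ?v1 ?v2 ?addr0 //; left|move: h; rewrite ltnS leqNgt lp].
Qed.

Lemma coboundary_add z w : is_TC (m - 1) w ->
  coboundary (fun p X Y c => z p X Y c + tdiff sg (m - 1) w c) -> coboundary z.
Proof.
move=> okw [w' okw' e]; exists (fun p X Y c => (-1) *: w p X Y c + w' p X Y c).
  exact: is_TC_comb.
move=> p X Y c; rewrite (@tdiff_lin _ _ _ sg (-1) _ _ w w') // scaleN1r -e.
by rewrite addrC addrK.
Qed.

(** The steps p = 0, ..., N clear the total arity N, since p cannot exceed p + q. Each step adds a
    coboundary, which keeps the cocycle condition by d^2 = 0. *)
Lemma vanish_descent N :
  (forall z, is_TC m z -> (forall p X Y (c : @chain k n fg p X Y), tdiff sg m z c = 0) ->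
     vanish N N.+1 z -> coboundary z) ->
  forall z, is_TC m z -> (forall p X Y (c : @chain k n fg p X Y), tdiff sg m z c = 0) ->
     vanish N 0 z -> coboundary z.
Proof.
move=> hN; suff h j p z : (p + j)%N = N.+1 -> is_TC m z ->
    (forall p X Y (c : @chain k n fg p X Y), tdiff sg m z c = 0) ->
    vanish N p z -> coboundary z by move=> z; exact: (h N.+1 0).
elim: j p z => [|j ih] p z e hz dz vz.
  by apply: hN => //; rewrite -e addn0.
have [|w okw vw] := coboundary_step _ hz dz vz; first by rewrite -ltnS -e addnS ltnS leq_addr.
apply: (coboundary_add okw); apply: (ih p.+1) => //; first by rewrite addSnnS.
  have := is_TC_tdiff sg okw; rewrite subrK => okdw.
  have := is_TC_comb 1 hz okdw; congr is_TC.
  do 4 (apply: functional_extensionality_dep => ?); rewrite scale1r //.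
move=> p' X Y c; rewrite tdiff_add dz add0r.
have := d_sq0 okw c; rewrite subrK; exact.
Qed.

Lemma vanish_coboundary N z : is_TC m z ->
  (forall p X Y (c : @chain k n fg p X Y), tdiff sg m z c = 0) -> vanish N 0 z ->
  coboundary z.
Proof.
elim: N z => [|N ih]; apply: vanish_descent => z hz dz vz.
  exists (fun p X Y c => 0); first exact: is_TC_zero.
  move=> p X Y c; rewrite tdiff_zero; apply: vz.
  case: p X Y c => [|p] X Y c; last by left; rewrite addSn.
  by case: (posnP (csize c)) => [->|h]; [right|left].
apply: ih => // p X Y c [|[_ //]]; rewrite leq_eqVlt => /orP[/eqP e|h].
  by apply: vz; right; rewrite e ltnS leq_addr.
by apply: vz; left.
Qed.

End Descent.

(* The signs in the differential are any signs such that d^2 = 0. *)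
Theorem proposition2p11 (k : fieldType) (char0 : [pchar k] =i pred0)
    (n : nat) (fg : bool) (sg : signs) (d_sq0 : @tdiff_sq0 k n fg sg) (m : int) :
  @TH_zero k n fg sg m.
Proof.
move=> z hz dz; have [N hN] := TC_finite hz.
apply: (vanish_coboundary d_sq0 (N := N)) => // p X Y c [|[_ //]]; exact: hN.
Qed.
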